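(* Let $G$ be a finitely generated abelian group, $\Bbbk$ a field with $\mathrm{char}\,\Bbbk\neq 2$, and $\phi$ a commutation factor on $G$ with values in $\Bbbk\setminus\{0\}$. Then the category $\mathrm{Hopf}_{\mathrm{coc}}(\mathrm{Vec}_G)$ of cocommutative color Hopf algebras is action representable and locally algebraically cartesian closed.
   Context: A commutation factor (skew-symmetric bicharacter) on an abelian group $G$ is a map $\phi:G\times G\to\Bbbk\setminus\{0\}$ with $\phi(gh,l)=\phi(g,l)\phi(h,l)$, $\phi(g,hl)=\phi(g,h)\phi(g,l)$ and $\phi(g,h)\phi(h,g)=1$ for all $g,h,l\in G$. $\mathrm{Vec}_G$ is the category of $G$-graded $\Bbbk$-vector spaces $V=\bigoplus_{g\in G}V_g$ and grading-preserving linear maps, with the usual tensor product, $(V\otimes W)_g=\bigoplus_{a\in G}V_a\otimes W_{a^{-1}g}$, unit $\Bbbk$ concentrated in degree $1_G$, the usual constraints, and symmetric braiding $c_{X,Y}(x\otimes y)=\phi(g,h)\,y\otimes x$ for $x\in X_g$, $y\in Y_h$. One writes $|x|$ for the degree of a homogeneous element and $\Delta(x)=x_1\otimes x_2$ (Sweedler notation, homogeneous terms); formulas are stated for homogeneous elements and extended linearly. A color Hopf algebra is a Hopf monoid in $\mathrm{Vec}_G$: a $G$-graded space $H$ which is an algebra and a coalgebra with grading-preserving structure maps $m,u,\Delta,\epsilon$, such that $\epsilon$ is an algebra map, $\Delta(1_H)=1_H\otimes 1_H$, $\Delta(ab)=\phi(|a_2|,|b_1|)a_1b_1\otimes a_2b_2$,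 and with a grading-preserving linear map $S:H\to H$ (antipode) satisfying $h_1S(h_2)=\epsilon(h)1_H=S(h_1)h_2$. Morphisms are grading-preserving maps of algebras and coalgebras. $H$ is cocommutative if $x_1\otimes x_2=\phi(|x_1|,|x_2|)x_2\otimes x_1$ for all $x\in H$. $\mathrm{Hopf}_{\mathrm{coc}}(\mathrm{Vec}_G)$ is the category of cocommutative color Hopf algebras and morphisms of color Hopf algebras. For a finitely complete category $\mathcal{C}$ and an object $Y$, $\mathrm{Pt}_Y(\mathcal{C})$ is the category of points over $Y$ (split epimorphisms with codomain $Y$ together with a chosen section). $\mathcal{C}$ is locally algebraically cartesian closed if for every $f:X\to Y$ in $\mathcal{C}$ the change-of-base (pullback) functor $f^*:\mathrm{Pt}_Y(\mathcal{C})\to\mathrm{Pt}_X(\mathcal{C})$ is a left adjoint (i.e. has a right adjoint). A semi-abelian category $\mathcal{C}$ is action representable if for every object $X$ the functor $\mathcal{C}^{\mathrm{op}}\to\mathrm{Set}$ sending $B$ to the set of internal actions of $B$ on $X$ (equivalently, of isomorphism classes of split extensions of $B$ with kernel $X$) is representable. Under the given hypotheses $\mathrm{Hopf}_{\mathrm{coc}}(\mathrm{Vec}_G)$ is semi-abelian. *)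

(* Defs.v *)
From HB Require Import structures.
From mathcomp Require Import all_boot all_order all_algebra.
From mathcomp Require Import mathcomp_extra boolp classical_sets functions.
From mathcomp Require Import cardinality fsbigop.

Set Implicit Arguments.
Unset Strict Implicit.
Unset Printing Implicit Defensive.

Import GRing.Theory.
Local Open Scope ring_scope.
Local Open Scope quotient_scope.

(* Formal sums of pairs, identified when every bilinear map to every vector
   space gives them the same value: this is the quotient of the free space on
   V x W characterised by the universal property of the tensor product, which
   is proved below (tlift_pure, tensor_ind). *)
Section Tensor.
Variables (k : fieldType) (V W : lmodType k).

Definition tsum (U : lmodType k) (b : V -> W -> U) (s : seq (V * W)) : U :=
  \sum_(p <- s) b p.1 p.2.

Definition teq (s t : seq (V * W)) : bool :=
  `[< forall (U : lmodType k) (b : {bilinear V -> W -> U}),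
        tsum b s = tsum b t >].

Lemma teq_refl : reflexive teq. Proof. by move=> s; apply/asboolP. Qed.
Lemma teq_sym : symmetric teq.
Proof. by move=> s t; apply/asboolP/asboolP => h U b. Qed.
Lemma teq_trans : transitive teq.
Proof.
by move=> s t u /asboolP h1 /asboolP h2; apply/asboolP => U b; rewrite h1.
Qed.
Canonical teq_equiv := EquivRel teq teq_refl teq_sym teq_trans.

Definition tensor := {eq_quot teq}.
HB.instance Definition _ := Choice.on tensor.
HB.instance Definition _ := EqQuotient.on tensor.

Lemma tensor_eqP (s t : seq (V * W)) :
  (forall (U : lmodType k) (b : {bilinear V -> W -> U}),
     tsum b s = tsum b t) <-> \pi_tensor s = \pi_tensor t.
Proof.
split; first by move=> h; apply/eqquotP/asboolP.
by move=> /eqquotP /asboolP.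
Qed.

Lemma tsum_repr (U : lmodType k) (b : {bilinear V -> W -> U}) s :
  tsum b (repr (\pi_tensor s)) = tsum b s.
Proof. exact: (proj2 (tensor_eqP _ s) (reprK _)). Qed.

Lemma tsum_cat (U : lmodType k) (b : V -> W -> U) s t :
  tsum b (s ++ t) = tsum b s + tsum b t.
Proof. exact: big_cat. Qed.

Definition tscale_seq (a : k) (s : seq (V * W)) := [seq (a *: p.1, p.2) | p <- s].

Lemma tsum_scale (U : lmodType k) (b : {bilinear V -> W -> U}) a s :
  tsum b (tscale_seq a s) = a *: tsum b s.
Proof.
by rewrite /tsum big_map scaler_sumr; apply: eq_bigr => p _; rewrite linearZl_LR.
Qed.

Definition tzero : tensor := \pi_tensor [::].
Definition tadd (s t : tensor) : tensor := \pi_tensor (repr s ++ repr t).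
Definition tscale (a : k) (s : tensor) : tensor :=
  \pi_tensor (tscale_seq a (repr s)).
Definition topp (s : tensor) : tensor := tscale (-1) s.

Definition tval (U : lmodType k) (b : {bilinear V -> W -> U}) (t : tensor) : U :=
  tsum b (repr t).

Lemma tval_ext (s t : tensor) :
  (forall (U : lmodType k) (b : {bilinear V -> W -> U}), tval b s = tval b t) ->
  s = t.
Proof. by move=> h; rewrite -[s]reprK -[t]reprK; apply/tensor_eqP. Qed.

Lemma tval0 (U : lmodType k) (b : {bilinear V -> W -> U}) : tval b tzero = 0.
Proof. by rewrite /tval tsum_repr /tsum big_nil. Qed.

Lemma tvalD (U : lmodType k) (b : {bilinear V -> W -> U}) s t :
  tval b (tadd s t) = tval b s + tval b t.
Proof. by rewrite /tval tsum_repr tsum_cat. Qed.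

Lemma tvalZ (U : lmodType k) (b : {bilinear V -> W -> U}) a s :
  tval b (tscale a s) = a *: tval b s.
Proof. by rewrite /tval tsum_repr tsum_scale. Qed.

Fact taddA : associative tadd.
Proof. by move=> s t u; apply: tval_ext => U b; rewrite !tvalD addrA. Qed.
Fact taddC : commutative tadd.
Proof. by move=> s t; apply: tval_ext => U b; rewrite !tvalD addrC. Qed.
Fact tadd0 : left_id tzero tadd.
Proof. by move=> s; apply: tval_ext => U b; rewrite tvalD tval0 add0r. Qed.
Fact taddN : left_inverse tzero topp tadd.
Proof.
by move=> s; apply: tval_ext => U b; rewrite tvalD tvalZ tval0 scaleN1r addNr.
Qed.

HB.instance Definition _ := GRing.isZmodule.Build tensor taddA taddC tadd0 taddN.

Fact tscaleA a b s : tscale a (tscale b s) = tscale (a * b) s.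
Proof. by apply: tval_ext => U f; rewrite !tvalZ scalerA. Qed.
Fact tscale1 : left_id 1 tscale.
Proof. by move=> s; apply: tval_ext => U f; rewrite tvalZ scale1r. Qed.
Fact tscaleDr : right_distributive tscale +%R.
Proof.
by move=> a s t; apply: tval_ext => U f; rewrite !(tvalZ, tvalD) scalerDr.
Qed.
Fact tscaleDl s : {morph tscale^~ s : a b / a + b}.
Proof.
by move=> a b; apply: tval_ext => U f; rewrite !(tvalZ, tvalD) scalerDl.
Qed.

HB.instance Definition _ :=
  GRing.Zmodule_isLmodule.Build k tensor tscaleA tscale1 tscaleDr tscaleDl.

Fact tval_linear (U : lmodType k) (b : {bilinear V -> W -> U}) : linear (tval b).
Proof. by move=> a s t; rewrite -tvalZ -tvalD. Qed.

HB.instance Definition _ (U : lmodType k) (b : {bilinear V -> W -> U}) :=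
  GRing.isLinear.Build k tensor U _ (tval b) (tval_linear b).

Definition tpure (x : V) (y : W) : tensor := \pi_tensor [:: (x, y)].

Lemma tval_pure (U : lmodType k) (b : {bilinear V -> W -> U}) x y :
  tval b (tpure x y) = b x y.
Proof. by rewrite /tval tsum_repr /tsum big_seq1. Qed.

Fact tpure_bilinear : bilinear_for *:%R *:%R tpure.
Proof.
split=> [y a x x'|x a y y']; apply: tval_ext => U b.
  by rewrite /= tval_linear !tval_pure linearPl.
by rewrite /= tval_linear !tval_pure linearPr.
Qed.

HB.instance Definition _ :=
  bilinear_isBilinear.Build k V W tensor _ _ tpure tpure_bilinear.

End Tensor.

Notation "x \ot y" := (tpure x y) (at level 40, left associativity) : ring_scope.

Definition tlift (k : fieldType) (V W U : lmodType k)
  (b : {bilinear V -> W -> U}) : {linear tensor V W -> U} := tval b.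

Lemma tlift_pure (k : fieldType) (V W U : lmodType k)
  (b : {bilinear V -> W -> U}) x y : tlift b (x \ot y) = b x y.
Proof. exact: tval_pure. Qed.

Lemma tensor_sum (k : fieldType) (V W : lmodType k) (t : tensor V W) :
  exists s : seq (V * W), t = \sum_(p <- s) p.1 \ot p.2.
Proof.
exists (repr t); apply: tval_ext => U b; rewrite linear_sum.
by apply: eq_bigr => p _; rewrite /= tval_pure.
Qed.

(* uniqueness half of the universal property *)
Lemma tensor_ind (k : fieldType) (V W U : lmodType k)
  (f g : {linear tensor V W -> U}) :
  (forall x y, f (x \ot y) = g (x \ot y)) -> f =1 g.
Proof.
by move=> h t; have [s ->] := tensor_sum t; rewrite !linear_sum; apply: eq_bigr.
Qed.

Section TensorMaps.
Variable k : fieldType.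

Section Map.
Variables (V W V' W' : lmodType k).
Variables (f : {linear V -> V'}) (g : {linear W -> W'}).
Definition tmap_bil (x : V) (y : W) : tensor V' W' := f x \ot g y.
Fact tmap_bilinear : bilinear_for *:%R *:%R tmap_bil.
Proof.
by split=> [y a x x'|x a y y']; rewrite /tmap_bil linearP ?linearPl ?linearPr.
Qed.
HB.instance Definition _ :=
  bilinear_isBilinear.Build k V W (tensor V' W') _ _ tmap_bil tmap_bilinear.
Definition tmap : {linear tensor V W -> tensor V' W'} := tlift tmap_bil.
Lemma tmap_pure x y : tmap (x \ot y) = f x \ot g y.
Proof. exact: tlift_pure. Qed.
End Map.

Section Assoc.
Variables (U V W : lmodType k).

Definition assoc_in (w : W) (u : U) (v : V) : tensor U (tensor V W) :=
  u \ot (v \ot w).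
Fact assoc_in_bilinear w : bilinear_for *:%R *:%R (assoc_in w).
Proof.
by split=> [v a u u'|u a v v']; rewrite /assoc_in ?linearPl ?linearPr.
Qed.
HB.instance Definition _ w :=
  bilinear_isBilinear.Build k U V _ _ _ (assoc_in w) (assoc_in_bilinear w).
Definition assoc_bil (t : tensor U V) (w : W) := tlift (assoc_in w) t.
Fact assoc_bilinear : bilinear_for *:%R *:%R assoc_bil.
Proof.
split=> [w a s t|t a w w']; first by rewrite /assoc_bil linearP.
have [s ->] := tensor_sum t; rewrite /assoc_bil !linear_sum /= scaler_sumr.
rewrite -big_split; apply: eq_bigr => p _ /=.
by rewrite !tval_pure /= /assoc_in !linearPr.
Qed.
HB.instance Definition _ :=
  bilinear_isBilinear.Build k _ _ _ _ _ assoc_bil assoc_bilinear.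
Definition tassoc : {linear tensor (tensor U V) W -> tensor U (tensor V W)} :=
  tlift assoc_bil.
Lemma tassoc_pure u v w : tassoc ((u \ot v) \ot w) = u \ot (v \ot w).
Proof. by rewrite tlift_pure /= /assoc_bil tlift_pure. Qed.

Definition unassoc_in (u : U) (v : V) (w : W) : tensor (tensor U V) W :=
  (u \ot v) \ot w.
Fact unassoc_in_bilinear u : bilinear_for *:%R *:%R (unassoc_in u).
Proof.
by split=> [w a v v'|v a w w'];
  rewrite /unassoc_in ?(linearPl, linearPr) // linearPr linearPl.
Qed.
HB.instance Definition _ u :=
  bilinear_isBilinear.Build k V W _ _ _ (unassoc_in u) (unassoc_in_bilinear u).
Definition unassoc_bil (u : U) (t : tensor V W) := tlift (unassoc_in u) t.
Fact unassoc_bilinear : bilinear_for *:%R *:%R unassoc_bil.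
Proof.
split=> [t a u u'|u a s t]; last by rewrite /unassoc_bil linearP.
have [s ->] := tensor_sum t; rewrite /unassoc_bil !linear_sum /= scaler_sumr.
rewrite -big_split; apply: eq_bigr => p _ /=.
by rewrite !tval_pure /= /unassoc_in !linearPl.
Qed.
HB.instance Definition _ :=
  bilinear_isBilinear.Build k _ _ _ _ _ unassoc_bil unassoc_bilinear.
Definition tunassoc : {linear tensor U (tensor V W) -> tensor (tensor U V) W} :=
  tlift unassoc_bil.
Lemma tunassoc_pure u v w : tunassoc (u \ot (v \ot w)) = (u \ot v) \ot w.
Proof. by rewrite tlift_pure /= /unassoc_bil tlift_pure. Qed.
End Assoc.

Section Algebra.
Variable A : algType k.
Definition mul_bil (x y : A) : A := x * y.
Fact mul_bilinear : bilinear_for *:%R *:%R mul_bil.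
Proof.
split=> [y a x x'|x a y y']; rewrite /mul_bil.
  by rewrite mulrDl -scalerAl.
by rewrite mulrDr -scalerAr.
Qed.
HB.instance Definition _ :=
  bilinear_isBilinear.Build k A A A _ _ mul_bil mul_bilinear.
Definition tmul : {linear tensor A A -> A} := tlift mul_bil.
Lemma tmul_pure x y : tmul (x \ot y) = x * y.
Proof. exact: tlift_pure. Qed.
End Algebra.

Section Unitors.
Variables (V W : lmodType k).
Definition counitl_bil (e : {scalar V}) (x : V) (y : W) : W := e x *: y.
Fact counitl_bilinear e : bilinear_for *:%R *:%R (counitl_bil e).
Proof.
split=> [y a x x'|x a y y']; rewrite /counitl_bil.
  by rewrite linearP scalerDl -scalerA.
by rewrite scalerDr /= !scalerA mulrC.
Qed.
HB.instance Definition _ e :=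
  bilinear_isBilinear.Build k _ _ _ _ _ (counitl_bil e) (counitl_bilinear e).
(* x \otimes y |-> e(x) y *)
Definition tcontractl e : {linear tensor V W -> W} := tlift (counitl_bil e).
Definition counitr_bil (e : {scalar W}) (x : V) (y : W) : V := e y *: x.
Fact counitr_bilinear e : bilinear_for *:%R *:%R (counitr_bil e).
Proof.
split=> [y a x x'|x a y y']; rewrite /counitr_bil.
  by rewrite scalerDr /= !scalerA mulrC.
by rewrite linearP scalerDl -scalerA.
Qed.
HB.instance Definition _ e :=
  bilinear_isBilinear.Build k _ _ _ _ _ (counitr_bil e) (counitr_bilinear e).
(* x \otimes y |-> e(y) x *)
Definition tcontractr e : {linear tensor V W -> V} := tlift (counitr_bil e).
End Unitors.

End TensorMaps.

Arguments tassoc {k U V W}.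
Arguments tunassoc {k U V W}.
Arguments tmul {k A}.
Arguments tcontractl {k V W}.
Arguments tcontractr {k V W}.

(* The grading group G is written additively. *)
Section Graded.
Variables (G : zmodType) (k : fieldType).

Definition finitely_generated : Prop :=
  exists s : seq G, forall g, exists c : G -> int, g = \sum_(x <- s) x *~ c x.

Record commutation_factor (phi : G -> G -> k) : Prop := CommutationFactor {
  cf_neq0 : forall g h, phi g h != 0;
  cf_mull : forall g h l, phi (g + h) l = phi g l * phi h l;
  cf_mulr : forall g h l, phi g (h + l) = phi g h * phi g l;
  cf_skew : forall g h, phi g h * phi h g = 1
}.

(* V is the internal direct sum of the subspaces deg g *)
Record is_grading (V : lmodType k) (deg : G -> set V) : Prop := IsGrading {
  deg_lin : forall g a x y, deg g x -> deg g y -> deg g (a *: x + y);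
  deg_decomp : forall x, exists! f : G -> V,
    [/\ finite_set [set g | f g != 0], forall g, deg g (f g)
      & x = \sum_(g \in [set: G]) f g]
}.

Record gvect := GVect {
  gv_car :> lmodType k;
  gv_deg : G -> set gv_car;
  gv_grading : is_grading gv_deg
}.

Section Components.
Variable V : gvect.

Lemma gcomp_ex (x : V) : exists f : G -> V,
  [/\ finite_set [set g | f g != 0], forall g, gv_deg g (f g)
    & x = \sum_(g \in [set: G]) f g].
Proof. by have [f [hf _]] := deg_decomp (gv_grading V) x; exists f. Qed.

Definition gcomp (x : V) : G -> V := projT1 (cid (gcomp_ex x)).

Lemma gcompP (x : V) :
  [/\ finite_set [set g | gcomp x g != 0], forall g, gv_deg g (gcomp x g)
    & x = \sum_(g \in [set: G]) gcomp x g].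
Proof. exact: projT2 (cid (gcomp_ex x)). Qed.

Lemma gcomp_uniq (x : V) (f : G -> V) :
  finite_set [set g | f g != 0] -> (forall g, gv_deg g (f g)) ->
  x = \sum_(g \in [set: G]) f g -> gcomp x = f.
Proof.
move=> h1 h2 h3; have [f' [_ hu]] := deg_decomp (gv_grading V) x.
by rewrite -(hu _ (gcompP x)); apply: hu.
Qed.

Lemma deg0 g : gv_deg g (0 : V).
Proof.
have [_ h _] := gcompP 0.
by have := deg_lin (gv_grading V) (-1) (h g) (h g); rewrite scaleN1r addNr.
Qed.

Lemma fsum_finE (U : lmodType k) (A : set G) (F : G -> U) :
  finite_set A -> (forall g, ~ A g -> F g = 0) ->
  \sum_(g \in [set: G]) F g = \sum_(g <- finmap.enum_fset (fset_set A)) F g.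
Proof.
move=> fA h; rewrite -fsbig_finite //; apply/esym/fsbig_widen => //.
by move=> g [_ /h].
Qed.

Lemma fsum_single (U : lmodType k) (g : G) (F : G -> U) :
  (forall h, h != g -> F h = 0) -> \sum_(h \in [set: G]) F h = F g.
Proof.
move=> h; rewrite -[RHS](fsbig_set1 +%R g F); apply/esym/fsbig_widen => //.
by move=> i [_ /= /eqP /h].
Qed.

Lemma fsum_linear (U : lmodType k) a (F F' : G -> U) :
  finite_set [set g | F g != 0] -> finite_set [set g | F' g != 0] ->
  \sum_(g \in [set: G]) (a *: F g + F' g) =
  a *: \sum_(g \in [set: G]) F g + \sum_(g \in [set: G]) F' g.
Proof.
move=> f1 f2; pose A := ([set g | F g != 0] `|` [set g | F' g != 0])%classic.
have fA : finite_set A by rewrite finite_setU.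
have z1 g : ~ A g -> F g = 0.
  by move=> h; apply/eqP/negPn/negP => n; apply: h; left.
have z2 g : ~ A g -> F' g = 0.
  by move=> h; apply/eqP/negPn/negP => n; apply: h; right.
rewrite !(@fsum_finE _ A) //; last by move=> g n; rewrite z1 // z2 // scaler0 addr0.
by rewrite big_split scaler_sumr.
Qed.

Lemma gcomp_linear g : linear (gcomp^~ g).
Proof.
move=> a x y /=; have [f1 d1 s1] := gcompP x; have [f2 d2 s2] := gcompP y.
rewrite (@gcomp_uniq _ (fun g => a *: gcomp x g + gcomp y g)) //.
- apply: (@sub_finite_set _ _
    ([set g | gcomp x g != 0] `|` [set g | gcomp y g != 0])%classic).
    move=> h /= hn; apply: contrapT => /not_orP [/negP /negPn /eqP e1].
    by move=> /negP /negPn /eqP e2; move: hn; rewrite e1 e2 scaler0 addr0 eqxx.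
  by rewrite finite_setU.
- by move=> h; apply: (deg_lin (gv_grading V)).
- by rewrite fsum_linear // -s1 -s2.
Qed.

Lemma gcomp_homog g (x : V) : gv_deg g x ->
  gcomp x = (fun h => if h == g then x else 0).
Proof.
move=> hx; apply: gcomp_uniq => [|h|].
- apply: (@sub_finite_set _ _ [set g]%classic); last exact: finite_set1.
  by move=> h /=; case: (h =P g) => // _; rewrite eqxx.
- by case: eqP => [->|_] //; exact: deg0.
- by rewrite (@fsum_single _ g) ?eqxx // => h /negPf ->.
Qed.

End Components.

Section Braiding.
Variables (phi : G -> G -> k) (V W : gvect).

Definition braid_bil (x : V) (y : W) : tensor W V :=
  \sum_(g \in [set: G]) \sum_(h \in [set: G])
     phi g h *: (gcomp y h \ot gcomp x g).

Lemma braid_fin1 (x : V) (y : W) g :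
  finite_set [set h | phi g h *: (gcomp y h \ot gcomp x g) != 0].
Proof.
have [fy _ _] := gcompP y; apply: sub_finite_set fy => h /=.
by apply: contra_neq => ->; rewrite linear0l scaler0.
Qed.

Lemma braid_fin2 (x : V) (y : W) : finite_set [set g |
  \sum_(h \in [set: G]) phi g h *: (gcomp y h \ot gcomp x g) != 0].
Proof.
have [fx _ _] := gcompP x; apply: sub_finite_set fx => g /=.
apply: contra_neq => ->; apply: fsbig1 => h _.
by rewrite linear0r scaler0.
Qed.

Fact braid_bilinear : bilinear_for *:%R *:%R braid_bil.
Proof.
split=> [y a x x'|x a y y']; rewrite /braid_bil /= -fsum_linear;
  try exact: braid_fin2; apply: eq_fsbigr => g _;
  rewrite -fsum_linear; try exact: braid_fin1; apply: eq_fsbigr => h _.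
  by rewrite gcomp_linear linearPr scalerDr !scalerA mulrC.
by rewrite gcomp_linear linearPl scalerDr !scalerA mulrC.
Qed.
HB.instance Definition _ :=
  bilinear_isBilinear.Build k V W (tensor W V) _ _ braid_bil braid_bilinear.

Definition braid : {linear tensor V W -> tensor W V} := tlift braid_bil.

Lemma braid_homog g h x y : gv_deg g x -> gv_deg h y ->
  braid (x \ot y) = phi g h *: (y \ot x).
Proof.
move=> hx hy; rewrite tlift_pure /= /braid_bil (gcomp_homog hx) (gcomp_homog hy).
rewrite (@fsum_single _ g) => [|g' /negPf ->]; last first.
  by apply: fsbig1 => h' _; rewrite linear0r scaler0.
rewrite (@fsum_single _ h) ?eqxx // => h' /negPf ->.
by rewrite linear0l scaler0.
Qed.

(* the grading of V \otimes W: degree g is the sum over a of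
   V_a \otimes W_(g - a) *)
Definition tensor_deg (g : G) : set (tensor V W) :=
  [set t | exists2 s : seq (V * W), t = \sum_(p <- s) p.1 \ot p.2 &
     forall p, p \in s -> exists a, gv_deg a p.1 /\ gv_deg (g - a) p.2].

End Braiding.

(* (A \otimes B) \otimes (C \otimes D) -> (A \otimes C) \otimes (B \otimes D),
   braiding B past C *)
Definition tmiddle (phi : G -> G -> k) (A : lmodType k) (B C : gvect)
    (D : lmodType k) :
    {linear tensor (tensor A B) (tensor C D) ->
            tensor (tensor A C) (tensor B D)} :=
  tunassoc
  \o (tmap idfun (tassoc \o (tmap (braid phi B C) idfun \o tunassoc))
      \o tassoc).

Record galg := GAlg {
  ga_alg :> algType k;
  ga_deg : G -> set ga_alg;
  ga_grading : is_grading ga_deg;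
  ga_deg1 : ga_deg 0 1;
  ga_degM : forall g h x y,
    ga_deg g x -> ga_deg h y -> ga_deg (g + h) (x * y)
}.

Definition ga_gvect (A : galg) : gvect := GVect (ga_grading A).

Variable phi : G -> G -> k.

(* the product (a \otimes b)(c \otimes d) = phi(|b|,|c|) ac \otimes bd of the
   color algebra A \otimes A *)
Definition color_mul (A : galg) (s t : tensor A A) : tensor A A :=
  tmap tmul tmul
    (tmiddle phi (ga_gvect A) (ga_gvect A) (ga_gvect A) (ga_gvect A) (s \ot t)).

Lemma color_mulE (A : galg) g h (a b c d : A) :
  ga_deg g b -> ga_deg h c ->
  color_mul (a \ot b) (c \ot d) = phi g h *: ((a * c) \ot (b * d)).
Proof.
move=> hb hc; rewrite /color_mul /tmiddle /= tassoc_pure tmap_pure /=.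
rewrite tunassoc_pure tmap_pure (@braid_homog _ _ _ g h) //= linearZl_LR linearZ.
rewrite tassoc_pure linearZr_LR linearZ /= tunassoc_pure linearZ /= tmap_pure.
by rewrite !tmul_pure.
Qed.

Record color_hopf := ColorHopf {
  ch_alg :> galg;
  comul : {linear ch_alg -> tensor ch_alg ch_alg};
  counit : {scalar ch_alg};
  antipode : {linear ch_alg -> ch_alg};
  comul_deg : forall g x, ga_deg g x ->
    @tensor_deg (ga_gvect ch_alg) (ga_gvect ch_alg) g (comul x);
  counit_deg : forall g x, ga_deg g x -> g != 0 -> counit x = 0;
  antipode_deg : forall g x, ga_deg g x -> ga_deg g (antipode x);
  comulA : forall x,
    tassoc (tmap comul idfun (comul x)) = tmap idfun comul (comul x);
  comul_counitl : forall x, tcontractl counit (comul x) = x;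
  comul_counitr : forall x, tcontractr counit (comul x) = x;
  counit1 : counit 1 = 1;
  counitM : forall x y : ch_alg, counit (x * y) = counit x * counit y;
  comul1 : comul 1 = 1 \ot 1;
  comulM : forall x y : ch_alg, comul (x * y) = color_mul (comul x) (comul y);
  antipoder : forall x, tmul (tmap idfun antipode (comul x)) = counit x *: 1;
  antipodel : forall x, tmul (tmap antipode idfun (comul x)) = counit x *: 1
}.

Definition cocommutative (H : color_hopf) : Prop :=
  forall x : H, braid phi (ga_gvect H) (ga_gvect H) (comul H x) = comul H x.

Record color_hom (H K : color_hopf) := ColorHom {
  ch_fun :> {lrmorphism H -> K};
  ch_fun_deg : forall g x, ga_deg g x -> ga_deg g (ch_fun x);
  ch_fun_comul : forall x, comul K (ch_fun x) = tmap ch_fun ch_fun (comul H x);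
  ch_fun_counit : forall x, counit K (ch_fun x) = counit H x
}.

Lemma lrmorphism_eq (A B : algType k) (f g : {lrmorphism A -> B}) :
  f =1 g -> f = g.
Proof.
case: f g => f [[p] [q] [r]] [g [[p'] [q'] [r']]] /= /funext e.
case: _ / e in p' q' r' *.
by rewrite (Prop_irrelevance p p') (Prop_irrelevance q q') (Prop_irrelevance r r').
Qed.

Lemma color_hom_eq (H K : color_hopf) (f g : color_hom H K) : f =1 g -> f = g.
Proof.
case: f g => [f f1 f2 f3] [g g1 g2 g3] /= /lrmorphism_eq e.
by case: _ / e in g1 g2 g3 *; congr ColorHom; apply: Prop_irrelevance.
Qed.

End Graded.

Record category := Category {
  cobj :> Type;
  hom : cobj -> cobj -> Type;
  idc : forall X, hom X X;
  comp : forall X Y Z, hom Y Z -> hom X Y -> hom X Z;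
  compA : forall X Y Z T (h : hom Z T) (g : hom Y Z) (f : hom X Y),
    comp h (comp g f) = comp (comp h g) f;
  comp1f : forall X Y (f : hom X Y), comp (idc Y) f = f;
  compf1 : forall X Y (f : hom X Y), comp f (idc X) = f
}.
Arguments hom {c} X Y.
Arguments idc {c} X.
Notation "g \oc f" := (comp g f) (at level 50, left associativity).

Record functor (C D : category) := Functor {
  fobj :> C -> D;
  fmap : forall X Y, hom X Y -> hom (fobj X) (fobj Y);
  fmap1 : forall X, fmap (idc X) = idc (fobj X);
  fmapM : forall X Y Z (g : hom Y Z) (f : hom X Y),
    fmap (g \oc f) = fmap g \oc fmap f
}.

(* functors from the opposite of C to sets *)
Record presheaf (C : category) := Presheaf {
  psh :> C -> Type;
  pmap : forall X Y, hom X Y -> psh Y -> psh X;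
  pmap1 : forall X (x : psh X), pmap (idc X) x = x;
  pmapM : forall X Y Z (g : hom Y Z) (f : hom X Y) (x : psh Z),
    pmap (g \oc f) x = pmap f (pmap g x)
}.

Definition is_iso (C : category) (X Y : C) (f : hom X Y) : Prop :=
  exists g : hom Y X, g \oc f = idc X /\ f \oc g = idc Y.

Definition representable (C : category) (F : presheaf C) : Prop :=
  exists (A : C) (eta : forall B, hom B A -> F B),
    (forall B, bijective (eta B)) /\
    (forall B B' (f : hom B' B) (u : hom B A),
       eta B' (u \oc f) = pmap f (eta B u)).

Definition is_left_adjoint (C D : category) (F : functor C D) : Prop :=
  exists (R : functor D C)
         (Phi : forall X Y, hom (F X) Y -> hom X (R Y)),
    (forall X Y, bijective (@Phi X Y)) /\
    (forall X X' Y Y' (v : hom X' X) (w : hom Y Y') (f : hom (F X) Y),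
       Phi X' Y' (w \oc f \oc fmap F v) = fmap R w \oc Phi X Y f \oc v).

Section CategoryTheory.
Variable C : category.

Record zero_object := ZeroObject {
  zobj :> C;
  to_zero : forall X : C, hom X zobj;
  from_zero : forall X : C, hom zobj X;
  to_zero_uniq : forall (X : C) (f g : hom X zobj), f = g;
  from_zero_uniq : forall (X : C) (f g : hom zobj X), f = g
}.

Definition zero_mor (Z : zero_object) (X Y : C) : hom X Y :=
  from_zero Z Y \oc to_zero Z X.

Lemma zero_comp (Z : zero_object) (X Y T : C) (f : hom X Y) :
  zero_mor Z Y T \oc f = zero_mor Z X T.
Proof. by rewrite /zero_mor -compA; congr comp; apply: to_zero_uniq. Qed.

Lemma comp_zero (Z : zero_object) (X Y T : C) (f : hom Y T) :
  f \oc zero_mor Z X Y = zero_mor Z X T.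
Proof. by rewrite /zero_mor compA; congr comp; apply: from_zero_uniq. Qed.

Definition is_kernel (Z : zero_object) (X A B : C) (m : hom X A) (p : hom A B) :=
  p \oc m = zero_mor Z X B /\
  forall (T : C) (g : hom T A), p \oc g = zero_mor Z T B ->
    exists! h : hom T X, m \oc h = g.

Record pullback (X Y Z : C) (f : hom X Z) (g : hom Y Z) := Pullback {
  pb_obj :> C;
  pb1 : hom pb_obj X;
  pb2 : hom pb_obj Y;
  pb_sq : f \oc pb1 = g \oc pb2;
  pb_univ : forall (T : C) (a : hom T X) (b : hom T Y), f \oc a = g \oc b ->
    exists! u : hom T pb_obj, pb1 \oc u = a /\ pb2 \oc u = b
}.

Definition finitely_complete : Prop :=
  (exists T : C, forall X : C, exists! f : hom X T, True) /\
  (forall (X Y Z : C) (f : hom X Z) (g : hom Y Z), inhabited (pullback f g)).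

Definition pullback_choice :=
  forall (X Y Z : C) (f : hom X Z) (g : hom Y Z), pullback f g.

Section Pairing.
Variables (X Y Z : C) (f : hom X Z) (g : hom Y Z) (P : pullback f g).

Lemma pb_pair_ex (T : C) (a : hom T X) (b : hom T Y) : f \oc a = g \oc b ->
  exists u : hom T P, pb1 P \oc u = a /\ pb2 P \oc u = b.
Proof. by move=> /(pb_univ P) [u [hu _]]; exists u. Qed.

Definition pb_pair (T : C) (a : hom T X) (b : hom T Y)
  (e : f \oc a = g \oc b) : hom T P := projT1 (cid (pb_pair_ex e)).

Lemma pb_pair1 T (a : hom T X) (b : hom T Y) e : pb1 P \oc @pb_pair T a b e = a.
Proof. exact: proj1 (projT2 (cid (pb_pair_ex e))). Qed.

Lemma pb_pair2 T (a : hom T X) (b : hom T Y) e : pb2 P \oc @pb_pair T a b e = b.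
Proof. exact: proj2 (projT2 (cid (pb_pair_ex e))). Qed.

Lemma pb_ext T (u v : hom T P) :
  pb1 P \oc u = pb1 P \oc v -> pb2 P \oc u = pb2 P \oc v -> u = v.
Proof.
move=> e1 e2; have /(pb_univ P) [w [_ hw]] :
  f \oc (pb1 P \oc v) = g \oc (pb2 P \oc v) by rewrite !compA pb_sq.
by rewrite -(hw u) // -(hw v).
Qed.

End Pairing.

Section Points.
Variable Y : C.

Record point := Point {
  pt_obj :> C;
  pt_proj : hom pt_obj Y;
  pt_sec : hom Y pt_obj;
  pt_split : pt_proj \oc pt_sec = idc Y
}.

Record pt_hom (P Q : point) := PtHom {
  pth :> hom P Q;
  pth_proj : pt_proj Q \oc pth = pt_proj P;
  pth_sec : pth \oc pt_sec P = pt_sec Q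
}.

Lemma pt_hom_eq (P Q : point) (f g : pt_hom P Q) : pth f = pth g -> f = g.
Proof.
case: f g => f f1 f2 [g g1 g2] /= e; case: _ / e in g1 g2 *.
by rewrite (Prop_irrelevance f1 g1) (Prop_irrelevance f2 g2).
Qed.

Definition pt_id (P : point) : pt_hom P P :=
  PtHom (compf1 (pt_proj P)) (comp1f (pt_sec P)).

Program Definition pt_comp (P Q R : point) (g : pt_hom Q R) (f : pt_hom P Q) :
  pt_hom P R := @PtHom P R (g \oc f) _ _.
Next Obligation. by rewrite compA !pth_proj. Qed.
Next Obligation. by rewrite -compA !pth_sec. Qed.

Program Definition Pt : category := @Category point pt_hom pt_id pt_comp _ _ _.
Next Obligation. by apply: pt_hom_eq; apply: compA. Qed.
Next Obligation. by apply: pt_hom_eq; apply: comp1f. Qed.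
Next Obligation. by apply: pt_hom_eq; apply: compf1. Qed.

End Points.

Section BaseChange.
Variables (pb : pullback_choice) (X Y : C) (f : hom X Y).

Lemma bc_sec_subproof (P : point Y) : f \oc idc X = pt_proj P \oc (pt_sec P \oc f).
Proof. by rewrite compA pt_split comp1f compf1. Qed.

Definition bc_obj (P : point Y) : point X :=
  @Point X (pb f (pt_proj P)) (pb1 _)
    (pb_pair (pb f (pt_proj P)) (bc_sec_subproof P)) (pb_pair1 _ _).

Lemma bc_map_subproof (P Q : point Y) (h : pt_hom P Q) :
  f \oc pb1 (pb f (pt_proj P)) = pt_proj Q \oc (h \oc pb2 (pb f (pt_proj P))).
Proof. by rewrite compA pth_proj pb_sq. Qed.

Program Definition bc_map (P Q : point Y) (h : pt_hom P Q) :
    pt_hom (bc_obj P) (bc_obj Q) :=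
  @PtHom X (bc_obj P) (bc_obj Q)
    (pb_pair (pb f (pt_proj Q)) (bc_map_subproof h)) _ _.
Next Obligation. exact: pb_pair1. Qed.
Next Obligation.
apply: pb_ext; rewrite compA !(pb_pair1, pb_pair2) //.
rewrite -compA; apply: etrans (congr1 (comp h) (pb_pair2 _ _)) _.
by rewrite compA pth_sec.
Qed.

Program Definition base_change : functor (Pt Y) (Pt X) :=
  @Functor (Pt Y) (Pt X) bc_obj bc_map _ _.
Next Obligation.
by apply: pt_hom_eq; apply: pb_ext => /=;
  rewrite !(pb_pair1, pb_pair2) !compf1 ?comp1f.
Qed.
Next Obligation.
apply: pt_hom_eq; apply: pb_ext => /=; rewrite !compA !(pb_pair1, pb_pair2) //.
rewrite -!compA; congr comp; apply/esym.
exact: pb_pair2.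
Qed.

End BaseChange.

(* Up to isomorphism base_change does not depend on pb, and finite completeness
   provides one: quantifying over all choices is neither vacuous nor stronger
   than fixing one. *)
Definition locally_algebraically_cartesian_closed : Prop :=
  finitely_complete /\
  forall (pb : pullback_choice) (X Y : C) (f : hom X Y),
    is_left_adjoint (base_change pb f).

Section SplitExtensions.
Variables (Z : zero_object) (pb : pullback_choice) (X : C).

Record splext (B : C) := SplExt {
  se_pt :> point B;
  se_ker : hom X se_pt;
  se_is_ker : is_kernel Z se_ker (pt_proj se_pt)
}.

Definition splext_iso (B : C) (E E' : splext B) : Prop :=
  exists u : pt_hom E E',
    is_iso (C := Pt B) u /\ pth u \oc se_ker E = se_ker E'.

Section Pull.
Variables (B B' : C) (f : hom B' B) (E : splext B).

Lemma se_pull_subproof :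
  f \oc zero_mor Z X B' = pt_proj E \oc se_ker E.
Proof. by rewrite comp_zero (proj1 (se_is_ker E)). Qed.

Lemma se_pull_ker :
  is_kernel Z (pb_pair (pb f (pt_proj E)) se_pull_subproof)
    (pt_proj (bc_obj pb f E)).
Proof.
split=> [|T g /= hg]; first exact: pb_pair1.
have e : pt_proj E \oc (pb2 _ \oc g) = zero_mor Z T B.
  by rewrite compA -pb_sq -compA hg comp_zero.
have [h [hh hu]] := proj2 (se_is_ker E) _ _ e.
exists h; split=> [|h' eh'].
  by apply: pb_ext; rewrite compA !(pb_pair1, pb_pair2) // zero_comp hg.
by apply: hu; rewrite -eh' compA pb_pair2.
Qed.

Definition se_pull : splext B' := @SplExt B' (bc_obj pb f E) _ se_pull_ker.

End Pull.

(* h : E' -> E exhibits E' as a pullback of E along f *)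
Record se_cart (B B' : C) (f : hom B' B) (E' : splext B') (E : splext B)
    (h : hom E' E) : Prop := SeCart {
  sc_proj : f \oc pt_proj E' = pt_proj E \oc h;
  sc_sec : h \oc pt_sec E' = pt_sec E \oc f;
  sc_ker : h \oc se_ker E' = se_ker E;
  sc_univ : forall (T : C) (a : hom T B') (b : hom T E),
    f \oc a = pt_proj E \oc b ->
    exists! u : hom T E', pt_proj E' \oc u = a /\ h \oc u = b
}.

Lemma sc_ext (B B' : C) (f : hom B' B) (E' : splext B') (E : splext B)
    (h : hom E' E) (hc : se_cart f h) (T : C) (u v : hom T E') :
  pt_proj E' \oc u = pt_proj E' \oc v -> h \oc u = h \oc v -> u = v.
Proof.
move=> e1 e2; have /(sc_univ hc) [w [_ hw]] :
  f \oc (pt_proj E' \oc v) = pt_proj E \oc (h \oc v).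
  by rewrite !compA (sc_proj hc).
by rewrite -(hw u) // -(hw v).
Qed.

Lemma se_pull_cart (B B' : C) (f : hom B' B) (E : splext B) :
  se_cart (E' := se_pull f E) f (pb2 (pb f (pt_proj E))).
Proof.
split=> [|||T a b e]; [exact: pb_sq|exact: pb_pair2|exact: pb_pair2|].
exact: pb_univ.
Qed.

Lemma se_cart_id (B : C) (E : splext B) : se_cart (E' := E) (idc B) (idc E).
Proof.
split; rewrite ?comp1f ?compf1 // => T a b; rewrite comp1f => ->.
by exists b; split=> [|u [_]]; rewrite comp1f.
Qed.

Lemma se_cart_comp (B B' B'' : C) (f : hom B' B) (g : hom B'' B')
    (E : splext B) (E' : splext B') (E'' : splext B'')
    (h : hom E' E) (l : hom E'' E') :
  se_cart f h -> se_cart g l -> se_cart (E' := E'') (f \oc g) (h \oc l).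
Proof.
move=> hf hg; split=> [|||T a b e].
- by rewrite -compA (sc_proj hg) !compA (sc_proj hf).
- by rewrite -compA (sc_sec hg) !compA (sc_sec hf).
- by rewrite -compA (sc_ker hg) (sc_ker hf).
have [|u [[u1 u2] hu]] := sc_univ hf (a := g \oc a) (b := b).
  by rewrite compA.
have [|v [[v1 v2] hv]] := sc_univ hg (a := a) (b := u); first by rewrite u1.
exists v; split=> [|w [w1 w2]]; first by rewrite -compA v2.
apply: hv; split=> //; apply/esym/hu; split; last by rewrite compA.
by rewrite compA -(sc_proj hg) -compA w1.
Qed.

Lemma se_cart_iso (B B' : C) (f : hom B' B) (E : splext B) (E1 E2 : splext B')
    (h1 : hom E1 E) (h2 : hom E2 E) :
  se_cart f h1 -> se_cart f h2 -> splext_iso E1 E2.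
Proof.
have fact (F1 F2 : splext B') (l1 : hom F1 E) (l2 : hom F2 E) :
    se_cart f l1 -> se_cart f l2 ->
    exists2 u : pt_hom F1 F2, l2 \oc u = l1 & u \oc se_ker F1 = se_ker F2.
  move=> c1 c2; have [u [[u1 u2] _]] := sc_univ c2 (sc_proj c1).
  have us : u \oc pt_sec F1 = pt_sec F2.
    apply: (sc_ext c2); first by rewrite compA u1 !pt_split.
    by rewrite compA u2 (sc_sec c1) (sc_sec c2).
  exists (PtHom u1 us) => //=; apply: (sc_ext c2).
    by rewrite compA u1 (proj1 (se_is_ker F1)) (proj1 (se_is_ker F2)).
  by rewrite compA u2 (sc_ker c1) (sc_ker c2).
move=> c1 c2; have [u u1 u2] := fact _ _ _ _ c1 c2.
have [v v1 v2] := fact _ _ _ _ c2 c1.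
exists u; split=> //; exists v; split; apply: pt_hom_eq => /=.
  by apply: (sc_ext c1); rewrite compf1 compA ?v1 // !pth_proj.
by apply: (sc_ext c2); rewrite compf1 compA ?u1 // !pth_proj.
Qed.

Lemma splext_iso_cart (B : C) (E E' : splext B) :
  splext_iso E E' -> exists h : hom E E', se_cart (idc B) h.
Proof.
move=> [u [[v [/(congr1 (@pth _ _ _)) /= vu /(congr1 (@pth _ _ _)) /= uv] uk]]].
exists u; split=> //; rewrite ?comp1f ?compf1 ?pth_proj ?pth_sec //.
move=> T a b; rewrite comp1f => ->.
exists (pth v \oc b); split=> [|w [_ <-]].
  by rewrite !compA uv comp1f pth_proj.
by rewrite compA vu comp1f.
Qed.

Lemma splext_iso_refl (B : C) (E : splext B) : splext_iso E E.
Proof. exact: se_cart_iso (se_cart_id E) (se_cart_id E). Qed.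

Lemma splext_iso_sym (B : C) (E E' : splext B) :
  splext_iso E E' -> splext_iso E' E.
Proof. by move=> /splext_iso_cart [h]; apply: se_cart_iso (se_cart_id E'). Qed.

Lemma splext_iso_trans (B : C) (E E' E'' : splext B) :
  splext_iso E E' -> splext_iso E' E'' -> splext_iso E E''.
Proof.
move=> /splext_iso_cart [h hc] /splext_iso_cart [l lc].
have := se_cart_comp lc hc; rewrite comp1f => c.
exact: se_cart_iso c (se_cart_id E'').
Qed.

Lemma se_pull_iso (B B' : C) (f : hom B' B) (E E' : splext B) :
  splext_iso E E' -> splext_iso (se_pull f E) (se_pull f E').
Proof.
move=> /splext_iso_cart [h hc].
have := se_cart_comp hc (se_pull_cart f E); rewrite comp1f => c.
exact: se_cart_iso c (se_pull_cart f E').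
Qed.

Definition splext_class (B : C) : Type :=
  {c : splext B -> Prop | exists E, c = splext_iso E}.

Definition class_of (B : C) (E : splext B) : splext_class B :=
  exist _ (splext_iso E) (ex_intro _ E erefl).

Lemma class_ofP (B : C) (E E' : splext B) :
  class_of E = class_of E' <-> splext_iso E E'.
Proof.
split=> [/(congr1 sval) /= e|i].
  by rewrite e; exact: splext_iso_refl.
apply: eq_exist; apply: funext => F; apply: propext; split=> j.
  exact: splext_iso_trans (splext_iso_sym i) j.
exact: splext_iso_trans i j.
Qed.

Definition class_repr (B : C) (c : splext_class B) : splext B :=
  projT1 (cid (proj2_sig c)).

Lemma class_reprK (B : C) (c : splext_class B) : class_of (class_repr c) = c.
Proof.
rewrite /class_repr; case: c => c hc /=; case: cid => E /= e.
exact: eq_exist.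
Qed.

Definition splext_pmap (B B' : C) (f : hom B' B) (c : splext_class B) :
  splext_class B' := class_of (se_pull f (class_repr c)).

Lemma splext_pmapE (B B' : C) (f : hom B' B) (E : splext B) :
  splext_pmap f (class_of E) = class_of (se_pull f E).
Proof.
by apply/class_ofP/se_pull_iso/class_ofP; rewrite class_reprK.
Qed.

Fact splext_pmap1 (B : C) (c : splext_class B) : splext_pmap (idc B) c = c.
Proof.
rewrite -[in RHS](class_reprK c); apply/class_ofP.
exact: se_cart_iso (se_pull_cart _ _) (se_cart_id _).
Qed.

Fact splext_pmapM (B B' B'' : C) (g : hom B' B) (f : hom B'' B')
    (c : splext_class B) :
  splext_pmap (g \oc f) c = splext_pmap f (splext_pmap g c).
Proof.
rewrite -(class_reprK c) !splext_pmapE; apply/class_ofP.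
apply: se_cart_iso (se_pull_cart _ _) _.
exact: se_cart_comp (se_pull_cart _ _) (se_pull_cart _ _).
Qed.

(* the functor SplExt(-, X), acting on morphisms by pullback *)
Definition splext_presheaf : presheaf C :=
  @Presheaf C splext_class (fun B' B => @splext_pmap B B')
    splext_pmap1 (fun B'' B' B => @splext_pmapM B B' B'').

End SplitExtensions.

(* Isomorphism classes of split extensions of B with kernel X stand for the
   internal actions of B on X; pointedness and finite completeness are what the
   functor SplExt(-, X) needs in order to exist. *)
Definition action_representable : Prop :=
  [/\ inhabited zero_object, finitely_complete &
      forall (Z : zero_object) (pb : pullback_choice) (X : C),
        representable (splext_presheaf Z pb X)].

End CategoryTheory.

Section HopfCoc.
Variables (G : zmodType) (k : fieldType) (phi : G -> G -> k).

Record coc_hopf := CocHopf {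
  coc_car :> color_hopf phi;
  coc_cocomm : cocommutative coc_car
}.

Program Definition color_id (H : color_hopf phi) : color_hom H H :=
  @ColorHom _ _ _ H H idfun _ _ _.
Next Obligation.
by apply/esym; apply: (@tensor_ind _ _ _ _ (tmap idfun idfun) idfun) => a b;
  rewrite tmap_pure.
Qed.

Program Definition color_comp (H K L : color_hopf phi)
    (g : color_hom K L) (f : color_hom H K) : color_hom H L :=
  @ColorHom _ _ _ H L (g \o f) _ _ _.
Next Obligation. by do 2![apply: ch_fun_deg]. Qed.
Next Obligation.
rewrite !ch_fun_comul; move: (comul H x) => t.
by apply: (@tensor_ind _ _ _ _ (tmap g g \o tmap f f) (tmap (g \o f) (g \o f)))
  => a b /=; rewrite !tmap_pure.
Qed.
Next Obligation. by rewrite !ch_fun_counit. Qed.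

Program Definition Hopf_coc : category :=
  @Category coc_hopf (fun H K => color_hom H K) (fun H => color_id H)
    (fun H K L => @color_comp H K L) _ _ _.
Next Obligation. exact: color_hom_eq. Qed.
Next Obligation. exact: color_hom_eq. Qed.
Next Obligation. exact: color_hom_eq. Qed.

End HopfCoc.

(* Main.v *)
(* Cocommutative color Hopf algebras are the group objects of the category C of
   cocommutative color coalgebras, in which the product of T and S is T (x) S.
   The statement therefore follows from two facts.

   First, C has equalizers and exponentials. A functor F on C whose elements are
   separated by families of homogeneous functionals on T (the "letters") is
   represented by a coalgebra of functions on words: f in F(T) and t in T give
   the function sending l1 ... ln to the sum of the products l1(t_1) ... ln(t_n)
   over the iterated coproduct of t, and concatenation of words induces the
   coproduct.

   Second, group objects of a cartesian closed category with equalizers have the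
   two properties. The right adjoint of pullback along f : X -> Y sends a point
   Q of X, with kernel N, to the semidirect product of Y with the group of
   X-equivariant maps Y -> N; and split extensions with kernel X are classified
   by the automorphism group object of X, the universal one being the semidirect
   product of X with it. Both are computed with generalised elements. *)

From HB Require Import structures.
From mathcomp Require Import all_boot all_order all_algebra.
From mathcomp Require Import mathcomp_extra boolp classical_sets functions.
From mathcomp Require Import cardinality fsbigop.
From mathcomp Require Import ring.
Require Import Defs.

Set Implicit Arguments.
Unset Strict Implicit.
Unset Printing Implicit Defensive.

Import GRing.Theory.
Local Open Scope ring_scope.

(** * Linear maps on tensor products, and their gradings *)

(** The obstacle is the existence of large enough coalgebras: an object representing [F] has to
    receive morphisms from coalgebras of unbounded size. A morphism into it is determined by the
    values of words, so it can be looked for inside one fixed space, the functions on words, as the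
    span of all functions that occur. Coproduct, grading and axioms are then inherited from the
    coalgebras [T]; what remains is a universal element, and for this [F] must satisfy descent along
    jointly spanning families of morphisms ([gluing]).

    On the side of group objects, every group is described by conditions on T-points. Such a
    condition is an equation quantified over further generalised elements; an exponential turns it
    into a single equation, and an equalizer cuts out its solutions.

    The passage from Hopf algebras to group objects has one point that is not formal: the antipode
    is only assumed linear and graded, and must be shown to be a morphism of coalgebras. *)

Section Spanning.
Variable k : fieldType.

(** Phrased as an induction principle instead of through finite linear combinations: it applies
    directly to identities between linear maps and to existence statements that are stable under
    linear combinations. *)
Definition spanning (V : lmodType k) (P : set V) : Prop :=
  forall S : set V, S 0 -> (forall a x y, S x -> S y -> S (a *: x + y)) ->
  (forall x, P x -> S x) -> forall x, S x.

Lemma spanningT (V : lmodType k) : spanning (setT : set V).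
Proof. by move=> S _ _ h x; apply: h. Qed.

Lemma eq_spanning (V U : lmodType k) (P : set V) (f g : {linear V -> U}) :
  spanning P -> (forall x, P x -> f x = g x) -> f =1 g.
Proof.
move=> sP h; apply: sP => //; first by rewrite !linear0.
by move=> a x y; rewrite !linearP => -> ->.
Qed.

(** [F] and [F'] are the two sides as they appear in a goal; [f] and [g] are composites of linear
    maps agreeing with them, and serve only to witness linearity. [span_ext] has the same shape. *)
Lemma span_ext_scalar (V : lmodType k) (P : set V) (f g : {scalar V})
    (F F' : V -> k) :
  f =1 F -> g =1 F' -> spanning P -> (forall x, P x -> F x = F' x) ->
  forall x, F x = F' x.
Proof.
move=> eF eF' sP h x; rewrite -eF -eF'; move: x; apply: sP.
- by rewrite !linear0.
- by move=> a x y e1 e2; rewrite !linearP e1 e2.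
by move=> x Px; rewrite eF eF' h.
Qed.

Lemma span_ext (V U : lmodType k) (P : set V) (f g : {linear V -> U})
    (F F' : V -> U) :
  f =1 F -> g =1 F' -> spanning P -> (forall x, P x -> F x = F' x) ->
  forall x, F x = F' x.
Proof.
move=> eF eF' sP h x; rewrite -eF -eF'; apply: eq_spanning sP _ x => x Px.
by rewrite eF eF' h.
Qed.

Definition pures (V W : lmodType k) (P : set V) (Q : set W) : set (tensor V W) :=
  [set t | exists x y, [/\ P x, Q y & t = x \ot y]].

Lemma spanning_pures (V W : lmodType k) (P : set V) (Q : set W) :
  spanning P -> spanning Q -> spanning (pures P Q).
Proof.
move=> sP sQ S S0 SD h t; have [s ->] := tensor_sum t.
have SD1 x y : S x -> S y -> S (x + y) by rewrite -{2}[x]scale1r; apply: SD.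
apply: big_ind => //; case=> x y _ /=; move: x y.
apply: (sP (fun x => forall y, S (x \ot y))) => [y|a x x' hx hx' y|x hx].
- by rewrite linear0l.
- by rewrite linearPl; apply: (SD); [exact: hx|exact: hx'].
apply: (sQ (fun y => S (x \ot y))) => [|a y y' hy hy'|y hy].
- by rewrite linear0r.
- by rewrite linearPr; apply: (SD); [exact: hy|exact: hy'].
by apply: h; exists x, y.
Qed.

End Spanning.

Section Gradings.
Variables (G : zmodType) (k : fieldType).
Implicit Types V W : gvect G k.

Definition homog V : set V := [set x | exists g, gv_deg g x].

Lemma deg_scale V g a (x : V) : gv_deg g x -> gv_deg g (a *: x).
Proof.
move=> hx; rewrite -[_ *: _]addr0; apply: (deg_lin (gv_grading V)) => //.
exact: deg0.
Qed.

Lemma degD V g (x y : V) : gv_deg g x -> gv_deg g y -> gv_deg g (x + y).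
Proof.
by move=> hx hy; rewrite -[x]scale1r; apply: (deg_lin (gv_grading V)).
Qed.

Lemma homog_spanning V : spanning (@homog V).
Proof.
move=> S S0 SD h x; have [_ hd ->] := gcompP x.
have SD1 y z : S y -> S z -> S (y + z) by rewrite -{2}[y]scale1r; apply: SD.
by elim/big_ind: _ => // g _; apply: h; exists g; apply: hd.
Qed.

Lemma gcompP_deg V (x : V) g : gv_deg g (gcomp x g).
Proof. by have [_ h _] := gcompP x. Qed.

Definition gproj V g : V -> V := fun x => gcomp x g.
HB.instance Definition _ V g :=
  GRing.isLinear.Build k V V _ (@gproj V g) (@gcomp_linear G k V g).

(** A grading is obtained from its projections. Uniqueness of the decomposition holds because [p h],
    applied to any decomposition of [x] into homogeneous terms, leaves exactly the term of index
    [h]. *)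
Lemma mk_grading (V : lmodType k) (deg : G -> set V) (p : G -> {linear V -> V}) :
  (forall g a x y, deg g x -> deg g y -> deg g (a *: x + y)) ->
  (forall g x, deg g (p g x)) ->
  (forall g h x, deg g x -> p h x = if h == g then x else 0) ->
  (forall x, finite_set [set g | p g x != 0]) ->
  (forall x, x = \sum_(g \in [set: G]) p g x) ->
  is_grading deg.
Proof.
move=> dl dp pd pf ps; split=> // x; exists (fun g => p g x); split=> [|f].
  by split.
case=> ff fd fs; apply/funext => h.
pose A := [set g | f g != 0]%classic.
have z g : ~ A g -> f g = 0 by move=> hA; apply/eqP/negPn/negP.
rewrite [in LHS]fs (@fsum_finE G k V A) //.
rewrite linear_sum /=.
transitivity (\sum_(g <- finmap.enum_fset (fset_set A)) if h == g then f g else 0).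
  by apply: eq_bigr => g _; rewrite (pd g).
rewrite -(@fsum_finE G k V A (fun g => if h == g then f g else 0)) //.
  rewrite (@fsum_single G k _ h) ?eqxx // => g; by rewrite eq_sym => /negPf ->.
by move=> g /z ->; case: ifP.
Qed.

Lemma finite_supp_linear (U : lmodType k) a (F F' : G -> U) :
  finite_set [set g | F g != 0] -> finite_set [set g | F' g != 0] ->
  finite_set [set g | a *: F g + F' g != 0].
Proof.
move=> f1 f2; apply: (@sub_finite_set _ _
  ([set g | F g != 0] `|` [set g | F' g != 0])%classic); last by rewrite finite_setU.
move=> h /= hn; apply: contrapT => /not_orP [/negP /negPn /eqP e1].
move=> /negP /negPn /eqP e2; move: hn.
by rewrite e1 e2 scaler0 addr0 eqxx.
Qed.

(** * The grading of a tensor product *)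

Section TensorGrading.
Variables V W : gvect G k.

Definition tproj_bil g (x : V) (y : W) : tensor V W :=
  \sum_(a \in [set: G]) gcomp x a \ot gcomp y (g - a).

Lemma tproj_fin g (x : V) (y : W) : finite_set [set a | gcomp x a \ot gcomp y (g - a) != 0].
Proof.
have [fx _ _] := gcompP x; apply: sub_finite_set fx => a /=.
by apply: contra_neq => ->; rewrite linear0l.
Qed.

Fact tproj_bilinear g : bilinear_for *:%R *:%R (tproj_bil g).
Proof.
split=> [y a x x'|x a y y']; rewrite /tproj_bil /= -fsum_linear;
  try exact: tproj_fin; apply: eq_fsbigr => h _;
  by rewrite gcomp_linear ?linearPr ?linearPl.
Qed.
HB.instance Definition _ g :=
  bilinear_isBilinear.Build k V W (tensor V W) _ _ (tproj_bil g) (tproj_bilinear g).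
Definition tproj g : {linear tensor V W -> tensor V W} := tlift (tproj_bil g).

Lemma tproj_homog g a b (x : V) (y : W) : gv_deg a x -> gv_deg b y ->
  tproj g (x \ot y) = if g == a + b then x \ot y else 0.
Proof.
move=> hx hy; rewrite tlift_pure /= /tproj_bil (gcomp_homog hx) (gcomp_homog hy).
rewrite (@fsum_single _ _ _ a) => [|h /negPf ->]; last by rewrite linear0l.
rewrite eqxx subr_eq [b + a]addrC; case: eqP => // _.
by rewrite linear0r.
Qed.

Lemma tensor_degP g (t : tensor V W) (S : set (tensor V W)) :
  tensor_deg (V := V) (W := W) g t ->
  S 0 -> (forall x y, S x -> S y -> S (x + y)) ->
  (forall a b x y, a + b = g -> gv_deg a x -> gv_deg b y -> S (x \ot y)) -> S t.
Proof.
move=> [s -> hs] S0 SD h; rewrite big_seq.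
elim/big_ind: _ => // -[x y] /hs [a [/= hx hy]].
by apply: h hx hy; rewrite addrC subrK.
Qed.

Lemma tensor_deg_pure a b (x : V) (y : W) : gv_deg a x -> gv_deg b y ->
  tensor_deg (V := V) (W := W) (a + b) (x \ot y).
Proof.
move=> hx hy; exists [:: (x, y)]; first by rewrite big_seq1.
by move=> p; rewrite inE => /eqP ->; exists a; rewrite addrC addKr.
Qed.

Lemma tensor_deg_lin g a (x y : tensor V W) :
  tensor_deg (V := V) (W := W) g x -> tensor_deg (V := V) (W := W) g y ->
  tensor_deg (V := V) (W := W) g (a *: x + y).
Proof.
move=> [s -> hs] [s' -> hs'].
exists ([seq (a *: p.1, p.2) | p <- s] ++ s').
  rewrite big_cat big_map scaler_sumr; congr (_ + _).
  by apply: eq_bigr => p _; rewrite linearZl_LR.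
move=> p; rewrite mem_cat => /orP [/mapP [q /hs [b [h1 h2]] ->]|/hs' //].
by exists b; split=> //=; apply: deg_scale.
Qed.

Lemma tensor_deg0 g : tensor_deg (V := V) (W := W) g 0.
Proof. by exists [::] => //; rewrite big_nil. Qed.

(** Both claims go through one induction, since a sum over [G] can be split linearly only when the
    families are known to have finite support. *)
Lemma tproj_sum x : finite_set [set g | tproj g x != 0] /\
  x = \sum_(g \in [set: G]) tproj g x.
Proof.
move: x; apply: (spanning_pures (@homog_spanning V) (@homog_spanning W)
  (S := fun x => finite_set [set g | tproj g x != 0] /\
            x = \sum_(g \in [set: G]) tproj g x)).
- split; last by apply/esym/fsbig1 => g _; rewrite linear0.
  by apply: sub_finite_set (finite_set0 G) => g /=; rewrite linear0 eqxx.
- move=> a x y [fx ex] [fy ey]; split.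
    by under eq_set do rewrite linearP; apply: finite_supp_linear.
  under eq_fsbigr do rewrite linearP /=.
  by rewrite fsum_linear // -ex -ey.
- move=> _ [x [y [[a hx] [b hy] ->]]]; split.
    apply: sub_finite_set (finite_set1 (a + b)) => g /=.
    by rewrite (tproj_homog _ hx hy); case: (g =P _) => // _; rewrite eqxx.
  rewrite (@fsum_single _ _ _ (a + b)) => [|h /negPf e];
    by rewrite (tproj_homog _ hx hy) ?eqxx ?e.
Qed.

Fact tensor_grading : is_grading (tensor_deg (V := V) (W := W)).
Proof.
apply: (@mk_grading _ _ tproj) => [|g x|g h x hx|x|x].
- exact: tensor_deg_lin.
- move: x; apply: (spanning_pures (@homog_spanning V) (@homog_spanning W)
    (S := fun x => tensor_deg (V := V) (W := W) g (tproj g x))).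
  + by rewrite linear0; apply: tensor_deg0.
  + by move=> a x y; rewrite linearP; apply: tensor_deg_lin.
  + move=> _ [x [y [[a hx] [b hy] ->]]]; rewrite (tproj_homog _ hx hy).
    case: eqP => [->|_]; last exact: tensor_deg0.
    exact: tensor_deg_pure.
- apply: (tensor_degP (S := fun x => tproj h x = if h == g then x else 0) hx).
  + by rewrite linear0; case: ifP.
  + by move=> y z; rewrite linearD => -> ->; case: ifP; rewrite ?addr0.
  + by move=> a b y z e hy hz; rewrite (tproj_homog _ hy hz) e.
- by case: (tproj_sum x).
- by case: (tproj_sum x).
Qed.

Definition gtensor : gvect G k := GVect tensor_grading.

End TensorGrading.

Lemma deg_pure V W a b g (x : V) (y : W) : gv_deg a x -> gv_deg b y ->
  g = a + b -> gv_deg (g := gtensor V W) g (x \ot y).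
Proof. by move=> hx hy ->; apply: tensor_deg_pure. Qed.

Definition graded V W (f : V -> W) : Prop :=
  forall g x, gv_deg g x -> gv_deg g (f x).

Lemma tmap_graded (V V' W W' : gvect G k) (f : {linear V -> V'})
    (f' : {linear W -> W'}) :
  graded f -> graded f' -> graded (V := gtensor V W) (W := gtensor V' W') (tmap f f').
Proof.
move=> gf gf' g t ht.
apply: (tensor_degP (S := fun t => gv_deg (g := gtensor V' W') g (tmap f f' t)) ht).
- by rewrite linear0; apply: (deg0 (gtensor V' W')).
- by move=> x y; rewrite linearD; apply: (@degD (gtensor V' W')).
- move=> a b x y <- hx hy; rewrite tmap_pure.
  by apply: deg_pure; [apply: gf hx|apply: gf' hy|].
Qed.

Lemma graded_comp (U V W : gvect G k) (f : V -> W) (g : U -> V) :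
  graded f -> graded g -> graded (f \o g).
Proof. by move=> hf hg a x /hg /hf. Qed.

End Gradings.

Ltac span_solve :=
  first [apply: spanning_pures; span_solve | apply: homog_spanning | apply: spanningT].

Section TensorLemmas.
Variable k : fieldType.

Lemma eq_tmap (V V' W W' : lmodType k) (f f' : {linear V -> V'})
    (g g' : {linear W -> W'}) :
  f =1 f' -> g =1 g' -> tmap f g =1 tmap f' g'.
Proof.
by move=> ef eg; apply: tensor_ind => x y; rewrite !tmap_pure ef eg.
Qed.

Lemma lcompE (U V W : lmodType k) (f : {linear V -> W}) (g : {linear U -> V}) x :
  GRing.Linear.sort [the {linear U -> W} of f \o g] x = f (g x).
Proof. by []. Qed.

Lemma tmap_comp (V V' V'' W W' W'' : lmodType k) (f : {linear V' -> V''})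
    (f' : {linear V -> V'}) (g : {linear W' -> W''}) (g' : {linear W -> W'}) t :
  tmap f g (tmap f' g' t) = tmap (f \o f') (g \o g') t.
Proof.
move: t; apply: (@tensor_ind _ _ _ _ (tmap f g \o tmap f' g')) => x y.
by rewrite lcompE !tmap_pure.
Qed.

Lemma tmap_id (V W : lmodType k) (t : tensor V W) : tmap idfun idfun t = t.
Proof. by move: t; apply: (@tensor_ind _ _ _ _ _ idfun) => x y; rewrite tmap_pure. Qed.

Lemma tpureZl (V W : lmodType k) a (x : V) (y : W) : (a *: x) \ot y = a *: (x \ot y).
Proof. by rewrite linearZl_LR. Qed.

Lemma tpureZr (V W : lmodType k) a (x : V) (y : W) : x \ot (a *: y) = a *: (x \ot y).
Proof. by rewrite linearZr_LR. Qed.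

Lemma scalarZE (V : lmodType k) (e : {scalar V}) a x : e (a *: x) = a * e x.
Proof. by rewrite linearZ. Qed.

Lemma tassocK (U V W : lmodType k) : cancel (@tassoc k U V W) tunassoc.
Proof.
apply: (span_ext (f := tunassoc \o tassoc) (g := idfun)); [by []|by []|span_solve|].
move=> _ [_ [w [[u [v [_ _ ->]]] _ ->]]].
by rewrite tassoc_pure tunassoc_pure.
Qed.

Lemma tcontractl_pure (V W : lmodType k) (e : {scalar V}) (x : V) (y : W) :
  tcontractl e (x \ot y) = e x *: y.
Proof. exact: tlift_pure. Qed.

Lemma tcontractr_pure (V W : lmodType k) (e : {scalar W}) (x : V) (y : W) :
  tcontractr e (x \ot y) = e y *: x.
Proof. exact: tlift_pure. Qed.

End TensorLemmas.

(** * Coherence of the braided interchange of middle factors *)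

Section Color.
Variables (G : zmodType) (k : fieldType) (phi : G -> G -> k).
Hypothesis hphi : commutation_factor phi.

Lemma cf0r g : phi g 0 = 1.
Proof.
apply: (mulfI (cf_neq0 hphi g 0)).
by rewrite -(cf_mulr hphi) addr0 mulr1.
Qed.

Lemma cf0l g : phi 0 g = 1.
Proof.
apply: (mulfI (cf_neq0 hphi 0 g)).
by rewrite -(cf_mull hphi) addr0 mulr1.
Qed.

Lemma tmiddleE (A D : lmodType k) (B C : gvect G k) g h a (b : B) (c : C) d :
  gv_deg g b -> gv_deg h c ->
  tmiddle phi A B C D ((a \ot b) \ot (c \ot d)) =
  phi g h *: ((a \ot c) \ot (b \ot d)).
Proof.
move=> hb hc; rewrite /tmiddle /= tassoc_pure tmap_pure /=.
rewrite tunassoc_pure tmap_pure (@braid_homog _ _ _ _ _ g h) //= linearZl_LR linearZ.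
by rewrite tassoc_pure linearZr_LR linearZ /= tunassoc_pure.
Qed.

Lemma tmiddle_nat (A A' D D' : lmodType k) (B B' C C' : gvect G k)
    (fA : {linear A -> A'}) (fB : {linear B -> B'}) (fC : {linear C -> C'})
    (fD : {linear D -> D'}) t : graded fB -> graded fC ->
  tmap (tmap fA fC) (tmap fB fD) (tmiddle phi A B C D t) =
  tmiddle phi A' B' C' D' (tmap (tmap fA fB) (tmap fC fD) t).
Proof.
move=> gB gC; move: t.
apply: (span_ext (f := tmap (tmap fA fC) (tmap fB fD) \o tmiddle phi A B C D)
  (g := tmiddle phi A' B' C' D' \o tmap (tmap fA fB) (tmap fC fD)));
  [by []|by []|span_solve|].
move=> _ [_ [_ [[a [b [_ [g hb] ->]]] [c [d [[h hc] _ ->]]] ->]]].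
rewrite (tmiddleE _ _ hb hc) linearZ_LR !tmap_pure.
by rewrite (tmiddleE _ _ (gB _ _ hb) (gC _ _ hc)).
Qed.

Lemma braid_nat (V V' W W' : gvect G k) (f : {linear V -> V'})
    (f' : {linear W -> W'}) t : graded f -> graded f' ->
  braid phi V' W' (tmap f f' t) = tmap f' f (braid phi V W t).
Proof.
move=> gf gf'; move: t.
apply: (span_ext (f := braid phi V' W' \o tmap f f')
  (g := tmap f' f \o braid phi V W)); [by []|by []|span_solve|].
move=> _ [x [y [[a hx] [b hy] ->]]] /=; rewrite tmap_pure.
rewrite (braid_homog _ (gf _ _ hx) (gf' _ _ hy)) (braid_homog _ hx hy).
by rewrite linearZ_LR tmap_pure.
Qed.

(** Both sides bring the factors into the order u1 v1 u2 v2 u3 v3. With ai, bi the degrees of ui,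
    vi, bimultiplicativity of [phi] makes either scalar equal to phi(a2,b1) phi(a3,b1)
    phi(a3,b2). *)
Lemma tmiddleA (U V : gvect G k) (t : tensor (tensor (tensor U U) U) (tensor (tensor V V) V)) :
  tassoc (tmap (tmiddle phi U U V V) idfun
    (tmiddle phi (tensor U U) U (gtensor V V) V t)) =
  tmap idfun (tmiddle phi U U V V)
    (tmiddle phi U (gtensor U U) V (tensor V V) (tmap tassoc tassoc t)).
Proof.
move: t; apply: (span_ext
  (f := tassoc \o (tmap (tmiddle phi U U V V) idfun
    \o tmiddle phi (tensor U U) U (gtensor V V) V))
  (g := tmap idfun (tmiddle phi U U V V)
    \o (tmiddle phi U (gtensor U U) V (tensor V V) \o tmap tassoc tassoc)));
  [by []|by []|span_solve|].
move=> _ [_ [_ [[_ [u3 [[u1 [u2 [[a1 h1] [a2 h2] ->]]] [a3 h3] ->]]]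
  [_ [v3 [[v1 [v2 [[b1 l1] [b2 l2] ->]]] [b3 l3] ->]]] ->]]].
rewrite tmap_pure !tassoc_pure.
rewrite (tmiddleE _ _ h3 (deg_pure l1 l2 erefl)) (tmiddleE _ _ (deg_pure h2 h3 erefl) l1).
rewrite !linearZ_LR !tmap_pure (tmiddleE _ _ h2 l1) (tmiddleE _ _ h3 l2).
rewrite linearZl_LR linearZr_LR linearZ_LR tassoc_pure !scalerA.
by rewrite (cf_mull hphi) (cf_mulr hphi) mulrAC [phi a2 b1 * _]mulrC.
Qed.

(** Here skew-symmetry enters: the left side contains phi(h,l) phi(l,h) in addition to the factors
    of the right side, and this product is 1. Cocommutativity of a tensor product of cocommutative
    coalgebras rests on it. *)
Lemma tmiddle_braid (U V : gvect G k) (t : tensor (tensor U U) (tensor V V)) :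
  braid phi (gtensor U V) (gtensor U V) (tmiddle phi U U V V t) =
  tmiddle phi U U V V (tmap (braid phi U U) (braid phi V V) t).
Proof.
move: t; apply: (span_ext
  (f := braid phi (gtensor U V) (gtensor U V) \o tmiddle phi U U V V)
  (g := tmiddle phi U U V V \o tmap (braid phi U U) (braid phi V V)));
  [by []|by []|span_solve|].
move=> _ [_ [_ [[a [b [[g ha] [h hb] ->]]] [c [d [[l hc] [m hd] ->]]] ->]]].
rewrite (tmiddleE _ _ hb hc) linearZ_LR tmap_pure.
rewrite (braid_homog _ (deg_pure ha hc erefl) (deg_pure hb hd erefl)).
rewrite (braid_homog _ ha hb) (braid_homog _ hc hd).
rewrite linearZl_LR linearZr_LR 2!(linearZ_LR (tmiddle phi U U V V)).
rewrite (tmiddleE _ _ ha hd) !scalerA.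
congr (_ *: _); rewrite (cf_mull hphi) !(cf_mulr hphi).
rewrite -[RHS]mul1r -(cf_skew hphi h l) !mulrA; ring.
Qed.

End Color.

(** * Cocommutative color coalgebras *)

#[local] Opaque tmiddle.

Section Coalgebras.
Variables (G : zmodType) (k : fieldType) (phi : G -> G -> k).

Record coalg := Coalg {
  cc_gv :> gvect G k;
  cc_comul : {linear cc_gv -> tensor cc_gv cc_gv};
  cc_counit : {scalar cc_gv};
  cc_comul_deg : graded (V := cc_gv) (W := gtensor cc_gv cc_gv) cc_comul;
  cc_counit_deg : forall g x, gv_deg (g := cc_gv) g x -> g != 0 -> cc_counit x = 0;
  cc_comulA : forall x,
    tassoc (tmap cc_comul idfun (cc_comul x)) = tmap idfun cc_comul (cc_comul x);
  cc_counitl : forall x, tcontractl cc_counit (cc_comul x) = x;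
  cc_counitr : forall x, tcontractr cc_counit (cc_comul x) = x;
  cc_comulC : forall x, braid phi cc_gv cc_gv (cc_comul x) = cc_comul x
}.

Record chom (T S : coalg) := CHom {
  ch_lin :> {linear T -> S};
  chom_deg : graded ch_lin;
  chom_comul : forall x, cc_comul S (ch_lin x) = tmap ch_lin ch_lin (cc_comul T x);
  chom_counit : forall x, cc_counit S (ch_lin x) = cc_counit T x
}.

Lemma linear_eq (U V : lmodType k) (f g : {linear U -> V}) : f =1 g -> f = g.
Proof.
case: f g => f [[p] [q]] [g [[p'] [q']]] /= /funext e.
case: _ / e in p' q' *.
by rewrite (Prop_irrelevance p p') (Prop_irrelevance q q').
Qed.

Lemma chom_eq (T S : coalg) (f g : chom T S) : f =1 g -> f = g.
Proof.
case: f g => [f f1 f2 f3] [g g1 g2 g3] /= /linear_eq e.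
by case: _ / e in g1 g2 g3 *; congr CHom; apply: Prop_irrelevance.
Qed.

Program Definition chom_id (T : coalg) : chom T T := @CHom T T idfun _ _ _.
Next Obligation. by move=> g x. Qed.
Next Obligation. by rewrite tmap_id. Qed.

Program Definition chom_comp (T S R : coalg) (f : chom S R) (g : chom T S) :
  chom T R := @CHom T R (f \o g) _ _ _.
Next Obligation. by apply: graded_comp; apply: chom_deg. Qed.
Next Obligation. by rewrite /= !chom_comul tmap_comp. Qed.
Next Obligation. by rewrite /= !chom_counit. Qed.

Program Definition Coc : category :=
  @Category coalg chom chom_id chom_comp _ _ _.
Next Obligation. by apply: chom_eq. Qed.
Next Obligation. by apply: chom_eq. Qed.
Next Obligation. by apply: chom_eq. Qed.

Hypothesis hphi : commutation_factor phi.

(** * The coalgebra structure of a tensor product *)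

Section Product.
Variables T S : coalg.

Definition prod_comul : {linear tensor T S -> tensor (tensor T S) (tensor T S)} :=
  tmiddle phi T T S S \o tmap (cc_comul T) (cc_comul S).

Definition prod_counit : {scalar tensor T S} :=
  cc_counit S \o tcontractl (cc_counit T).

Lemma prod_comulE t : prod_comul t = tmiddle phi T T S S (tmap (cc_comul T) (cc_comul S) t).
Proof. by []. Qed.

Lemma prod_counit_pure x y : prod_counit (x \ot y) = cc_counit T x * cc_counit S y.
Proof. by rewrite /prod_counit /= tcontractl_pure scalarZE. Qed.

Lemma tmiddle_graded : graded
  (V := gtensor (gtensor T T) (gtensor S S)) (W := gtensor (gtensor T S) (gtensor T S))
  (tmiddle phi T T S S).
Proof.
pose W := gtensor (gtensor T S) (gtensor T S).
move=> g t ht.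
apply: (tensor_degP (V := gtensor T T) (W := gtensor S S)
  (S := fun t => gv_deg (g := W) g (tmiddle phi T T S S t)) ht).
- by rewrite linear0; apply: (deg0 W).
- by move=> x y; rewrite linearD; apply: (@degD _ _ W).
move=> a b x y <- hx hy {g t ht}.
apply: (tensor_degP (V := T) (W := T) (S := fun x => gv_deg (g := W) (a + b)
  (tmiddle phi T T S S (x \ot y))) hx).
- by rewrite linear0l linear0; apply: (deg0 W).
- by move=> x1 x2; rewrite linearDl linearD; apply: (@degD _ _ W).
move=> c d x1 x2 <- h1 h2.
apply: (tensor_degP (V := S) (W := S) (S := fun y => gv_deg (g := W) (c + d + b)
  (tmiddle phi T T S S ((x1 \ot x2) \ot y))) hy).
- by rewrite linear0r linear0; apply: (deg0 W).
- by move=> y1 y2; rewrite linearDr linearD; apply: (@degD _ _ W).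
move=> e f y1 y2 <- l1 l2.
rewrite (tmiddleE _ _ _ h2 l1); apply: deg_scale.
by apply: deg_pure (deg_pure h1 l1 erefl) (deg_pure h2 l2 erefl) _; rewrite addrACA.
Qed.

Lemma prod_comul_deg : graded (V := gtensor T S)
  (W := gtensor (gtensor T S) (gtensor T S)) prod_comul.
Proof.
move=> g t ht; apply: tmiddle_graded.
by apply: (tmap_graded (@cc_comul_deg T) (@cc_comul_deg S)).
Qed.

Lemma prod_counit_deg g t : gv_deg (g := gtensor T S) g t -> g != 0 ->
  prod_counit t = 0.
Proof.
move=> ht g0; apply: (tensor_degP (V := T) (W := S) (S := fun t => prod_counit t = 0) ht).
- exact: linear0.
- by move=> x y; rewrite linearD => -> ->; rewrite addr0.
move=> a b x y e hx hy; rewrite prod_counit_pure.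
have [a0|a0] := eqVneq a 0; last by rewrite (cc_counit_deg hx a0) mul0r.
have [b0|b0] := eqVneq b 0; last by rewrite (cc_counit_deg hy b0) mulr0.
by rewrite -e a0 b0 addr0 eqxx in g0.
Qed.

(** A counit cannot see the braiding scalar: it vanishes outside degree 0, and phi(g,h) is 1 as soon
    as one of the two degrees is 0. The same reason governs the other contractions of [tmiddle]
    below. *)
Lemma tcontractl_tmiddle t :
  tcontractl prod_counit (tmiddle phi T T S S t) =
  tmap (tcontractl (cc_counit T)) (tcontractl (cc_counit S)) t.
Proof.
move: t; apply: (span_ext (f := tcontractl prod_counit \o tmiddle phi T T S S)
  (g := tmap (tcontractl (cc_counit T)) (tcontractl (cc_counit S))));
  [by []|by []|span_solve|].
move=> _ [_ [_ [[a [b [_ [g hb] ->]]] [c [d [[h hc] _ ->]]] ->]]].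
rewrite (tmiddleE _ _ _ hb hc) // linearZ_LR tcontractl_pure prod_counit_pure.
rewrite tmap_pure !tcontractl_pure tpureZl tpureZr !scalerA.
congr (_ *: _); have [h0|h0] := eqVneq h 0; last by rewrite (cc_counit_deg hc h0) !(mulr0, mul0r).
by rewrite h0 cf0r // mul1r mulrC.
Qed.

Lemma tcontractr_tmiddle t :
  tcontractr prod_counit (tmiddle phi T T S S t) =
  tmap (tcontractr (cc_counit T)) (tcontractr (cc_counit S)) t.
Proof.
move: t; apply: (span_ext (f := tcontractr prod_counit \o tmiddle phi T T S S)
  (g := tmap (tcontractr (cc_counit T)) (tcontractr (cc_counit S))));
  [by []|by []|span_solve|].
move=> _ [_ [_ [[a [b [_ [g hb] ->]]] [c [d [[h hc] _ ->]]] ->]]].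
rewrite (tmiddleE _ _ _ hb hc) // linearZ_LR tcontractr_pure prod_counit_pure.
rewrite tmap_pure !tcontractr_pure tpureZl tpureZr !scalerA.
congr (_ *: _); have [h0|h0] := eqVneq g 0; last by rewrite (cc_counit_deg hb h0) !(mul0r, mulr0).
by rewrite h0 cf0l // mul1r.
Qed.

Lemma prod_counitl t : tcontractl prod_counit (prod_comul t) = t.
Proof.
rewrite prod_comulE tcontractl_tmiddle tmap_comp -[RHS]tmap_id.
by apply: eq_tmap => x /=; rewrite cc_counitl.
Qed.

Lemma prod_counitr t : tcontractr prod_counit (prod_comul t) = t.
Proof.
rewrite prod_comulE tcontractr_tmiddle tmap_comp -[RHS]tmap_id.
by apply: eq_tmap => x /=; rewrite cc_counitr.
Qed.

Lemma prod_comulC t : braid phi (gtensor T S) (gtensor T S) (prod_comul t) = prod_comul t.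
Proof.
rewrite prod_comulE tmiddle_braid // tmap_comp; congr (tmiddle _ _ _ _ _ _).
by apply: eq_tmap => x /=; rewrite cc_comulC.
Qed.

(** By naturality the coproducts of [T] and [S] can all be applied before any interchange. The
    interchanges then agree by [tmiddleA], and the coproducts by coassociativity in each factor. *)
Lemma prod_comulA t :
  tassoc (tmap prod_comul idfun (prod_comul t)) = tmap idfun prod_comul (prod_comul t).
Proof.
pose M := tmiddle phi T T S S.
have e1 u : tmap prod_comul idfun u =
    tmap M idfun (tmap (tmap (cc_comul T) (cc_comul S)) (tmap idfun idfun) u).
  by rewrite tmap_comp; apply: eq_tmap => // x; rewrite tmap_id.
have e2 u : tmap idfun prod_comul u =
    tmap idfun M (tmap (tmap idfun idfun) (tmap (cc_comul T) (cc_comul S)) u).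
  by rewrite tmap_comp; apply: eq_tmap => // x; rewrite tmap_id.
rewrite e1 e2 prod_comulE.
rewrite (tmiddle_nat _ (B' := T) (C' := gtensor S S)) //; last exact: cc_comul_deg.
rewrite (tmiddle_nat _ (B' := gtensor T T) (C' := S)) //; last exact: cc_comul_deg.
rewrite (tmiddleA hphi); pose N := tmiddle phi T (gtensor T T) S (tensor S S).
apply: (congr1 (fun z => tmap idfun M (N z))).
rewrite (tmap_comp (tmap (cc_comul T) idfun)) (tmap_comp (tmap idfun (cc_comul T))).
rewrite (tmap_comp tassoc); apply: eq_tmap => x; first exact: (cc_comulA (c := T)).
exact: (cc_comulA (c := S)).
Qed.

Definition cprod : coalg := @Coalg (gtensor T S) prod_comul prod_counit
  prod_comul_deg prod_counit_deg prod_comulA prod_counitl prod_counitr prod_comulC.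

Lemma cprod_comulE t :
  cc_comul cprod t = tmiddle phi T T S S (tmap (cc_comul T) (cc_comul S) t).
Proof. by []. Qed.

Lemma cprod_counit_pure x y :
  cc_counit cprod (x \ot y) = cc_counit T x * cc_counit S y.
Proof. exact: prod_counit_pure. Qed.

End Product.

Lemma tassoc_nat (U V W U' V' W' : lmodType k) (f : {linear U -> U'})
    (g : {linear V -> V'}) (h : {linear W -> W'}) t :
  tassoc (tmap (tmap f g) h t) = tmap f (tmap g h) (tassoc t).
Proof.
move: t; apply: (span_ext (f := tassoc \o tmap (tmap f g) h)
  (g := tmap f (tmap g h) \o tassoc)); [by []|by []|span_solve|].
move=> _ [_ [w [[u [v [_ _ ->]]] _ ->]]].
by rewrite !(tassoc_pure, tmap_pure).
Qed.

Lemma tmap_split (U V U' V' : lmodType k) (f : {linear U -> U'})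
    (g : {linear V -> V'}) t : tmap f g t = tmap idfun g (tmap f idfun t).
Proof. by rewrite tmap_comp; apply: eq_tmap. Qed.

Lemma comul4A (R : coalg) (r : R) :
  tassoc (tmap (cc_comul R) (cc_comul R) (cc_comul R r)) =
  tmap idfun (tmap idfun (cc_comul R) \o cc_comul R) (cc_comul R r).
Proof.
rewrite tmap_split (@eq_tmap _ _ _ _ _ _ (tmap idfun idfun) (cc_comul R) (cc_comul R)) //;
  last by move=> x; rewrite tmap_id.
by rewrite tassoc_nat cc_comulA tmap_comp.
Qed.

#[local] Transparent tmiddle.
(** After reassociation the two middle factors of the fourfold coproduct are themselves a coproduct,
    so braiding them changes nothing by cocommutativity. This says that the coproduct [R -> R (x) R]
    is a morphism of coalgebras, which [cpair] needs. *)
Lemma comul4 (R : coalg) (r : R) :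
  tmiddle phi R R R R (tmap (cc_comul R) (cc_comul R) (cc_comul R r)) =
  tmap (cc_comul R) (cc_comul R) (cc_comul R r).
Proof.
rewrite -[LHS]/(tunassoc (tmap idfun (tassoc \o (tmap (braid phi R R) idfun \o tunassoc))
  (tassoc (tmap (cc_comul R) (cc_comul R) (cc_comul R r))))).
rewrite -[RHS]tassocK comul4A (tmap_comp idfun); apply: (congr1 tunassoc).
apply: eq_tmap => // x.
rewrite -[LHS]/(tassoc (tmap (braid phi R R) idfun
  (tunassoc (tmap idfun (cc_comul R) (cc_comul R x))))).
rewrite -[RHS]/(tmap idfun (cc_comul R) (cc_comul R x)) -(cc_comulA x).
rewrite tassocK (tmap_comp (braid phi R R)); apply: (congr1 tassoc).
by apply: eq_tmap => // y; apply: cc_comulC.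
Qed.
#[local] Opaque tmiddle.

(** * The tensor product as a categorical product *)

Section Projections.
Variables T S : coalg.

Lemma proj1_tmiddle t :
  tmap (tcontractr (cc_counit S)) (tcontractr (cc_counit S)) (tmiddle phi T T S S t) =
  tcontractr (cc_counit S \o tcontractl (cc_counit S)) t.
Proof.
move: t; apply: (span_ext
  (f := tmap (tcontractr (cc_counit S)) (tcontractr (cc_counit S)) \o tmiddle phi T T S S)
  (g := tcontractr (cc_counit S \o tcontractl (cc_counit S))));
  [by []|by []|span_solve|].
move=> _ [_ [_ [[a [b [_ [g hb] ->]]] [c [d [[h hc] _ ->]]] ->]]].
rewrite (tmiddleE _ _ _ hb hc) // linearZ_LR tmap_pure !tcontractr_pure.
rewrite tpureZl tpureZr !scalerA /= tcontractl_pure scalarZE.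
congr (_ *: _); have [h0|h0] := eqVneq h 0; last by rewrite (cc_counit_deg hc h0) !(mulr0, mul0r).
by rewrite h0 cf0r // mul1r.
Qed.

Lemma proj2_tmiddle t :
  tmap (tcontractl (cc_counit T)) (tcontractl (cc_counit T)) (tmiddle phi T T S S t) =
  tcontractl (cc_counit T \o tcontractl (cc_counit T)) t.
Proof.
move: t; apply: (span_ext
  (f := tmap (tcontractl (cc_counit T)) (tcontractl (cc_counit T)) \o tmiddle phi T T S S)
  (g := tcontractl (cc_counit T \o tcontractl (cc_counit T))));
  [by []|by []|span_solve|].
move=> _ [_ [_ [[a [b [_ [g hb] ->]]] [c [d [[h hc] _ ->]]] ->]]].
rewrite (tmiddleE _ _ _ hb hc) // linearZ_LR tmap_pure !tcontractl_pure.
rewrite tpureZl tpureZr !scalerA /= tcontractl_pure scalarZE.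
congr (_ *: _); have [h0|h0] := eqVneq g 0; last by rewrite (cc_counit_deg hb h0) !(mulr0, mul0r).
by rewrite h0 cf0l // mul1r.
Qed.

Lemma proj12_tmiddle t :
  tmap (tcontractr (cc_counit S)) (tcontractl (cc_counit T)) (tmiddle phi T T S S t) =
  tmap (tcontractr (cc_counit T)) (tcontractl (cc_counit S)) t.
Proof.
move: t; apply: (span_ext
  (f := tmap (tcontractr (cc_counit S)) (tcontractl (cc_counit T)) \o tmiddle phi T T S S)
  (g := tmap (tcontractr (cc_counit T)) (tcontractl (cc_counit S))));
  [by []|by []|span_solve|].
move=> _ [_ [_ [[a [b [_ [g hb] ->]]] [c [d [[h hc] _ ->]]] ->]]].
rewrite (tmiddleE _ _ _ hb hc) // linearZ_LR !tmap_pure !(tcontractl_pure, tcontractr_pure).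
rewrite !tpureZl !tpureZr !scalerA.
congr (_ *: _); have [h0|h0] := eqVneq h 0; last by rewrite (cc_counit_deg hc h0) !(mulr0, mul0r).
by rewrite h0 cf0r // mul1r mulrC.
Qed.

Lemma tcontractr_graded : graded (V := gtensor T S) (tcontractr (cc_counit S)).
Proof.
move=> g t ht; apply: (tensor_degP (V := T) (W := S)
  (S := fun t => gv_deg g (tcontractr (cc_counit S) t : T)) ht).
- by rewrite linear0; apply: deg0.
- by move=> x y; rewrite linearD; apply: degD.
move=> a b x y <- hx hy; rewrite tcontractr_pure.
have [b0|b0] := eqVneq b 0; first by rewrite b0 addr0; apply: deg_scale.
by rewrite (cc_counit_deg hy b0) scale0r; apply: deg0.
Qed.

Lemma tcontractl_graded : graded (V := gtensor T S) (tcontractl (cc_counit T)).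
Proof.
move=> g t ht; apply: (tensor_degP (V := T) (W := S)
  (S := fun t => gv_deg g (tcontractl (cc_counit T) t : S)) ht).
- by rewrite linear0; apply: deg0.
- by move=> x y; rewrite linearD; apply: degD.
move=> a b x y <- hx hy; rewrite tcontractl_pure.
have [b0|b0] := eqVneq a 0; first by rewrite b0 add0r; apply: deg_scale.
by rewrite (cc_counit_deg hx b0) scale0r; apply: deg0.
Qed.

Fact cfst_comul x : cc_comul T (tcontractr (cc_counit S) x) =
  tmap (tcontractr (cc_counit S)) (tcontractr (cc_counit S)) (cc_comul (cprod T S) x).
Proof.
apply/esym; rewrite cprod_comulE proj1_tmiddle; move: x.
apply: (span_ext (V := tensor T S)
  (f := tcontractr (cc_counit S \o tcontractl (cc_counit S)) \o tmap (cc_comul T) (cc_comul S))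
  (g := cc_comul T \o tcontractr (cc_counit S))); [by []|by []|span_solve|].
move=> _ [x [y [_ _ ->]]]; rewrite tmap_pure !tcontractr_pure linearZ_LR /=.
by rewrite cc_counitl.
Qed.

Fact cfst_counit x :
  cc_counit T (tcontractr (cc_counit S) x) = cc_counit (cprod T S) x.
Proof.
move: x; apply: (span_ext_scalar (V := tensor T S)
  (f := cc_counit T \o tcontractr (cc_counit S)) (g := prod_counit T S));
  [by []|by []|span_solve|].
by move=> _ [x [y [_ _ ->]]]; rewrite tcontractr_pure prod_counit_pure scalarZE mulrC.
Qed.

Definition cfst : chom (cprod T S) T :=
  @CHom (cprod T S) T (tcontractr (cc_counit S)) tcontractr_graded cfst_comul cfst_counit.

Fact csnd_comul x : cc_comul S (tcontractl (cc_counit T) x) =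
  tmap (tcontractl (cc_counit T)) (tcontractl (cc_counit T)) (cc_comul (cprod T S) x).
Proof.
apply/esym; rewrite cprod_comulE proj2_tmiddle; move: x.
apply: (span_ext (V := tensor T S)
  (f := tcontractl (cc_counit T \o tcontractl (cc_counit T)) \o tmap (cc_comul T) (cc_comul S))
  (g := cc_comul S \o tcontractl (cc_counit T))); [by []|by []|span_solve|].
move=> _ [x [y [_ _ ->]]]; rewrite tmap_pure !tcontractl_pure linearZ_LR /=.
by rewrite cc_counitl.
Qed.

Fact csnd_counit x :
  cc_counit S (tcontractl (cc_counit T) x) = cc_counit (cprod T S) x.
Proof.
move: x; apply: (span_ext_scalar (V := tensor T S)
  (f := cc_counit S \o tcontractl (cc_counit T)) (g := prod_counit T S));
  [by []|by []|span_solve|].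
by move=> _ [x [y [_ _ ->]]]; rewrite tcontractl_pure prod_counit_pure scalarZE.
Qed.

Definition csnd : chom (cprod T S) S :=
  @CHom (cprod T S) S (tcontractl (cc_counit T)) tcontractl_graded csnd_comul csnd_counit.

Section Pairing.
Variables (R : coalg) (f : chom R T) (g : chom R S).

Lemma tmap_counit (t : tensor R R) : prod_counit T S (tmap f g t) = prod_counit R R t.
Proof.
move: t; apply: (span_ext_scalar (V := tensor R R)
  (f := prod_counit T S \o tmap f g) (g := prod_counit R R)); [by []|by []|span_solve|].
by move=> _ [x [y [_ _ ->]]]; rewrite tmap_pure !prod_counit_pure !chom_counit.
Qed.

Fact cpair_graded : graded (W := gtensor T S) (tmap f g \o cc_comul R).
Proof.
move=> a x hx; apply: (tmap_graded (@chom_deg _ _ f) (@chom_deg _ _ g)).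
exact: cc_comul_deg.
Qed.

Fact cpair_comul x : cc_comul (cprod T S) ((tmap f g \o cc_comul R) x) =
  tmap (tmap f g \o cc_comul R) (tmap f g \o cc_comul R) (cc_comul R x).
Proof.
rewrite cprod_comulE.
rewrite -[RHS]tmap_comp -comul4.
rewrite (@tmiddle_nat _ _ phi _ _ _ _ R T R S f f g g) //; try exact: chom_deg.
apply: (congr1 (tmiddle phi T T S S)).
rewrite [LHS]tmap_comp [RHS]tmap_comp.
by apply: eq_tmap => y; apply: chom_comul.
Qed.
Fact cpair_counit x :
  cc_counit (cprod T S) ((tmap f g \o cc_comul R) x) = cc_counit R x.
Proof. by rewrite [LHS]tmap_counit /prod_counit /= cc_counitl. Qed.

Definition cpair : chom R (cprod T S) :=
  @CHom R (cprod T S) (tmap f g \o cc_comul R) cpair_graded cpair_comul cpair_counit.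

End Pairing.

Lemma cfst_pair R (f : chom R T) (g : chom R S) : chom_comp cfst (cpair f g) = f.
Proof.
apply: chom_eq => x /=; rewrite -[in RHS](cc_counitr x); move: (cc_comul R x).
apply: (span_ext (V := tensor R R) (f := tcontractr (cc_counit S) \o tmap f g)
  (g := f \o tcontractr (cc_counit R))); [by []|by []|span_solve|].
by move=> _ [y [z [_ _ ->]]]; rewrite tmap_pure !tcontractr_pure chom_counit linearZ_LR.
Qed.

Lemma csnd_pair R (f : chom R T) (g : chom R S) : chom_comp csnd (cpair f g) = g.
Proof.
apply: chom_eq => x /=; rewrite -[in RHS](cc_counitl x); move: (cc_comul R x).
apply: (span_ext (V := tensor R R) (f := tcontractl (cc_counit T) \o tmap f g)
  (g := g \o tcontractl (cc_counit R))); [by []|by []|span_solve|].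
by move=> _ [y [z [_ _ ->]]]; rewrite tmap_pure !tcontractl_pure chom_counit linearZ_LR.
Qed.

Lemma cpair_fst_snd t :
  tmap (tcontractr (cc_counit S)) (tcontractl (cc_counit T)) (prod_comul T S t) = t.
Proof.
rewrite prod_comulE proj12_tmiddle tmap_comp -[RHS]tmap_id.
by apply: eq_tmap => x; [apply: (cc_counitr (c := T))|apply: (cc_counitl (c := S))].
Qed.

(** Applying the two projections to the two halves of the coproduct of [T (x) S] is the identity
    ([cpair_fst_snd]); a coalgebra morphism carries this back to [R]. *)
Lemma cpair_eta R (h : chom R (cprod T S)) :
  h = cpair (chom_comp cfst h) (chom_comp csnd h).
Proof.
apply: chom_eq => x /=; rewrite -[LHS]cpair_fst_snd.
rewrite (chom_comul h x) tmap_comp.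
by apply: eq_tmap.
Qed.

End Projections.

(** * The terminal coalgebra *)

Section Unit.

Definition kdeg (g : G) : set k^o := [set x | g = 0 \/ x = 0].

Definition kproj (g : G) (x : k^o) : k^o := if g == 0 then x else 0.
Fact kproj_linear g : linear (kproj g).
Proof. by move=> a x y; rewrite /kproj; case: ifP => // _; rewrite scaler0 addr0. Qed.
HB.instance Definition _ g := GRing.isLinear.Build k k^o k^o _ (kproj g) (kproj_linear g).

Fact kgrading : is_grading kdeg.
Proof.
apply: (@mk_grading _ _ k^o _ kproj) => [g a x y|g x|g h x|x|x]; rewrite /kdeg /=.
- by case=> [->|->]; [left|case=> [->|->]; [left|right; rewrite scaler0 addr0]].
- by rewrite /kproj; case: eqP; [left|right].
- rewrite /kproj; case=> [->|->] //; case: ifP; case: ifP => //.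
- apply: sub_finite_set (finite_set1 (0 : G)) => g /=.
  by rewrite /kproj; case: (g =P 0) => // _; rewrite eqxx.
by rewrite (@fsum_single _ _ _ 0) /kproj ?eqxx // => h /negPf ->.
Qed.

Definition kgvect : gvect G k := GVect kgrading.

Definition kone : kgvect := (1 : k^o).

Definition kcomul (x : kgvect) : tensor kgvect kgvect := (x : k) *: (kone \ot kone).
Fact kcomul_linear : linear kcomul.
Proof. by move=> a x y; rewrite /kcomul scalerDl scalerA. Qed.
HB.instance Definition _ :=
  GRing.isLinear.Build k kgvect (tensor kgvect kgvect) _ kcomul kcomul_linear.

Definition kcounit (x : kgvect) : k := x.
Fact kcounit_linear : scalar kcounit. Proof. by []. Qed.
HB.instance Definition _ := GRing.isLinear.Build k kgvect k _ kcounit kcounit_linear.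

Lemma kdeg1 : gv_deg 0 kone. Proof. by left. Qed.

Fact kcomul_deg : graded (V := kgvect) (W := gtensor kgvect kgvect) kcomul.
Proof.
move=> g x [->|->]; last by rewrite linear0; apply: (deg0 (gtensor kgvect kgvect)).
by apply: (@deg_scale _ _ (gtensor kgvect kgvect)); apply: deg_pure kdeg1 kdeg1 _; rewrite addr0.
Qed.

Fact kcounit_deg g x : gv_deg (g := kgvect) g x -> g != 0 -> kcounit x = 0.
Proof. by case=> [/eqP ->|//]. Qed.

Lemma kcomul1 : kcomul kone = kone \ot kone.
Proof. exact: scale1r. Qed.

Fact kcomulA x : tassoc (tmap kcomul idfun (kcomul x)) = tmap idfun kcomul (kcomul x).
Proof.
rewrite [kcomul x](_ : _ = (x : k) *: (kone \ot kone)) // !linearZ_LR !tmap_pure.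
apply: congr1; apply: etrans (congr1 (fun u => tassoc (u \ot kone)) kcomul1) _.
by rewrite tassoc_pure; apply: (congr1 (fun u => kone \ot u)) (esym kcomul1).
Qed.

Fact kcounitl x : tcontractl kcounit (kcomul x) = x.
Proof. by rewrite linearZ_LR tcontractl_pure scale1r; apply: mulr1. Qed.

Fact kcounitr x : tcontractr kcounit (kcomul x) = x.
Proof. by rewrite linearZ_LR tcontractr_pure scale1r; apply: mulr1. Qed.

Fact kcomulC x : braid phi kgvect kgvect (kcomul x) = kcomul x.
Proof. by rewrite linearZ_LR (braid_homog _ kdeg1 kdeg1) cf0r // scale1r. Qed.

Definition cunit : coalg :=
  @Coalg kgvect kcomul kcounit kcomul_deg kcounit_deg kcomulA kcounitl kcounitr kcomulC.

Section Terminal.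
Variable T : coalg.

Definition kterm (x : T) : k^o := cc_counit T x.
Fact kterm_linear : linear kterm.
Proof. exact: linearP. Qed.
HB.instance Definition _ := GRing.isLinear.Build k T k^o _ kterm kterm_linear.

Fact kterm_graded : graded (W := kgvect) kterm.
Proof.
move=> g x hx; have [->|g0] := eqVneq g 0; first by left.
by right; apply: cc_counit_deg hx g0.
Qed.

Fact kterm_comul x : kcomul (kterm x) = tmap kterm kterm (cc_comul T x).
Proof.
rewrite -[in LHS](cc_counitl x); move: (cc_comul T x).
apply: (span_ext (V := tensor T T) (f := kcomul \o (kterm \o tcontractl (cc_counit T)))
  (g := tmap kterm kterm)); [by []|by []|span_solve|].
move=> _ [y [z [_ _ ->]]]; rewrite tcontractl_pure tmap_pure /kcomul.
rewrite /kterm scalarZE mulrC -scalerA -tpureZl -tpureZr.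
by congr (_ \ot _); apply: mulr1.
Qed.

Definition cterm : chom T cunit :=
  @CHom T cunit kterm kterm_graded kterm_comul (fun=> erefl).

(** The counit of the unit coalgebra is the identity, so a morphism into it is forced to be the
    counit of [T]. *)
Lemma cterm_uniq (f g : chom T cunit) : f = g.
Proof.
apply: chom_eq => x; have := chom_counit f x; rewrite -(chom_counit g x).
exact.
Qed.

End Terminal.

End Unit.

Section Associativity.
Variables A B C : coalg.

Lemma tassoc_tmiddle (t : tensor (tensor (tensor A A) (tensor B B)) (tensor C C)) :
  tmap tassoc tassoc (tmiddle phi (tensor A B) (gtensor A B) C C
    (tmap (tmiddle phi A A B B) idfun t)) =
  tmiddle phi A A (gtensor B C) (tensor B C)
    (tmap idfun (tmiddle phi B B C C) (tassoc t)).
Proof.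
move: t; apply: (span_ext
  (f := tmap tassoc tassoc \o (tmiddle phi (tensor A B) (gtensor A B) C C
    \o tmap (tmiddle phi A A B B) idfun))
  (g := tmiddle phi A A (gtensor B C) (tensor B C) \o
    (tmap idfun (tmiddle phi B B C C) \o tassoc))); [by []|by []|span_solve|].
move=> _ [_ [_ [[_ [_ [[a1 [a2 [_ [a ha] ->]]] [b1 [b2 [[b hb] [b' hb'] ->]]] ->]]]
  [c1 [c2 [[c hc] _ ->]]] ->]]].
rewrite tassoc_pure !tmap_pure (tmiddleE _ _ _ ha hb) // (tmiddleE _ _ _ hb' hc) //.
rewrite tpureZl tpureZr (linearZ_LR (tmiddle phi _ _ _ _)) (linearZ_LR (tmap tassoc _)).
rewrite (linearZ_LR (tmiddle phi A A _ _)) /=.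
rewrite (tmiddleE _ _ _ (deg_pure ha hb' erefl) hc) //.
rewrite (tmiddleE _ _ _ ha (deg_pure hb hc erefl)) //.
rewrite (linearZ_LR (tmap tassoc _)) tmap_pure !tassoc_pure !scalerA.
by rewrite cf_mull // cf_mulr //; congr (_ *: _); ring.
Qed.

Lemma tassoc_graded : graded (V := gtensor (gtensor A B) C) (W := gtensor A (gtensor B C)) tassoc.
Proof.
pose W := gtensor A (gtensor B C).
move=> g t ht; apply: (tensor_degP (V := gtensor A B) (W := C)
  (S := fun t => gv_deg (g := W) g (tassoc t)) ht).
- by rewrite linear0; apply: (deg0 W).
- by move=> x y; rewrite linearD; apply: (@degD _ _ W).
move=> a b x y <- hx hy.
apply: (tensor_degP (V := A) (W := B) (S := fun x => gv_deg (g := W) (a + b)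
  (tassoc (x \ot y))) hx).
- by rewrite linear0l linear0; apply: (deg0 W).
- by move=> x1 x2; rewrite linearDl linearD; apply: (@degD _ _ W).
move=> c d x1 x2 <- h1 h2; rewrite tassoc_pure.
by apply: deg_pure h1 (deg_pure h2 hy erefl) _; rewrite addrA.
Qed.

Fact cassoc_comul x : cc_comul (cprod A (cprod B C)) (tassoc x) =
  tmap tassoc tassoc (cc_comul (cprod (cprod A B) C) x).
Proof.
move: x; apply: (span_ext (V := tensor (tensor A B) C)
  (f := prod_comul A (cprod B C) \o tassoc)
  (g := tmap tassoc tassoc \o prod_comul (cprod A B) C)); [by []|by []|span_solve|].
move=> _ [_ [z [[x [y [_ _ ->]]] _ ->]]].
rewrite tassoc_pure !cprod_comulE !tmap_pure !cprod_comulE !tmap_pure.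
have := tassoc_tmiddle ((cc_comul A x \ot cc_comul B y) \ot cc_comul C z).
by rewrite tassoc_pure !tmap_pure => <-.
Qed.

Fact cassoc_counit x : cc_counit (cprod A (cprod B C)) (tassoc x) =
  cc_counit (cprod (cprod A B) C) x.
Proof.
move: x; apply: (span_ext_scalar (V := tensor (tensor A B) C)
  (f := prod_counit A (cprod B C) \o tassoc)
  (g := prod_counit (cprod A B) C)); [by []|by []|span_solve|].
move=> _ [_ [z [[x [y [_ _ ->]]] _ ->]]].
by rewrite tassoc_pure !cprod_counit_pure mulrA.
Qed.

Definition cassoc : chom (cprod (cprod A B) C) (cprod A (cprod B C)) :=
  @CHom (cprod (cprod A B) C) (cprod A (cprod B C)) tassoc
    tassoc_graded cassoc_comul cassoc_counit.

End Associativity.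

End Coalgebras.

(** * Representable functors on coalgebras *)

Section Separation.
Variable k : fieldType.

Section Functional.
Variables (V : lmodType k) (x0 : V).
Hypothesis x0_neq0 : x0 != 0.

Definition lin_closed (A : set V) := forall a x y, A x -> A y -> A (a *: x + y).

(** Zorn's lemma gives a subspace maximal among those avoiding [x0], and such a subspace is a
    complement of the line through [x0]. *)
Lemma hyperplane_ex : exists A : set V,
  [/\ lin_closed A, A 0, ~ A x0 & forall y, exists c, A (y - c *: x0)].
Proof.
have [|A [[cA nA] mA]] := @Zorn_bigcup V (fun A => lin_closed A /\ ~ A x0).
  move=> F hF tF; split; last by case=> X /hF [].
  move=> a x y [X FX Xx] [Y FY Yy].
  have [XY|YX] := tF _ _ FX FY.
    by exists Y => //; apply: (proj1 (hF _ FY)) => //; apply: XY.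
  by exists X => //; apply: (proj1 (hF _ FX)) => //; apply: YX.
(* [lin_closed] admits the empty set, which is the union of the empty chain. Maximality excludes it,
   because the zero subspace is larger and still avoids [x0]. *)
have A0 : A 0.
  apply: contrapT => nA0.
  have eA y : ~ A y by move=> Ay; apply: nA0; rewrite -(addNr y) -scaleN1r; apply: cA.
  apply: (mA [set 0]%classic).
    by split=> [y /eA|/(_ 0 erefl)].
  split=> [a x y /= -> ->|/= /eqP]; first by rewrite scaler0 addr0.
  by rewrite (negPf x0_neq0).
exists A; split=> // y; apply: contrapT => /forallNP ny.
(* If no translate of [y] along [x0] lies in [A], then A + k y still avoids [x0]: from x0 = z + c y
   with c nonzero, y - c^-1 x0 would lie in [A]. This contradicts maximality. *)
pose B := [set z | exists a c, A a /\ z = a + c *: y]%classic.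
have AB : (A `<=` B)%classic by move=> z Az; exists z, 0; rewrite scale0r addr0.
have [AltB|nB] := pselect (A `<` B)%classic; last first.
  apply: nB; split=> // BA; apply: (ny 0); rewrite scale0r subr0; apply: BA.
  by exists 0, 1; rewrite scale1r add0r.
apply: (mA B) => //; split=> [a _ _ [z [c [Az ->]]] [z' [c' [Az' ->]]]|].
  exists (a *: z + z'), (a * c + c'); split; first exact: cA.
  by rewrite scalerDr scalerA scalerDl addrACA.
case=> z [c [Az e]]; have [c0|c0] := eqVneq c 0.
  by apply: nA; rewrite e c0 scale0r addr0.
apply: (ny c^-1); rewrite e scalerDr scalerA mulVf // scale1r opprD addrCA subrr addr0.
by rewrite -scaleNr -[_ *: _]addr0; apply: cA.
Qed.

(** The functional is the coordinate along [x0] modulo the hyperplane; it takes the value 1 at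
    [x0]. *)
Lemma scalar_neq0 : exists xi : {scalar V}, xi x0 != 0.
Proof.
have [A [cA A0 nA ex]] := hyperplane_ex.
have uniq y c c' : A (y - c *: x0) -> A (y - c' *: x0) -> c = c'.
  move=> h h'; apply: contrapT => /eqP; rewrite -subr_eq0 => n; apply: nA.
  have := cA (- 1) _ _ h h'; rewrite scaleN1r opprB addrA subrK -scalerBl => hx.
  by have := cA (c - c')^-1 _ _ hx A0; rewrite addr0 scalerA mulVf // scale1r.
pose f y := projT1 (cid (ex y)).
have fP y : A (y - f y *: x0) := projT2 (cid (ex y)).
have fl : scalar f.
  move=> a x y; apply: (uniq (a *: x + y)) => //=.
  have := cA a _ _ (fP x) (fP y).
  by rewrite scalerBr scalerA scalerDl opprD addrACA.
pose fL := GRing.isLinear.Build k V k _ f fl.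
exists (HB.pack f fL : {scalar V}) => /=.
rewrite (uniq x0 (f x0) 1) ?oner_neq0 //; by rewrite scale1r subrr.
Qed.

End Functional.

Lemma scalar_sep (V : lmodType k) (x : V) : (forall xi : {scalar V}, xi x = 0) -> x = 0.
Proof.
move=> h; apply/eqP/negPn/negP => /scalar_neq0 [xi].
by rewrite h eqxx.
Qed.

Definition teval (V W : lmodType k) (xi : {scalar V}) (eta : {scalar W}) :
  {scalar tensor V W} := eta \o tcontractl xi.

Lemma teval_pure (V W : lmodType k) (xi : {scalar V}) (eta : {scalar W}) x y :
  teval xi eta (x \ot y) = xi x * eta y.
Proof. by rewrite /teval /= tcontractl_pure scalarZE. Qed.

(** Induction on the number of pure tensors in a representing sum. If the first one is a (x) b with
    [a] nonzero, some functional [xi i0] is nonzero at [a]; since the [eta j] separate points, [b]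
    is then a combination of the remaining second factors, and substituting it shortens the sum. *)
Lemma tensor_sep (V W : lmodType k) (I J : Type) (xi : I -> {scalar V})
    (eta : J -> {scalar W}) :
  (forall x, (forall i, xi i x = 0) -> x = 0) ->
  (forall y, (forall j, eta j y = 0) -> y = 0) ->
  forall t, (forall i j, teval (xi i) (eta j) t = 0) -> t = 0.
Proof.
move=> sx sy t; have [s ->] := tensor_sum t.
have [n] := ubnP (size s); elim: n s => // n IH [|[a b] s]; first by rewrite big_nil.
rewrite ltnS => sn; rewrite big_cons => h0.
have h i j : teval (xi i) (eta j) (a \ot b + \sum_(p <- s) p.1 \ot p.2) = 0.
  exact: h0.
rewrite -[(a, b).1]/a -[(a, b).2]/b; clear h0.
have [a0|/eqP a0] := eqVneq a 0.
  rewrite a0 linear0l add0r; apply: IH => // i j.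
  by have := h i j; rewrite linearD a0 linear0l linear0 add0r.
have [i0 ai0] : exists i, xi i a != 0.
  apply: contrapT => /forallNP n0; apply: a0; apply: sx => i.
  by apply/eqP/negPn/negP/n0.
have hb : b = - \sum_(p <- s) (xi i0 a)^-1 *: (xi i0 p.1 *: p.2).
  apply/eqP; rewrite -subr_eq0 opprK; apply/eqP/sy => j.
  apply: (mulfI ai0); rewrite mulr0 linearD linear_sum mulrDr mulr_sumr /=.
  rewrite -[RHS](h i0 j) [RHS]linearD teval_pure [in RHS]linear_sum; congr (_ + _).
  apply: eq_bigr => p _; rewrite [RHS]teval_pure.
  by rewrite !scalarZE mulVKf.
have e : a \ot b + \sum_(p <- s) p.1 \ot p.2 =
    \sum_(p <- [seq (p.1 - ((xi i0 a)^-1 * xi i0 p.1) *: a, p.2) | p <- s]) p.1 \ot p.2.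
  rewrite big_map hb linearNr linear_sumr -sumrN -big_split; apply: eq_bigr => p _ /=.
  have -> x y z : (x - y : V) \ot (z : W) = x \ot z - y \ot z by rewrite linearBl.
  by rewrite tpureZl !tpureZr scalerA addrC.
rewrite e; apply: IH; first by rewrite size_map.
by move=> i j; rewrite -e.
Qed.

End Separation.

(** * The coalgebra of functions on words *)

Section Representability.
Variables (G : zmodType) (k : fieldType) (phi : G -> G -> k).
Hypothesis hphi : commutation_factor phi.
Local Notation coalg := (coalg phi).

(** The map t |-> a(t_1) t_2. The functional [b \o act a] is the convolution product of [a] and [b],
    so [act_act] says that the convolution algebra of functionals acts on [T]. *)
Definition act (T : coalg) (a : {scalar T}) : {linear T -> T} :=
  tcontractl a \o cc_comul T.

Lemma actE (T : coalg) (a : {scalar T}) t : act a t = tcontractl a (cc_comul T t).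
Proof. by []. Qed.

Lemma tcontractl_map (V V' W W' : lmodType k) (f : {linear V -> V'})
    (g : {linear W -> W'}) (a : {scalar V'}) t :
  tcontractl a (tmap f g t) = g (tcontractl (a \o f) t).
Proof.
move: t; apply: (span_ext (f := tcontractl a \o tmap f g)
  (g := g \o tcontractl (a \o f))); [by []|by []|span_solve|].
by move=> _ [x [y [_ _ ->]]]; rewrite tmap_pure !tcontractl_pure linearZ_LR.
Qed.

Lemma eq_tcontractl (V W : lmodType k) (a b : {scalar V}) (t : tensor V W) :
  a =1 b -> tcontractl a t = tcontractl b t.
Proof.
move=> e; move: t; apply: (span_ext (f := tcontractl a)
  (g := tcontractl b)); [by []|by []|span_solve|].
by move=> _ [x [y [_ _ ->]]]; rewrite !tcontractl_pure e.
Qed.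

Lemma tcontractl_assoc (U V W : lmodType k) (a : {scalar U}) (b : {scalar V})
    (t : tensor (tensor U V) W) :
  tcontractl b (tcontractl a (tassoc t)) = tcontractl (teval a b) t.
Proof.
move: t; apply: (span_ext (f := tcontractl b \o (tcontractl a \o tassoc))
  (g := tcontractl (teval a b))); [by []|by []|span_solve|].
move=> _ [_ [z [[x [y [_ _ ->]]] _ ->]]].
rewrite tassoc_pure !tcontractl_pure linearZ_LR tcontractl_pure teval_pure.
by rewrite scalerA.
Qed.

Lemma act_act (T : coalg) (a b : {scalar T}) t :
  act b (act a t) = act (b \o act a) t.
Proof.
rewrite !actE.
have -> : cc_comul T (tcontractl a (cc_comul T t)) =
    tcontractl a (tmap idfun (cc_comul T) (cc_comul T t)).
  by rewrite tcontractl_map; congr (cc_comul T _); apply: eq_tcontractl.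
rewrite -cc_comulA tcontractl_assoc tcontractl_map.
by apply: eq_tcontractl.
Qed.

(** As a consequence the one-letter word [[:: l]] evaluates to the letter [l] itself. *)
Lemma act_counit (T : coalg) (a : {scalar T}) t : cc_counit T (act a t) = a t.
Proof.
rewrite actE -[in RHS](cc_counitr t); move: (cc_comul T t).
apply: (span_ext_scalar (V := tensor T T) (f := cc_counit T \o tcontractl a)
  (g := a \o tcontractr (cc_counit T))); [by []|by []|span_solve|].
move=> _ [x [y [_ _ ->]]].
by rewrite tcontractl_pure tcontractr_pure !scalarZE mulrC.
Qed.

Definition homog_scalar (V : gvect G k) (d : G) (a : {scalar V}) : Prop :=
  forall g x, gv_deg g x -> g != d -> a x = 0.

Lemma tcontractl_deg (V W : gvect G k) d (a : {scalar V}) g t :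
  homog_scalar d a -> gv_deg (g := gtensor V W) g t -> gv_deg (g - d) (tcontractl a t : W).
Proof.
move=> ha ht; apply: (tensor_degP (V := V) (W := W)
  (S := fun t => gv_deg (g - d) (tcontractl a t : W)) ht).
- by rewrite linear0; apply: deg0.
- by move=> x y; rewrite linearD; apply: degD.
move=> b c x y <- hx hy; rewrite tcontractl_pure.
have [->|bd] := eqVneq b d; first by rewrite addrC addKr; apply: deg_scale.
by rewrite (ha _ _ hx bd) scale0r; apply: deg0.
Qed.

Lemma homog_scalar_comp (V : gvect G k) (d : G) (a : {scalar V}) (x : V) :
  homog_scalar d a -> a x = a (gcomp x d).
Proof.
move=> ha; move: x; apply: (span_ext_scalar (f := a) (g := a \o gproj d));
  [by []|by []|exact: homog_spanning|].
move=> x [g hx]; rewrite (gcomp_homog hx); case: eqP => [//|/eqP n].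
by rewrite linear0 (ha _ _ hx) // eq_sym.
Qed.

Variables (F : coalg -> Type) (pull : forall T S, chom T S -> F S -> F T).
Variables (L : Type) (d : L -> G) (test : forall T, F T -> L -> {scalar T}).

Hypothesis test_nat : forall T S (h : chom T S) f l t,
  test (pull h f) l t = test f l (h t).
Hypothesis test_deg : forall T (f : F T) l, homog_scalar (d l) (test f l).

(* word_eval f [:: l1; ...; ln] t is the sum of l1(t_1) ... ln(t_n) over the
   iterated coproduct t_1 (x) ... (x) t_n of t. *)
Fixpoint word_eval (T : coalg) (f : F T) (w : seq L) : {scalar T} :=
  if w is l :: w' then word_eval f w' \o act (test f l) else cc_counit T.

Lemma word_eval_nat T S (h : chom T S) f w t :
  word_eval (pull h f) w t = word_eval f w (h t).
Proof.
elim: w t => [|l w IH] t /=; first by rewrite chom_counit.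
rewrite [LHS]IH; congr (word_eval f w _).
rewrite [RHS]actE chom_comul tcontractl_map; apply: (congr1 h).
by apply: eq_tcontractl => x; apply: test_nat.
Qed.

(** Coassociativity in terms of words: cutting a word in two amounts to evaluating its halves on t_1
    and t_2. This is why concatenation can define the coproduct. *)
Lemma word_eval_cat T (f : F T) u v t :
  word_eval f (u ++ v) t = word_eval f v (act (word_eval f u) t).
Proof.
elim: u t => [|l u IH] t; first by rewrite actE cc_counitl.
rewrite [LHS]IH; apply: congr1; rewrite act_act.
by apply: eq_tcontractl.
Qed.

Definition word_deg (w : seq L) : G := \sum_(l <- w) d l.

Lemma word_eval_deg T (f : F T) w : homog_scalar (word_deg w) (word_eval f w).
Proof.
rewrite /word_deg; elim: w => [|l w IH] g t ht; first by rewrite big_nil; apply: cc_counit_deg.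
rewrite big_cons => n; apply: (IH (g - d l)) => /=.
  by apply: tcontractl_deg (@test_deg _ f l) (cc_comul_deg ht).
by rewrite subr_eq addrC.
Qed.

Arguments word_eval_deg {T} f w [g x] _ _.

(* The representing coalgebra consists of all functions on words of the form
   w |-> word_eval f w t and their sums; T ranges over all coalgebras, but only
   inside a proposition, so the carrier stays small. *)
Definition germ_fun T (f : F T) (t : T) : seq L -> k^o := fun w => word_eval f w t.

Definition is_germ_sum (x : seq L -> k^o) : Prop :=
  forall S : set (seq L -> k^o), S 0 ->
  (forall a x y, S x -> S y -> S (a *: x + y)) ->
  (forall T (f : F T) t, S (germ_fun f t)) -> S x.

Definition germ_pred : {pred (seq L -> k^o)} := fun x => `[<is_germ_sum x>].

Lemma germ_predP x : reflect (is_germ_sum x) (x \in germ_pred).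
Proof. exact: asboolP. Qed.

Fact germ_submod : submod_closed germ_pred.
Proof.
split=> [|a x y /germ_predP hx /germ_predP hy]; apply/germ_predP => S S0 SD hS.
  exact: S0.
by apply: (SD); [exact: (hx S S0 SD hS)|exact: (hy S S0 SD hS)].
Qed.

HB.instance Definition _ :=
  GRing.isSubmodClosed.Build k (seq L -> k^o) germ_pred (GRing.submod_closed_semi germ_submod).

Record germs := Germs { germ_val :> seq L -> k^o; _ : germ_val \in germ_pred }.
HB.instance Definition _ := [isSub for germ_val].
HB.instance Definition _ := [Choice of germs by <:].
HB.instance Definition _ := [SubChoice_isSubLmodule of germs by <:].

Lemma germs_eq (x y : germs) : (forall w, x w = y w) -> x = y.
Proof. by move=> e; apply/val_inj/funext. Qed.

Fact germ_in T (f : F T) t : germ_fun f t \in germ_pred.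
Proof. by apply/germ_predP => S _ _; apply. Qed.

Definition germ T (f : F T) (t : T) : germs := Germs (germ_in f t).

Fact germ_linear T (f : F T) : linear (germ f).
Proof. by move=> a x y; apply: germs_eq => w /=; rewrite /germ_fun linearP. Qed.
HB.instance Definition _ T (f : F T) :=
  GRing.isLinear.Build k T germs _ (germ f) (germ_linear f).

Definition germ_set : set germs := [set x | exists T (f : F T) t, x = germ f t].

Lemma germ_spanning : spanning germ_set.
Proof.
move=> S S0 SD hS [x hx]; move/germ_predP: (hx) => hx'.
have [y Sy e] : exists2 y : germs, S y & germ_val y = x.
  apply: (hx' (fun x => exists2 y : germs, S y & germ_val y = x)).
  - by exists 0.
  - by move=> a _ _ [y Sy <-] [z Sz <-]; exists (a *: y + z); first exact: SD.
  - by move=> T f t; exists (germ f t) => //; apply: hS; exists T, f, t.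
by have -> : Germs hx = y by apply/val_inj.
Qed.

Definition word_at (w : seq L) (x : germs) : k := x w.
Fact word_at_linear w : scalar (word_at w). Proof. by []. Qed.
HB.instance Definition _ w :=
  GRing.isLinear.Build k germs k _ (word_at w) (word_at_linear w).

Lemma word_at_germ T (f : F T) w t : word_at w (germ f t) = word_eval f w t.
Proof. by []. Qed.

Lemma word_at_sep (x : germs) : (forall w, word_at w x = 0) -> x = 0.
Proof. by move=> h; apply: germs_eq => w; apply: h. Qed.

Definition germ_deg (g : G) : set germs :=
  [set x | forall w, word_deg w != g -> word_at w x = 0].

Lemma word_eval_gcomp T (f : F T) w g t :
  word_eval f w (gcomp t g) = if word_deg w == g then word_eval f w t else 0.
Proof.
case: eqP => [<-|/eqP n]; first by rewrite -(homog_scalar_comp t (word_eval_deg f w)).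
by apply: (word_eval_deg f w (gcompP_deg t g)); rewrite eq_sym.
Qed.

Definition germ_cut (g : G) (x : seq L -> k^o) : seq L -> k^o :=
  fun w => if word_deg w == g then x w else 0.

(** Words are homogeneous functionals, so keeping only the words of degree [g] in the function
    attached to [t] gives the function attached to the degree [g] component of [t]. *)
Fact germ_cut_in g (x : germs) : germ_cut g x \in germ_pred.
Proof.
move: x; apply: germ_spanning => [|a x y hx hy|_ [T [f [t ->]]]].
- rewrite (_ : germ_cut g _ = 0); first exact: rpred0.
  by apply/funext => w; rewrite /germ_cut; case: ifP.
- rewrite (_ : germ_cut g _ = a *: germ_cut g x + germ_cut g y).
    exact: (proj2 germ_submod a _ _ hx hy).
  apply/funext => w; rewrite -[RHS]/(a * germ_cut g x w + germ_cut g y w) /germ_cut.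
  by case: ifP => // _; rewrite mulr0 addr0.
- rewrite (_ : germ_cut g _ = germ f (gcomp t g)); first exact: germ_in.
  by apply/funext => w; rewrite /= /germ_fun word_eval_gcomp.
Qed.

Definition germ_proj g (x : germs) : germs := Germs (germ_cut_in g x).
Fact germ_proj_linear g : linear (germ_proj g).
Proof.
move=> a x y; apply: germs_eq => w.
rewrite -[RHS]/(a * germ_cut g x w + germ_cut g y w) /= /germ_cut.
by case: ifP => // _; rewrite mulr0 addr0.
Qed.
HB.instance Definition _ g :=
  GRing.isLinear.Build k germs germs _ (germ_proj g) (germ_proj_linear g).

Lemma germ_proj_germ T (f : F T) g t : germ_proj g (germ f t) = germ f (gcomp t g).
Proof. by apply: germs_eq => w /=; rewrite /germ_fun word_eval_gcomp. Qed.

Lemma germ_proj_sum x : finite_set [set g | germ_proj g x != 0] /\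
  x = \sum_(g \in [set: G]) germ_proj g x.
Proof.
move: x; apply: germ_spanning => [|a x y [fx ex] [fy ey]|_ [T [f [t ->]]]].
- split; last by apply/esym/fsbig1 => g _; rewrite linear0.
  by apply: sub_finite_set (finite_set0 G) => g /=; rewrite linear0 eqxx.
- split; first by under eq_set do rewrite linearP; apply: finite_supp_linear.
  by under eq_fsbigr do rewrite linearP /=; rewrite fsum_linear // -ex -ey.
have [ft _ et] := gcompP t.
have z g : ~ [set g | gcomp t g != 0]%classic g -> gcomp t g = 0.
  by move=> /negP /negPn /eqP.
split.
  apply: sub_finite_set ft => g /=; rewrite germ_proj_germ.
  by apply: contra_neq => ->; rewrite linear0.
under eq_fsbigr do rewrite germ_proj_germ.
rewrite (fsum_finE ft) => [|g /z ->]; last by rewrite linear0.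
by rewrite -linear_sum -(fsum_finE ft) // -et.
Qed.

Fact germ_grading : is_grading germ_deg.
Proof.
apply: (@mk_grading _ _ _ _ germ_proj) => [g a x y hx hy w n|g x w n|g h x hx|x|x].
- by rewrite linearP /= hx // hy // mulr0 addr0.
- by rewrite /word_at /= /germ_cut (negPf n).
- apply: germs_eq => w; rewrite /= /germ_cut.
  case: (h =P g) => [->|n].
    by case: eqP => // /eqP n; apply/esym; apply: hx.
  by case: eqP => // e; apply: hx; rewrite e; apply/eqP.
- by case: (germ_proj_sum x).
by case: (germ_proj_sum x).
Qed.

Definition germ_gvect : gvect G k := GVect germ_grading.

Lemma germ_graded T (f : F T) : graded (W := germ_gvect) (germ f).
Proof.
by move=> g t ht w n; rewrite word_at_germ (word_eval_deg f w ht) // eq_sym.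
Qed.

Lemma teval_map (V V' W W' : lmodType k) (a : {scalar V'}) (b : {scalar W'})
    (f : {linear V -> V'}) (g : {linear W -> W'}) t :
  teval a b (tmap f g t) = b (g (tcontractl (a \o f) t)).
Proof. by rewrite /teval /= tcontractl_map. Qed.

Lemma germ_comul_ex (x : germs) : exists t : tensor germs germs,
  forall u v, teval (word_at u) (word_at v) t = word_at (u ++ v) x.
Proof.
move: x; apply: germ_spanning => [|a x y [s hs] [t ht]|_ [T [f [t ->]]]].
- by exists 0 => u v; rewrite !linear0.
- by exists (a *: s + t) => u v; rewrite [LHS]linearP hs ht [RHS]linearP.
exists (tmap (germ f) (germ f) (cc_comul T t)) => u v.
by rewrite teval_map !word_at_germ word_eval_cat.
Qed.

(* The coproduct of x is the function (u, v) |-> x (u ++ v), which lies in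
   germs (x) germs because words separate the points of that space. *)
Definition germ_comul (x : germs) : tensor germs germs := projT1 (cid (germ_comul_ex x)).

Lemma germ_comulP x u v :
  teval (word_at u) (word_at v) (germ_comul x) = word_at (u ++ v) x.
Proof. exact: (projT2 (cid (germ_comul_ex x))). Qed.

Lemma germ_tensor_sep (s t : tensor germs germs) :
  (forall u v, teval (word_at u) (word_at v) s = teval (word_at u) (word_at v) t) ->
  s = t.
Proof.
move=> h; apply/eqP; rewrite -subr_eq0; apply/eqP.
apply: (tensor_sep word_at_sep word_at_sep) => u v.
by rewrite linearB h subrr.
Qed.

Fact germ_comul_linear : linear germ_comul.
Proof.
move=> a x y; apply: germ_tensor_sep => u v.
by rewrite [RHS]linearP !germ_comulP [LHS]linearP.
Qed.
HB.instance Definition _ :=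
  GRing.isLinear.Build k germs (tensor germs germs) _ germ_comul germ_comul_linear.

Lemma germ_comul_germ T (f : F T) t :
  germ_comul (germ f t) = tmap (germ f) (germ f) (cc_comul T t).
Proof.
apply: germ_tensor_sep => u v.
by rewrite germ_comulP teval_map !word_at_germ word_eval_cat.
Qed.

Definition germ_counit : germs -> k := word_at [::].
HB.instance Definition _ := GRing.Linear.on germ_counit.

Lemma germ_counit_germ T (f : F T) t : germ_counit (germ f t) = cc_counit T t.
Proof. by []. Qed.

Lemma germ_homog g (x : germs) : germ_deg g x -> x = germ_proj g x.
Proof.
move=> hx; apply: germs_eq => w; rewrite /= /germ_cut; case: eqP => // /eqP n.
exact: hx.
Qed.

Fact germ_comul_deg : graded (V := germ_gvect) (W := gtensor germ_gvect germ_gvect) germ_comul.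
Proof.
move=> g x /germ_homog ->; move: x; apply: germ_spanning => [|a x y hx hy|_ [T [f [t ->]]]].
- by rewrite !linear0; apply: (deg0 (gtensor germ_gvect germ_gvect)).
- rewrite !linearP; apply: (deg_lin (gv_grading (gtensor germ_gvect germ_gvect)));
    [exact: hx|exact: hy].
rewrite germ_proj_germ germ_comul_germ.
by apply: (tmap_graded (germ_graded f) (germ_graded f)); apply/cc_comul_deg/gcompP_deg.
Qed.

Fact germ_counit_deg g x : gv_deg (g := germ_gvect) g x -> g != 0 -> germ_counit x = 0.
Proof. by move=> hx g0; apply: hx; rewrite /word_deg big_nil eq_sym. Qed.

(** Elements [germ f t] span, and [germ f] intertwines the coproduct of [T] with [germ_comul]; the
    axiom is therefore inherited from the coalgebras [T], and likewise for the counit laws and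
    cocommutativity. *)
Fact germ_comulA x :
  tassoc (tmap germ_comul idfun (germ_comul x)) = tmap idfun germ_comul (germ_comul x).
Proof.
move: x; apply: (span_ext (f := tassoc \o (tmap germ_comul idfun \o germ_comul))
  (g := tmap idfun germ_comul \o germ_comul)); [by []|by []|exact: germ_spanning|].
move=> _ [T [f [t ->]]]; rewrite germ_comul_germ.
rewrite (tmap_comp germ_comul) (tmap_comp idfun).
rewrite (@eq_tmap _ _ _ _ _ _ (tmap (germ f) (germ f) \o cc_comul T) _ (germ f \o idfun));
  [|exact: germ_comul_germ|by []].
rewrite (@eq_tmap _ _ _ _ _ _ (germ f \o idfun) _ (tmap (germ f) (germ f) \o cc_comul T));
  [|by []|exact: germ_comul_germ].
rewrite -(tmap_comp (tmap (germ f) (germ f))) -(tmap_comp (germ f)) tassoc_nat.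
by rewrite cc_comulA.
Qed.

Fact germ_counitl x : tcontractl germ_counit (germ_comul x) = x.
Proof.
move: x; apply: (span_ext (f := tcontractl germ_counit \o germ_comul)
  (g := idfun)); [by []|by []|exact: germ_spanning|].
move=> _ [T [f [t ->]]]; rewrite germ_comul_germ tcontractl_map.
rewrite -[in RHS](cc_counitl t); apply: (congr1 (germ f)).
exact: eq_tcontractl.
Qed.

Lemma tcontractr_map (V V' W W' : lmodType k) (f : {linear V -> V'})
    (g : {linear W -> W'}) (a : {scalar W'}) t :
  tcontractr a (tmap f g t) = f (tcontractr (a \o g) t).
Proof.
move: t; apply: (span_ext (f := tcontractr a \o tmap f g)
  (g := f \o tcontractr (a \o g))); [by []|by []|span_solve|].
by move=> _ [x [y [_ _ ->]]]; rewrite tmap_pure !tcontractr_pure linearZ_LR.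
Qed.

Lemma eq_tcontractr (V W : lmodType k) (a b : {scalar W}) (t : tensor V W) :
  a =1 b -> tcontractr a t = tcontractr b t.
Proof.
move=> e; move: t; apply: (span_ext (f := tcontractr a)
  (g := tcontractr b)); [by []|by []|span_solve|].
by move=> _ [x [y [_ _ ->]]]; rewrite !tcontractr_pure e.
Qed.

Fact germ_counitr x : tcontractr germ_counit (germ_comul x) = x.
Proof.
move: x; apply: (span_ext (f := tcontractr germ_counit \o germ_comul)
  (g := idfun)); [by []|by []|exact: germ_spanning|].
move=> _ [T [f [t ->]]]; rewrite germ_comul_germ tcontractr_map.
rewrite -[in RHS](cc_counitr t); apply: (congr1 (germ f)).
exact: eq_tcontractr.
Qed.

Fact germ_comulC x : braid phi germ_gvect germ_gvect (germ_comul x) = germ_comul x.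
Proof.
move: x; apply: (span_ext (f := braid phi germ_gvect germ_gvect \o germ_comul)
  (g := germ_comul)); [by []|by []|exact: germ_spanning|].
move=> _ [T [f [t ->]]]; rewrite germ_comul_germ.
rewrite (@braid_nat _ _ phi T germ_gvect T germ_gvect (germ f) (germ f));
  try exact: germ_graded.
by rewrite cc_comulC.
Qed.

Definition germ_coalg : coalg := @Coalg _ _ phi germ_gvect germ_comul germ_counit
  germ_comul_deg germ_counit_deg germ_comulA germ_counitl germ_counitr germ_comulC.

Definition germ_hom T (f : F T) : chom T germ_coalg :=
  @CHom _ _ phi T germ_coalg (germ f) (germ_graded f)
    (germ_comul_germ f) (germ_counit_germ f).

Hypothesis test_sep : forall T (f f' : F T),
  (forall l t, test f l t = test f' l t) -> f = f'.

(** A descent condition: functionals [tau] on [E] that become the letters of elements of [F] along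
    morphisms jointly spanning [E] are the letters of an element of [F E]. Compatibility of the
    local elements is built in, as they restrict one [tau] and letters separate. *)
Hypothesis gluing : forall (E : coalg) (tau : L -> {scalar E}),
  spanning [set x | exists T (f : F T) (h : chom T E),
    (forall l t, tau l (h t) = test f l t) /\ exists t, x = h t] ->
  exists u : F E, forall l x, test u l x = tau l x.

(** The universal element [u] is glued along all [germ_hom f]; its letter [l] is evaluation at the
    one-letter word [[:: l]]. *)
Theorem germ_representable :
  exists (E : coalg) (u : F E), forall T (f : F T), exists! h : chom T E, pull h u = f.
Proof.
have [|u hu] := @gluing germ_coalg (fun l => word_at [:: l]).
  move=> S S0 SD hS; apply: germ_spanning => // _ [T [f [t ->]]].
  apply: hS; exists T, f, (germ_hom f); split; last by exists t.
  by move=> l s; apply: (act_counit (test f l) s).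
have pu T (f : F T) : pull (germ_hom f) u = f.
  apply: test_sep => l t; rewrite test_nat hu.
  exact: (act_counit (test f l) t).
(* The words of [u] are the coordinates of [germs]. A morphism [h] pulling [u] back to [f] therefore
   has the coordinates [word_eval f w], which gives uniqueness. *)
have ew w (x : germs) : word_eval u w x = word_at w x.
  move: x; apply: (span_ext_scalar (V := germs) (f := word_eval u w) (g := word_at w));
    [by []|by []|exact: germ_spanning|].
  move=> _ [T [f [t ->]]]; rewrite word_at_germ -{2}(pu T f).
  by rewrite (word_eval_nat (germ_hom f)).
exists germ_coalg, u => T f; exists (germ_hom f); split=> // h <-.
apply: chom_eq => t; apply: germs_eq => w.
by rewrite -[RHS]/(word_at w (h t)) -ew /= /germ_fun word_eval_nat.
Qed.

End Representability.

(** * Exponentials and equalizers of coalgebras *)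

Section Exponentials.
Variables (G : zmodType) (k : fieldType) (phi : G -> G -> k).
Hypothesis hphi : commutation_factor phi.
Local Notation coalg := (coalg phi).

Section ProductMap.
Variables (T T' S S' : coalg) (f : chom T T') (g : chom S S').

Fact cmap_comul x : cc_comul (cprod hphi T' S') (tmap f g x) =
  tmap (tmap f g) (tmap f g) (cc_comul (cprod hphi T S) x).
Proof.
rewrite !cprod_comulE (@tmiddle_nat _ _ phi _ _ _ _ _ _ _ _ f f g g);
  try exact: chom_deg.
rewrite (tmap_comp (cc_comul T')) (tmap_comp (tmap f f)); congr (tmiddle _ _ _ _ _ _).
by apply: eq_tmap => y; apply: chom_comul.
Qed.

Fact cmap_counit x : cc_counit (cprod hphi T' S') (tmap f g x) = cc_counit (cprod hphi T S) x.
Proof.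
move: x; apply: (span_ext_scalar (V := tensor T S)
  (f := prod_counit T' S' \o tmap f g) (g := prod_counit T S)); [by []|by []|span_solve|].
by move=> _ [x [y [_ _ ->]]]; rewrite tmap_pure !cprod_counit_pure !chom_counit.
Qed.

Definition cmap : chom (cprod hphi T S) (cprod hphi T' S') :=
  @CHom _ _ phi (cprod hphi T S) (cprod hphi T' S') (tmap f g)
    (tmap_graded (@chom_deg _ _ _ _ _ f) (@chom_deg _ _ _ _ _ g)) cmap_comul cmap_counit.

Lemma cmap_pure x y : cmap (x \ot y) = f x \ot g y.
Proof. exact: tmap_pure. Qed.

Lemma cmap_pair : cmap = cpair hphi (chom_comp f (cfst hphi T S)) (chom_comp g (csnd hphi T S)).
Proof.
rewrite [LHS]cpair_eta; congr (cpair hphi _ _); apply: chom_eq.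
- apply: (span_ext (V := tensor T S) (f := chom_comp (cfst hphi T' S') cmap)
    (g := chom_comp f (cfst hphi T S))); [by []|by []|span_solve|].
  move=> _ [x [y [_ _ ->]]]; rewrite /= [tmap _ _ _]tmap_pure.
  by rewrite [LHS]tcontractr_pure [tcontractr _ _]tcontractr_pure linearZ_LR chom_counit.
- apply: (span_ext (V := tensor T S) (f := chom_comp (csnd hphi T' S') cmap)
    (g := chom_comp g (csnd hphi T S))); [by []|by []|span_solve|].
  move=> _ [x [y [_ _ ->]]]; rewrite /= [tmap _ _ _]tmap_pure.
  by rewrite [LHS]tcontractl_pure [tcontractl _ _]tcontractl_pure linearZ_LR chom_counit.
Qed.

End ProductMap.

Definition tpurel (V W : lmodType k) (y : W) (x : V) : tensor V W := x \ot y.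
Fact tpurel_linear (V W : lmodType k) (y : W) : linear (@tpurel V W y).
Proof. by move=> a x x'; rewrite /tpurel linearPl. Qed.
HB.instance Definition _ (V W : lmodType k) (y : W) :=
  GRing.isLinear.Build k V (tensor V W) _ (@tpurel V W y) (tpurel_linear y).

Definition tpurer (V W : lmodType k) (x : V) (y : W) : tensor V W := x \ot y.
Fact tpurer_linear (V W : lmodType k) (x : V) : linear (@tpurer V W x).
Proof. by move=> a y y'; rewrite /tpurer linearPr. Qed.
HB.instance Definition _ (V W : lmodType k) (x : V) :=
  GRing.isLinear.Build k W (tensor V W) _ (@tpurer V W x) (tpurer_linear x).

Lemma gcomp_graded (V W : gvect G k) (f : {linear V -> W}) x g :
  graded f -> gcomp (f x) g = f (gcomp x g).
Proof.
move=> gf; move: x; apply: (span_ext (f := gproj g \o f) (g := f \o gproj g));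
  [by []|by []|exact: homog_spanning|].
move=> x [h hx]; rewrite (gcomp_homog hx) (gcomp_homog (gf _ _ hx)).
by case: eqP => // _; rewrite linear0.
Qed.

Lemma gvect_sep (V : gvect G k) (x y : V) :
  (forall g (xi : {scalar V}), xi (gcomp x g) = xi (gcomp y g)) -> x = y.
Proof.
move=> h; have [_ _ ->] := gcompP x; have [_ _ ->] := gcompP y.
apply: eq_fsbigr => g _; apply/eqP; rewrite -subr_eq0; apply/eqP/scalar_sep => xi.
by rewrite linearB /= h subrr.
Qed.

Variables (Y K W : coalg) (alpha beta : chom K W).

(** One functor serves two purposes: with [alpha = beta] it defines the exponential of [K] by [Y],
    and with [Y] the unit the equalizer of [alpha] and [beta]. *)
Definition expF (T : coalg) : Type :=
  {f : chom (cprod hphi T Y) K | chom_comp alpha f = chom_comp beta f}.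

Definition exp_pull (T S : coalg) (h : chom T S) (f : expF S) : expF T.
Proof.
exists (chom_comp (sval f) (cmap h (chom_id Y))).
abstract (by case: f => f /= e; apply: chom_eq => x; apply: (congr1 (fun g : chom _ W => g (cmap h (chom_id Y) x)) e)).
Defined.

(* The letter (a, y, g, xi) reads off xi of the degree g part of f(t (x) y_a). *)
Definition exp_letter : Type := (G * Y * G * {scalar K})%type.

(** Since [f] preserves degrees, the degree [g] part of f(t (x) y_a) only depends on the component
    of [t] of degree [g - a]. *)
Definition exp_deg (l : exp_letter) : G := l.1.2 - l.1.1.1.

Definition exp_test (T : coalg) (f : expF T) (l : exp_letter) : {scalar T} :=
  l.2 \o (gproj l.1.2 \o (sval f \o tpurel (gcomp l.1.1.2 l.1.1.1))).

Lemma exp_testE T (f : expF T) a y g (xi : {scalar K}) t :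
  exp_test f (a, y, g, xi) t = xi (gcomp (sval f (t \ot gcomp y a)) g).
Proof. by []. Qed.

Lemma exp_test_nat T S (h : chom T S) f l t :
  exp_test (exp_pull h f) l t = exp_test f l (h t).
Proof.
case: l => [[[a y] g] xi]; rewrite !exp_testE; congr (xi (gcomp _ g)).
by apply: (congr1 (sval f)); rewrite cmap_pure.
Qed.

Lemma exp_test_deg T (f : expF T) l : homog_scalar (exp_deg l) (exp_test f l).
Proof.
case: l => [[[a y] g] xi] b t ht n; rewrite exp_testE.
have := @chom_deg _ _ _ _ _ (sval f) _ _ (deg_pure ht (gcompP_deg y a) erefl).
move=> /gcomp_homog ->; case: eqP => [e|_]; last by rewrite linear0.
by rewrite /exp_deg /= e addrK eqxx in n.
Qed.

Lemma exp_ext T (f f' : expF T) :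
  (forall t y, sval f (t \ot y) = sval f' (t \ot y)) -> f = f'.
Proof.
case: f f' => [f e] [f' e'] /= h.
suff ef : f = f' by case: _ / ef in e' *; congr exist; apply: Prop_irrelevance.
apply: chom_eq; apply: (span_ext (V := tensor T Y) (f := f) (g := f'));
  [by []|by []|span_solve|].
by move=> _ [t [y [_ _ ->]]].
Qed.

Lemma homog_ext (V : gvect G k) (U : lmodType k) (f g : {linear V -> U}) :
  (forall x a, f (gcomp x a) = g (gcomp x a)) -> f =1 g.
Proof.
move=> h; apply: (eq_spanning (@homog_spanning _ _ V)) => x [a hx].
by have := h x a; rewrite (gcomp_homog hx) eqxx.
Qed.

Lemma exp_test_sep T (f f' : expF T) :
  (forall l t, exp_test f l t = exp_test f' l t) -> f = f'.
Proof.
move=> h; apply: exp_ext => t.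
apply: (homog_ext (f := sval f \o tpurer t) (g := sval f' \o tpurer t)) => y a.
apply: gvect_sep => g xi.
by have := h (a, y, g, xi) t; rewrite !exp_testE.
Qed.

(** * Descent for maps out of [T (x) Y] *)

Section Gluing.
Variables (E : coalg) (tau : exp_letter -> {scalar E}).

Definition exp_cover : set E := [set x | exists T (f : expF T) (h : chom T E),
    (forall l t, tau l (h t) = exp_test f l t) /\ exists t, x = h t].

Hypothesis cover : spanning exp_cover.

(** [v] is the value at [e] of the curried map E -> Hom(Y, K) that the letters [tau] prescribe. It
    is unique among linear maps, and its existence is linear in [e], hence needs checking only on
    the cover. *)
Definition glued (e : E) (v : Y -> K) : Prop :=
  forall a y g (xi : {scalar K}), tau (a, y, g, xi) e = xi (gcomp (v (gcomp y a)) g).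

Lemma glued_cover T (f : expF T) (h : chom T E) t :
  (forall l t, tau l (h t) = exp_test f l t) -> glued (h t) (sval f \o tpurer t).
Proof. by move=> hh a y g xi; rewrite hh. Qed.

Lemma glued_lin a e e' v v' : glued e v -> glued e' v' ->
  glued (a *: e + e') (fun y => a *: v y + v' y).
Proof. by move=> h h' b y g xi; rewrite linearP h h' gcomp_linear [RHS]linearP. Qed.

Lemma glued_uniq e (v v' : {linear Y -> K}) : glued e v -> glued e v' -> v =1 v'.
Proof.
move=> h h'; apply: homog_ext => y a; apply: gvect_sep => g xi.
by rewrite -h -h'.
Qed.

Lemma glued_ex e : exists v : {linear Y -> K}, glued e v.
Proof.
move: e; apply: cover => [|a x y [v hv] [v' hv']|_ [T [f [h [hh [t ->]]]]]].
- exists (\0 : {linear Y -> K}) => a y g xi.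
  by rewrite linear0 /= (_ : gcomp _ g = gproj g 0) // !linear0.
- exists (GRing.add_fun (GRing.scale_fun a v) v' : {linear Y -> K}).
  exact: glued_lin.
by exists (sval f \o tpurer t : {linear Y -> K}); apply: glued_cover.
Qed.

Definition glue_fun (e : E) : {linear Y -> K} := projT1 (cid (glued_ex e)).
Lemma glue_funP e : glued e (glue_fun e).
Proof. exact: (projT2 (cid (glued_ex e))). Qed.

Definition glue_bil (e : E) (y : Y) : K := glue_fun e y.
Fact glue_bilinear : bilinear_for *:%R *:%R glue_bil.
Proof.
split=> [y a e e'|e a y y']; last by rewrite /glue_bil /= linearP.
pose v := (GRing.add_fun (GRing.scale_fun a (glue_fun e)) (glue_fun e') : {linear Y -> K}).
apply: (glued_uniq (v' := v) (glue_funP _)).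
by apply: glued_lin; apply: glue_funP.
Qed.
HB.instance Definition _ :=
  bilinear_isBilinear.Build k E Y K _ _ glue_bil glue_bilinear.

Definition glue : {linear tensor E Y -> K} := tlift glue_bil.

Lemma glue_pure e y : glue (e \ot y) = glue_fun e y.
Proof. exact: tlift_pure. Qed.

Lemma glue_cover T (f : expF T) (h : chom T E) x :
  (forall l t, tau l (h t) = exp_test f l t) ->
  glue (cmap h (chom_id Y) x) = sval f x.
Proof.
move=> hh; move: x; apply: (span_ext (V := tensor T Y)
  (f := glue \o cmap h (chom_id Y)) (g := sval f)); [by []|by []|span_solve|].
move=> _ [t [y [_ _ ->]]]; rewrite cmap_pure glue_pure.
exact: (glued_uniq (v := glue_fun (h t)) (v' := sval f \o tpurer t) (glue_funP _)
  (glued_cover t hh)).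
Qed.

(** The cover stays spanning after tensoring with [Y]; with [glue_cover], the coalgebra identities
    for [glue] reduce to those of the morphisms [f]. *)
Lemma glue_spanning : spanning (V := tensor E Y) [set x |
  exists T (f : expF T) (h : chom T E),
    (forall l t, tau l (h t) = exp_test f l t) /\ exists z, x = cmap h (chom_id Y) z].
Proof.
move=> S S0 SD hS; apply: (spanning_pures cover (@spanningT _ Y)) => //.
move=> _ [_ [y [[T [f [h [hh [t ->]]]]] _ ->]]].
by apply: hS; exists T, f, h; split=> //; exists (t \ot y); rewrite cmap_pure.
Qed.

Fact glue_graded : graded (V := gtensor E Y) glue.
Proof.
move=> g x hx; apply: (tensor_degP (V := E) (W := Y)
  (S := fun x => gv_deg g (glue x)) hx).
- by rewrite linear0; apply: deg0.
- by move=> z z'; rewrite linearD; apply: degD.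
move=> a b e y <- he hy.
(* A homogeneous [e] is not presented as a combination of images of homogeneous elements. The claim
   for the degree [a] component of an arbitrary [e'] is linear in [e'], so the cover suffices. *)
suff h e' : gv_deg (a + b) (glue (gcomp e' a \ot y)).
  by have := h e; rewrite (gcomp_homog he) eqxx.
move: e'; apply: cover => [|c e1 e2 h1 h2|_ [T [f [h [hh [t ->]]]]]].
- by rewrite (_ : gcomp _ a = gproj a 0) // linear0 linear0l linear0; apply: deg0.
- by rewrite gcomp_linear linearPl linearP; apply: (deg_lin (gv_grading K)).
rewrite (gcomp_graded _ _ (@chom_deg _ _ _ _ _ h)).
rewrite -[gcomp t a in X in gv_deg _ X]/(gcomp t a).
have := glue_cover (gcomp t a \ot y) hh; rewrite cmap_pure => ->.
by apply: (@chom_deg _ _ _ _ _ (sval f)); apply: deg_pure (gcompP_deg t a) hy erefl.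
Qed.

Fact glue_comul x : cc_comul K (glue x) = tmap glue glue (cc_comul (cprod hphi E Y) x).
Proof.
move: x; apply: (span_ext (V := tensor E Y) (f := cc_comul K \o glue)
  (g := tmap glue glue \o cc_comul (cprod hphi E Y))); [by []|by []|exact: glue_spanning|].
move=> _ [T [f [h [hh [z ->]]]]]; rewrite (glue_cover z hh) !chom_comul.
rewrite [RHS](tmap_comp glue); apply: eq_tmap => x; exact/esym/(glue_cover x hh).
Qed.

Fact glue_counit x : cc_counit K (glue x) = cc_counit (cprod hphi E Y) x.
Proof.
move: x; apply: (span_ext_scalar (V := tensor E Y) (f := cc_counit K \o glue)
  (g := cc_counit (cprod hphi E Y))); [by []|by []|exact: glue_spanning|].
by move=> _ [T [f [h [hh [z ->]]]]]; rewrite (glue_cover z hh) !chom_counit.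
Qed.

Definition glue_hom : chom (cprod hphi E Y) K :=
  @CHom _ _ phi (cprod hphi E Y) K glue glue_graded glue_comul glue_counit.

Fact glue_eq : chom_comp alpha glue_hom = chom_comp beta glue_hom.
Proof.
apply: chom_eq; apply: (span_ext (V := tensor E Y) (f := alpha \o glue)
  (g := beta \o glue)); [by []|by []|exact: glue_spanning|].
move=> _ [T [f [h [hh [z ->]]]]].
apply: etrans (congr1 alpha (glue_cover z hh)) (etrans _ (esym (congr1 beta (glue_cover z hh)))).
exact: (congr1 (fun g : chom _ W => g z) (proj2_sig f)).
Qed.

Lemma exp_gluing : exists u : expF E, forall l x, exp_test u l x = tau l x.
Proof.
exists (exist _ glue_hom glue_eq) => -[[[a y] g] xi] e.
rewrite exp_testE (glue_funP e); congr (xi (gcomp _ g)); exact: glue_pure.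
Qed.

End Gluing.

Theorem exp_representable : exists (E : coalg) (u : expF E),
  forall T (f : expF T), exists! h : chom T E, exp_pull h u = f.
Proof.
exact: (germ_representable exp_test_nat exp_test_deg exp_test_sep exp_gluing).
Qed.

End Exponentials.

(** * Group objects in a cartesian closed category *)

Record cartesian (C : category) := Cartesian {
  one : C;
  bang : forall T : C, hom T one;
  bang_uniq : forall (T : C) (f g : hom T one), f = g;
  prd : C -> C -> C;
  fst_ : forall X Y : C, hom (prd X Y) X;
  snd_ : forall X Y : C, hom (prd X Y) Y;
  pair_ : forall T X Y : C, hom T X -> hom T Y -> hom T (prd X Y);
  fst_pair : forall (T X Y : C) (f : hom T X) (g : hom T Y),
    fst_ X Y \oc pair_ f g = f;
  snd_pair : forall (T X Y : C) (f : hom T X) (g : hom T Y),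
    snd_ X Y \oc pair_ f g = g;
  pair_eta : forall (T X Y : C) (h : hom T (prd X Y)),
    h = pair_ (fst_ X Y \oc h) (snd_ X Y \oc h);
  exp_eq : forall (Y K W : C) (al be : hom K W),
    exists (E : C) (u : hom (prd E Y) K), al \oc u = be \oc u /\
      forall (T : C) (f : hom (prd T Y) K), al \oc f = be \oc f ->
      exists! h : hom T E, u \oc pair_ (h \oc fst_ T Y) (snd_ T Y) = f
}.

(* The group object E seen through Yoneda: a group law on the functor hom(-, E). *)
Record group_on (C : category) (E : C) := GroupOn {
  gmul : forall T : C, hom T E -> hom T E -> hom T E;
  gone : forall T : C, hom T E;
  ginv : forall T : C, hom T E -> hom T E;
  gmulA : forall T (a b c : hom T E), gmul a (gmul b c) = gmul (gmul a b) c;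
  gmul1l : forall T (a : hom T E), gmul (gone T) a = a;
  gmulVl : forall T (a : hom T E), gmul (ginv a) a = gone T;
  gmul_nat : forall T S (h : hom S T) (a b : hom T E),
    gmul a b \oc h = gmul (a \oc h) (b \oc h)
}.

Section GroupOnTheory.
Variables (C : category) (E : C) (g : group_on E).
Implicit Types T S : C.

(** Through this an operation compatible with products also preserves units, and then inverses; it
    is why [gmul_nat] and [umap_mul] mention products alone. *)
Lemma gmul_idem T (a : hom T E) : gmul g a a = a -> a = gone g T.
Proof. by move=> e; rewrite -(gmulVl g a) -{3}e gmulA gmulVl gmul1l. Qed.

Lemma gmulVr T (a : hom T E) : gmul g a (ginv g a) = gone g T.
Proof.
apply: gmul_idem.
by rewrite -gmulA [gmul g (ginv g a) _]gmulA gmulVl gmul1l.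
Qed.

Lemma gmul1r T (a : hom T E) : gmul g a (gone g T) = a.
Proof. by rewrite -(gmulVl g a) gmulA gmulVr gmul1l. Qed.

Lemma gmulK T (a b : hom T E) : gmul g (gmul g a b) (ginv g b) = a.
Proof. by rewrite -gmulA gmulVr gmul1r. Qed.

Lemma gmulKV T (a b : hom T E) : gmul g (gmul g a (ginv g b)) b = a.
Proof. by rewrite -gmulA gmulVl gmul1r. Qed.

Lemma ginv_uniq T (a b : hom T E) : gmul g a b = gone g T -> b = ginv g a.
Proof. by move=> e; rewrite -[LHS](gmul1l g) -(gmulVl g a) -gmulA e gmul1r. Qed.

Lemma ginvK T (a : hom T E) : ginv g (ginv g a) = a.
Proof. by apply/esym/ginv_uniq; rewrite gmulVl. Qed.

Lemma ginv1 T : ginv g (gone g T) = gone g T.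
Proof. by apply/esym/ginv_uniq; rewrite gmul1l. Qed.

Lemma ginvM T (a b : hom T E) :
  ginv g (gmul g a b) = gmul g (ginv g b) (ginv g a).
Proof. by apply/esym/ginv_uniq; rewrite gmulA gmulK gmulVr. Qed.

Lemma gone_nat T S (h : hom S T) : gone g T \oc h = gone g S.
Proof. by apply: gmul_idem; rewrite -gmul_nat gmul1l. Qed.

Lemma ginv_nat T S (h : hom S T) (a : hom T E) : ginv g a \oc h = ginv g (a \oc h).
Proof. by apply: ginv_uniq; rewrite -gmul_nat gmulVr gone_nat. Qed.

Definition gsimp :=
  (gmulA g, gmulK, gmulKV, gmulVr, gmulVl g, gmul1l g, gmul1r, ginvM, ginvK, ginv1).

End GroupOnTheory.

(* Witnesses that D is equivalent to the category of group objects of C. *)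
Record groups_in (C D : category) := GroupsIn {
  und :> D -> C;
  umap : forall H K : D, hom H K -> hom (und H) (und K);
  umap_inj : forall (H K : D) (f g : hom H K), umap f = umap g -> f = g;
  umap_comp : forall (H K L : D) (f : hom K L) (g : hom H K),
    umap (f \oc g) = umap f \oc umap g;
  umap_id : forall H : D, umap (idc H) = idc (und H);
  ugrp : forall H : D, group_on (und H);
  umap_mul : forall (H K : D) (f : hom H K) (T : C) (a b : hom T (und H)),
    umap f \oc gmul (ugrp H) a b = gmul (ugrp K) (umap f \oc a) (umap f \oc b);
  ulift : forall (H K : D) (f : hom (und H) (und K)),
    (forall T (a b : hom T (und H)),
      f \oc gmul (ugrp H) a b = gmul (ugrp K) (f \oc a) (f \oc b)) ->
    exists f' : hom H K, umap f' = f;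
  uobj : forall (E : C) (g : group_on E),
    exists (H : D) (i : hom (und H) E) (j : hom E (und H)),
      [/\ j \oc i = idc _, i \oc j = idc _ &
          forall T (a b : hom T (und H)),
            i \oc gmul (ugrp H) a b = gmul g (i \oc a) (i \oc b)]
}.

Lemma left_adjoint_of_universal (A B : category) (F : functor A B) :
  (forall Y : B, exists (R : A) (ep : hom (F R) Y),
     forall (X : A) (f : hom (F X) Y), exists! g : hom X R, ep \oc fmap F g = f) ->
  is_left_adjoint F.
Proof.
move=> h; pose R Y := projT1 (cid (h Y)).
pose ep Y : hom (F (R Y)) Y := projT1 (cid (projT2 (cid (h Y)))).
have epP Y X (f : hom (F X) Y) : exists! g : hom X (R Y), ep Y \oc fmap F g = f :=
  projT2 (cid (projT2 (cid (h Y)))) X f.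
have ex Y X (f : hom (F X) Y) : exists g : hom X (R Y), ep Y \oc fmap F g = f.
  by have [g [hg _]] := epP Y X f; exists g.
pose tr X Y (f : hom (F X) Y) : hom X (R Y) := projT1 (cid (ex Y X f)).
have trP X Y (f : hom (F X) Y) : ep Y \oc fmap F (tr X Y f) = f := projT2 (cid (ex Y X f)).
have inj Y X (g g' : hom X (R Y)) : ep Y \oc fmap F g = ep Y \oc fmap F g' -> g = g'.
  by move=> e; have [w [_ uw]] := epP Y X (ep Y \oc fmap F g'); rewrite -(uw g) // -(uw g').
have R1 Y : tr _ _ (idc Y \oc ep Y) = idc (R Y).
  by apply: (inj); rewrite trP fmap1 compf1 comp1f.
have RM Y Y' Y'' (w' : hom Y' Y'') (w : hom Y Y') :
    tr _ _ ((w' \oc w) \oc ep Y) = tr _ _ (w' \oc ep Y') \oc tr _ _ (w \oc ep Y).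
  by apply: (inj); rewrite trP fmapM compA trP -!compA trP.
exists (@Functor B A R (fun Y Y' w => tr _ _ (w \oc ep Y)) R1 RM).
exists tr; split=> [X Y|X X' Y Y' v w f].
  exists (fun g => ep Y \oc fmap F g) => [f|g]; first exact: trP.
  by apply: (inj); rewrite trP.
by apply: (inj); rewrite /= trP !fmapM !compA trP -(compA w (ep Y)) trP.
Qed.

Section GroupObjects.
Variables (C D : category) (cart : cartesian C) (M : groups_in C D).
Implicit Types (T S : C).

Local Notation U := (und M).
Local Notation "a ** b" := (gmul (ugrp M _) a b) (at level 40, left associativity).
Local Notation iv a := (ginv (ugrp M _) a).
Local Notation e_ := (gone (ugrp M _) _).
Local Notation "f $ a" := (umap M f \oc a) (at level 45, right associativity).

Lemma umap_one (H K : D) (f : hom H K) T : f $ (gone (ugrp M H) T) = e_.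
Proof. by apply: gmul_idem; rewrite -umap_mul gmul1l. Qed.

Lemma umap_inv (H K : D) (f : hom H K) T (a : hom T (U H)) :
  f $ (iv a) = iv (f $ a).
Proof. by apply: ginv_uniq; rewrite -umap_mul gmulVr umap_one. Qed.

Definition usimp := (umap_mul, umap_inv, umap_one).

Lemma umapA (H K : D) (f : hom H K) T S (a : hom T (U H)) (h : hom S T) :
  f $ (a \oc h) = (f $ a) \oc h.
Proof. exact: compA. Qed.

Lemma umap_compE (H K L : D) (f : hom K L) (g : hom H K) T (a : hom T (U H)) :
  (f \oc g) $ a = f $ (g $ a).
Proof. by rewrite umap_comp compA. Qed.

Lemma umap_idE (H : D) T (a : hom T (U H)) : (idc H) $ a = a.
Proof. by rewrite umap_id comp1f. Qed.

Lemma umap_ext (H K : D) (f g : hom H K) :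
  (forall T (a : hom T (U H)), f $ a = g $ a) -> f = g.
Proof. by move=> h; apply: (@umap_inj _ _ M); have := h _ (idc _); rewrite !compf1. Qed.

Lemma pairE T X Y (f f' : hom T (prd cart X Y)) :
  fst_ cart X Y \oc f = fst_ cart X Y \oc f' ->
  snd_ cart X Y \oc f = snd_ cart X Y \oc f' -> f = f'.
Proof. by move=> e1 e2; rewrite [f]pair_eta e1 e2 -pair_eta. Qed.

Lemma pair_nat T S X Y (f : hom T X) (g : hom T Y) (h : hom S T) :
  pair_ cart f g \oc h = pair_ cart (f \oc h) (g \oc h).
Proof. by apply: pairE; rewrite compA !(fst_pair, snd_pair). Qed.

(** * Subobjects cut out by equations between generalised elements *)

Section Families.
Variables (E Y W : C).

(** By Yoneda a natural family is a morphism E * Y -> W, kept in the form of an operation on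
    generalised elements. *)
Definition family := forall S, hom S E -> hom S Y -> hom S W.
Definition natural_family (a : family) := forall S S' (h : hom S' S) e y,
  a S e y \oc h = a S' (e \oc h) (y \oc h).

End Families.

Lemma exponential (Y W : C) : exists (X : C) (ev : family X Y W),
  natural_family ev /\ forall T (a : family T Y W), natural_family a ->
  exists! t : hom T X, forall S (h : hom S T) z, ev S (t \oc h) z = a S h z.
Proof.
(* With both maps the identity, the equation in [exp_eq] holds trivially and a plain exponential
   remains. *)
have [X [u [_ hu]]] := exp_eq cart Y (idc W) (idc W).
exists X, (fun S e z => u \oc pair_ cart e z); split=> [S S' h e y|T a na].
  by rewrite -compA pair_nat.
have [t [ht tu]] := hu T (a _ (fst_ cart T Y) (snd_ cart T Y)) erefl.
exists t; split=> [S h z|t' ht'].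
  have -> : pair_ cart (t \oc h) z =
      pair_ cart (t \oc fst_ cart T Y) (snd_ cart T Y) \oc pair_ cart h z.
    by rewrite pair_nat -compA !(fst_pair, snd_pair).
  by rewrite compA ht na !(fst_pair, snd_pair).
by apply: tu; rewrite ht'.
Qed.

Definition represents (E0 : C) (P : forall T, hom T E0 -> Prop) (E : C) (u : hom E E0) :=
  (forall T (h : hom T E), P T (u \oc h)) /\
  (forall T f, P T f -> exists! h : hom T E, u \oc h = f).

(** The equalizer of [al \oc u] and [be \oc u], read off [exp_eq] with exponent the terminal object;
    [sec] is the identification of [T] with its product by that object. *)
Lemma represents_cut E0 (P : forall T, hom T E0 -> Prop) W (al be : hom E0 W) :
  (exists E (u : hom E E0), represents P u) ->
  exists E (u : hom E E0), represents (fun T f => P T f /\ al \oc f = be \oc f) u.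
Proof.
move=> [E [u [hu eu]]].
have [E' [v [ev uv]]] := exp_eq cart (one cart) (al \oc u) (be \oc u).
pose sec T := pair_ cart (idc T) (bang cart T).
exists E', (u \oc (v \oc sec E')); split=> [T h|T f [Pf ef]].
  split; first by rewrite -!compA; apply: hu.
  by rewrite !compA ev.
have [h [hh uh]] := eu T f Pf.
have [|t [ht ut]] := uv T (h \oc fst_ cart T (one cart)).
  by rewrite !compA -(compA al) -(compA be) hh ef.
exists t; split=> [|t' ht'].
  rewrite -hh -!compA; congr (_ \oc _).
  have -> : sec E' \oc t = pair_ cart (t \oc fst_ _ _ _) (snd_ _ _ _) \oc sec T.
    rewrite !pair_nat -!compA fst_pair snd_pair comp1f compf1.
    by congr pair_; apply: bang_uniq.
  by rewrite compA ht -compA fst_pair compf1.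
apply: ut; apply/esym; rewrite (uh (v \oc (sec E' \oc t'))); last by rewrite !compA in ht' *.
rewrite -!compA; congr (_ \oc _); rewrite /sec pair_nat comp1f.
by congr pair_; apply: bang_uniq.
Qed.

(** An equation required at all stages [S -> T] and for all [z] is a single equation between the
    transposes of [a] and [b] to the exponential of [W] by [Y], hence an instance of
    [represents_cut]. *)
Lemma represents_cut_family E0 (P : forall T, hom T E0 -> Prop) Y W (a b : family E0 Y W) :
  natural_family a -> natural_family b ->
  (exists E (u : hom E E0), represents P u) ->
  exists E (u : hom E E0), represents (fun T f => P T f /\
    forall S (h : hom S T) z, a S (f \oc h) z = b S (f \oc h) z) u.
Proof.
move=> na nb; have [X [ev [nev hX]]] := exponential Y W.
have [al [hal _]] := hX _ a na; have [be [hbe _]] := hX _ b nb.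
move=> /(@represents_cut E0 P X al be) [E [u [hu eu]]].
have iff T (f : hom T E0) : (al \oc f = be \oc f) <->
    (forall S (h : hom S T) z, a S (f \oc h) z = b S (f \oc h) z).
  split=> [e S h z|e]; first by rewrite -hal -hbe !compA e.
  have nf : natural_family (fun S (h : hom S T) z => a S (f \oc h) z).
    by move=> S S' h x y; rewrite na compA.
  have [t [_ ut]] := hX T _ nf.
  rewrite -(ut (al \oc f)); last by move=> S h z; rewrite -compA hal.
  by apply: ut => S h z; rewrite -compA hbe e.
exists E, u; split=> [T h|T f [Pf ef]]; last by apply: eu; split=> //; apply/iff.
by have [Ph /iff] := hu T h.
Qed.

Lemma represents_all E0 : represents (fun T (f : hom T E0) => True) (idc E0).
Proof.
by split=> // T f _; exists f; split=> [|h]; rewrite comp1f.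
Qed.

(* By Yoneda, a group law on a representable subfunctor P of hom(-, E0) is
   carried by an object of D. *)
Lemma group_representable E0 (P : forall T, hom T E0 -> Prop)
    (mul : forall T, hom T E0 -> hom T E0 -> hom T E0)
    (oneE : forall T, hom T E0) (inv : forall T, hom T E0 -> hom T E0) :
  (exists E (u : hom E E0), represents P u) ->
  (forall T a b, P T a -> P T b -> P T (mul T a b)) ->
  (forall T, P T (oneE T)) ->
  (forall T a, P T a -> P T (inv T a)) ->
  (forall T a b c, P T a -> P T b -> P T c -> mul T a (mul T b c) = mul T (mul T a b) c) ->
  (forall T a, P T a -> mul T (oneE T) a = a) ->
  (forall T a, P T a -> mul T (inv T a) a = oneE T) ->
  (forall T S (h : hom S T) a b, P T a -> P T b ->
     mul T a b \oc h = mul S (a \oc h) (b \oc h)) ->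
  exists (H : D) (v : hom (U H) E0), represents P v /\
    forall T (a b : hom T (U H)), v \oc (a ** b) = mul T (v \oc a) (v \oc b).
Proof.
move=> [E [u [hu eu]]] mulP oneP invP mA m1 mV mN.
have exu T f : P T f -> exists h : hom T E, u \oc h = f.
  by move=> /eu [h [hh _]]; exists h.
pose rep T f (Pf : P T f) : hom T E := projT1 (cid (exu T f Pf)).
have repP T f (Pf : P T f) : u \oc rep T f Pf = f := projT2 (cid (exu T f Pf)).
have inj T (h h' : hom T E) : u \oc h = u \oc h' -> h = h'.
  by move=> e; have [w [_ uw]] := eu T _ (hu T h'); rewrite -(uw h) // -(uw h').
pose m T (a b : hom T E) := rep T _ (mulP T _ _ (hu T a) (hu T b)).
pose o T := rep T _ (oneP T); pose v T (a : hom T E) := rep T _ (invP T _ (hu T a)).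
have g1 T (a b c : hom T E) : m T a (m T b c) = m T (m T a b) c.
  by apply: inj; rewrite !repP mA.
have g2 T (a : hom T E) : m T (o T) a = a by apply: inj; rewrite !repP m1.
have g3 T (a : hom T E) : m T (v T a) a = o T by apply: inj; rewrite !repP mV.
have g4 T S (h : hom S T) (a b : hom T E) : m T a b \oc h = m S (a \oc h) (b \oc h).
  by apply: inj; rewrite compA !repP mN ?compA.
have [H [i [j [ji ij hi]]]] := uobj M (GroupOn g1 g2 g3 g4).
exists H, (u \oc i); split; first split=> [T h|T f Pf].
- by rewrite -compA; apply: hu.
- have [h [hh uh]] := eu T f Pf; exists (j \oc h); split=> [|h' hh'].
    by rewrite -compA (compA i) ij comp1f.
  by rewrite (uh (i \oc h')) ?compA // ji comp1f.
by move=> T a b; rewrite -!compA hi repP.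
Qed.

(** * Finite limits of group objects, tested on generalised elements *)

Lemma zero_object_ex : exists Z : zero_object D, forall T (a b : hom T (U Z)), a = b.
Proof.
have [|||||||| Z [v [[_ ev] _]]] := @group_representable (one cart) (fun _ _ => True)
  (fun T _ _ => bang cart T) (fun T => bang cart T) (fun T _ => bang cart T).
- by exists (one cart), (idc _); apply: represents_all.
- by [].
- by [].
- by [].
- by [].
- by move=> *; apply: bang_uniq.
- by move=> *; apply: bang_uniq.
- by move=> *; apply: bang_uniq.
have Z1 T (a b : hom T (U Z)) : a = b.
  have [w [_ uw]] := ev T (v \oc a) I.
  by rewrite -(uw a) // -(uw b) //; apply: bang_uniq.
have toZ (X : D) : exists f : hom X Z, True.
  by have [|f _] := @ulift _ _ M X Z e_; [move=> *; apply: Z1|exists f].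
have fromZ (X : D) : exists f : hom Z X, True.
  have [|f _] := @ulift _ _ M Z X e_; last by exists f.
  by move=> T a b; rewrite !gone_nat gmul1l.
unshelve eexists (@ZeroObject D Z (fun X => projT1 (cid (toZ X)))
  (fun X => projT1 (cid (fromZ X))) _ _) => //.
- by move=> X f g; apply: umap_ext => T a; apply: Z1.
- move=> X f g; apply: umap_ext => T a.
  by rewrite (Z1 T a e_) !umap_one.
Qed.

Lemma zero_point (Z : zero_object D) T (a b : hom T (U Z)) : a = b.
Proof.
have [Z0 Z1] := zero_object_ex.
have h (c : hom T (U Z)) : c = umap M (from_zero Z0 Z) \oc (umap M (to_zero Z0 Z) \oc c).
  rewrite -umap_compE (from_zero_uniq (from_zero Z0 Z \oc to_zero Z0 Z) (idc Z)).
  by rewrite umap_idE.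
by rewrite (h a) (h b); congr (_ \oc _); apply: Z1.
Qed.

Lemma umap_zero (Z : zero_object D) (X Y : D) T (a : hom T (U X)) :
  zero_mor Z X Y $ a = e_.
Proof. by rewrite umap_compE (zero_point (to_zero Z X $ a) e_) umap_one. Qed.

(** The universal property is required against every object of [C], not only those underlying an
    object of [D]; this is what computations with generalised elements use. *)
Definition pullback_points (X Y Z : D) (f : hom X Z) (g : hom Y Z) (P : D)
    (p : hom P X) (q : hom P Y) :=
  f \oc p = g \oc q /\
  forall T (a : hom T (U X)) (b : hom T (U Y)), f $ a = g $ b ->
    exists! h : hom T (U P), p $ h = a /\ q $ h = b.

Lemma pullback_points_ex (X Y Z : D) (f : hom X Z) (g : hom Y Z) :
  exists (P : D) (p : hom P X) (q : hom P Y), pullback_points f g p q.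
Proof.
pose F := fst_ cart (U X) (U Y); pose S := snd_ cart (U X) (U Y).
pose Q T (h : hom T (prd cart (U X) (U Y))) :=
  True /\ (umap M f \oc F) \oc h = (umap M g \oc S) \oc h.
pose mk T (a : hom T (U X)) (b : hom T (U Y)) : hom T (prd cart (U X) (U Y)) := pair_ cart a b.
have QE T h : Q T h <-> f $ (F \oc h) = g $ (S \oc h) by rewrite /Q !compA; split=> [[]|].
have Fm T a b : F \oc mk T a b = a := fst_pair _ _ _.
have Sm T a b : S \oc mk T a b = b := snd_pair _ _ _.
have [|||||||| P [v [[hv ev] vM]]] := @group_representable _ Q
  (fun T a b => mk T ((F \oc a) ** (F \oc b)) ((S \oc a) ** (S \oc b)))
  (fun T => mk T e_ e_) (fun T a => mk T (iv (F \oc a)) (iv (S \oc a))).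
- by apply: represents_cut; exists (prd cart (U X) (U Y)), (idc _); apply: represents_all.
- by move=> T a b /QE ea /QE eb; apply/QE; rewrite Fm Sm !usimp ea eb.
- by move=> T; apply/QE; rewrite Fm Sm !usimp.
- by move=> T a /QE ea; apply/QE; rewrite Fm Sm !usimp ea.
- by move=> T a b c _ _ _; rewrite !Fm !Sm !gmulA.
- by move=> T a _; rewrite !Fm !Sm !gmul1l; apply/esym/pair_eta.
- by move=> T a _; rewrite !Fm !Sm !gmulVl.
- by move=> T R h a b _ _; rewrite pair_nat !gmul_nat !compA.
have [|p hp] := @ulift _ _ M P X (F \oc v).
  by move=> T a b; rewrite -!compA vM Fm.
have [|q hq] := @ulift _ _ M P Y (S \oc v).
  by move=> T a b; rewrite -!compA vM Sm.
exists P, p, q; split.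
  apply: umap_ext => T a; rewrite !umap_compE hp hq -!compA; apply/QE/hv.
move=> T a b e; have [|h [hh uh]] := ev T (mk T a b).
  by apply/QE; rewrite Fm Sm.
exists h; split=> [|h' [ea eb]]; first by rewrite hp hq -!compA hh Fm Sm.
by apply: uh; rewrite -ea -eb hp hq -!compA; apply/pair_eta.
Qed.

Lemma pullback_points_pullback (X Y Z : D) (f : hom X Z) (g : hom Y Z) P p q :
  @pullback_points X Y Z f g P p q ->
  forall (T : D) (a : hom T X) (b : hom T Y), f \oc a = g \oc b ->
    exists! u : hom T P, p \oc u = a /\ q \oc u = b.
Proof.
move=> [pq hP] T a b e.
have inj S (h h' : hom S (U P)) : p $ h = p $ h' -> q $ h = q $ h' -> h = h'.
  move=> e1 e2; have [|w [_ uw]] := hP S (p $ h') (q $ h').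
    by rewrite -!umap_compE pq.
  by rewrite -(uw h) // -(uw h').
have [|h [[h1 h2] _]] := hP (U T) (umap M a) (umap M b); first by rewrite -!umap_comp e.
have [|u hu] := @ulift _ _ M T P h.
  by move=> S c d; apply: inj; rewrite !usimp !compA ?h1 ?h2 !usimp.
have e1 : p \oc u = a by apply: (@umap_inj _ _ M); rewrite umap_comp hu h1.
have e2 : q \oc u = b by apply: (@umap_inj _ _ M); rewrite umap_comp hu h2.
exists u; split=> // u' [e1' e2']; apply: umap_ext => S c; apply: inj.
  by rewrite -!umap_compE e1 e1'.
by rewrite -!umap_compE e2 e2'.
Qed.

Lemma finitely_complete_groups : finitely_complete D.
Proof.
split=> [|X Y Z f g].
  have [Z _] := zero_object_ex; exists Z => X; exists (to_zero Z X).
  by split=> // f _; apply: to_zero_uniq.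
have [P [p [q h]]] := pullback_points_ex f g.
by constructor; exact: (Pullback (proj1 h) (pullback_points_pullback h)).
Qed.

(** An arbitrary pullback in [D] is compared with the one constructed from points, and the universal
    property against objects of [C] is transported along [r] and [s]. *)
Lemma pullback_pointsP (X Y Z : D) (f : hom X Z) (g : hom Y Z) (P : pullback f g) :
  pullback_points f g (pb1 P) (pb2 P).
Proof.
have [Q [p [q hQ]]] := pullback_points_ex f g; split; first exact: pb_sq.
have [eQ uQ] := hQ.
have [s [[s1 s2] _]] := pullback_points_pullback hQ (pb_sq P).
pose r := pb_pair P eQ.
have rs : r \oc s = idc P.
  by apply: pb_ext; rewrite compA /r !(pb_pair1, pb_pair2) compf1.
move=> T a b e; have [h [[h1 h2] uh]] := uQ T a b e.
exists (r $ h); split=> [|h' [e1 e2]].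
  by rewrite -!umap_compE /r !(pb_pair1, pb_pair2).
by rewrite (uh (s $ h')) -?umap_compE ?s1 ?s2 // rs umap_idE.
Qed.

Lemma pullback_points_inj (X Y Z : D) (f : hom X Z) (g : hom Y Z) P p q :
  @pullback_points X Y Z f g P p q ->
  forall T (h h' : hom T (U P)), p $ h = p $ h' -> q $ h = q $ h' -> h = h'.
Proof.
move=> [pq hP] T h h' e1 e2; have [|w [_ uw]] := hP T (p $ h') (q $ h').
  by rewrite -!umap_compE pq.
by rewrite -(uw h) // -(uw h').
Qed.

(** A kernel is the pullback along the map from the zero object, so its universal property extends
    to points from [C] by the same comparison. *)
Lemma kernel_points (Z : zero_object D) (X A B : D) (m : hom X A) (p : hom A B) :
  is_kernel Z m p -> (forall T (a : hom T (U X)), p $ (m $ a) = e_) /\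
  forall T (a : hom T (U A)), p $ a = e_ -> exists! h : hom T (U X), m $ h = a.
Proof.
move=> [pm hm]; split=> [T a|T a pa].
  by rewrite -umap_compE pm umap_zero.
have [K [q [z hK]]] := pullback_points_ex p (from_zero Z B); have [eK uK] := hK.
have [|r [hr _]] := hm K q.
  by rewrite eK; congr (_ \oc _); apply: to_zero_uniq.
have [s [[qs _] _]] := pullback_points_pullback hK (pm : p \oc m = from_zero Z B \oc to_zero Z X).
have rs : r \oc s = idc X.
  have [w [_ uw]] := hm X m pm.
  by rewrite -(uw (r \oc s)) ?compA ?hr // -(uw (idc X)) ?compf1.
have [|h [[h1 _] _]] := uK T a e_; first by rewrite pa umap_one.
exists (r $ h); split=> [|h' e]; first by rewrite -umap_compE hr.
have -> : h = s $ h'.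
  apply: (pullback_points_inj hK); last exact: zero_point.
  by rewrite h1 -umap_compE qs.
by rewrite -umap_compE rs umap_idE.
Qed.

(* The T-points of R are the pairs (y, u), with y a T-point of Y and u a family
   of maps Y -> ker q satisfying u(f(x) z) = s(x) u(z) s(x)^-1; the product is
   (y, u)(y', u') = (y y', z |-> u(z) u'(z y)).  Below, ap r z stands for u(z). *)
Lemma coinduced_points (X Y Q : D) (f : hom X Y) (q : hom Q X) (s : hom X Q) :
  exists (R : D) (pr : hom R Y) (ap : family (U R) (U Y) (U Q)),
  [/\ natural_family ap,
    forall T r z, q $ ap T r z = e_,
    forall T r x z, ap T r ((f $ x) ** z) = (s $ x) ** ap T r z ** iv (s $ x),
    forall T r r' z, ap T (r ** r') z = ap T r z ** ap T r' (z ** (pr $ r)) &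
    (forall T (r r' : hom T (U R)), pr $ r = pr $ r' ->
       (forall S (h : hom S T) z, ap S (r \oc h) z = ap S (r' \oc h) z) -> r = r') /\
    forall T y (a : family T (U Y) (U Q)), natural_family a ->
      (forall S h z, q $ a S h z = e_) ->
      (forall S h x z, a S h ((f $ x) ** z) = (s $ x) ** a S h z ** iv (s $ x)) ->
      exists r : hom T (U R), pr $ r = y /\ forall S h z, ap S (r \oc h) z = a S h z].
Proof.
have [Ex [ev [nev hE]]] := exponential (U Y) (U Q).
(* Families take their values in all of [Q] at this stage; the equation in [P1] later confines them
   to the kernel of [q]. *)
pose E0 := prd cart (U Y) Ex; pose F := fst_ cart (U Y) Ex; pose V := snd_ cart (U Y) Ex.
pose app : family E0 (U Y) (U Q) := fun T e z => ev T (V \oc e) z.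
have napp : natural_family app by move=> S S' h e z; rewrite /app nev compA.
have mkE T y (a : family T (U Y) (U Q)) : natural_family a ->
    exists e : hom T E0, F \oc e = y /\ forall S h z, app S (e \oc h) z = a S h z.
  move=> /hE [t [ht _]]; exists (pair_ cart y t); rewrite fst_pair; split=> // S h z.
  by rewrite /app compA snd_pair.
have ext T (e e' : hom T E0) : F \oc e = F \oc e' ->
    (forall S (h : hom S T) z, app S (e \oc h) z = app S (e' \oc h) z) -> e = e'.
  move=> e1 e2; apply: pairE => //.
  have na : natural_family (fun S (h : hom S T) z => app S (e \oc h) z).
    by move=> S S' h g z; rewrite napp compA.
  have [w [_ uw]] := hE T _ na.
  rewrite -(uw (snd_ cart _ _ \oc e)); last by move=> S h z; rewrite -compA.
  by apply: uw => S h z; rewrite -compA e2.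
have mul_ex T (e e' : hom T E0) : exists e'' : hom T E0,
    F \oc e'' = (F \oc e) ** (F \oc e') /\ forall S h z, app S (e'' \oc h) z =
      app S (e \oc h) z ** app S (e' \oc h) (z ** (F \oc e \oc h)).
  by apply: mkE => S S' h g z; rewrite gmul_nat !napp gmul_nat !compA.
have one_ex T : exists e'' : hom T E0,
    F \oc e'' = e_ /\ forall S h z, app S (e'' \oc h) z = e_.
  by apply: mkE => S S' h g z; rewrite gone_nat.
have inv_ex T (e : hom T E0) : exists e'' : hom T E0,
    F \oc e'' = iv (F \oc e) /\ forall S h z, app S (e'' \oc h) z =
      iv (app S (e \oc h) (z ** iv (F \oc e \oc h))).
  by apply: mkE => S S' h g z; rewrite ginv_nat !napp gmul_nat ginv_nat !compA.
pose mul T e e' := projT1 (cid (mul_ex T e e')).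
have mulF T e e' : F \oc mul T e e' = (F \oc e) ** (F \oc e').
  by have [] := projT2 (cid (mul_ex T e e')).
have mulA T e e' S (h : hom S T) z : app S (mul T e e' \oc h) z =
    app S (e \oc h) z ** app S (e' \oc h) (z ** (F \oc e \oc h)).
  by have [_ ->] := projT2 (cid (mul_ex T e e')).
pose oneE T := projT1 (cid (one_ex T)).
have oneF T : F \oc oneE T = e_ by have [] := projT2 (cid (one_ex T)).
have oneA T S (h : hom S T) z : app S (oneE T \oc h) z = e_.
  by have [_ ->] := projT2 (cid (one_ex T)).
pose inv T e := projT1 (cid (inv_ex T e)).
have invF T e : F \oc inv T e = iv (F \oc e) by have [] := projT2 (cid (inv_ex T e)).
have invA T e S (h : hom S T) z : app S (inv T e \oc h) z =
    iv (app S (e \oc h) (z ** iv (F \oc e \oc h))).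
  by have [_ ->] := projT2 (cid (inv_ex T e)).
(* [represents_cut_family] quantifies over one point only, so the pair (x, z) of the equivariance
   condition is encoded as a single point [w] of the product of [X] and [Y]. *)
pose FX := fst_ cart (U X) (U Y); pose SX := snd_ cart (U X) (U Y).
pose P1 T (e : hom T E0) := True /\ forall S (h : hom S T) z, q $ app S (e \oc h) z = e_.
pose P T (e : hom T E0) := P1 T e /\ forall S (h : hom S T) (w : hom S (prd cart (U X) (U Y))),
  app S (e \oc h) ((f $ (FX \oc w)) ** (SX \oc w)) =
  (s $ (FX \oc w)) ** app S (e \oc h) (SX \oc w) ** iv (s $ (FX \oc w)).
have PE T e : P T e <-> (forall S (h : hom S T) z, q $ app S (e \oc h) z = e_) /\
  forall S (h : hom S T) x z, app S (e \oc h) ((f $ x) ** z) =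
    (s $ x) ** app S (e \oc h) z ** iv (s $ x).
  split=> [[[_ h1] h2]|[h1 h2]].
    split=> // S h x z; have := h2 S h (pair_ cart x z).
    by rewrite /FX /SX fst_pair snd_pair.
  by split=> // S h w; apply: h2.
have [|||||||| R [v [[hv ev'] vM]]] := @group_representable E0 P mul oneE inv.
- apply: (@represents_cut_family E0 P1 (prd cart (U X) (U Y)) (U Q)
    (fun S e w => app S e ((f $ (FX \oc w)) ** (SX \oc w)))
    (fun S e w => (s $ (FX \oc w)) ** app S e (SX \oc w) ** iv (s $ (FX \oc w)))).
  + by move=> S S' h e w; rewrite napp gmul_nat -!compA.
  + by move=> S S' h e w; rewrite !gmul_nat ginv_nat napp -!compA.
  apply: (@represents_cut_family E0 (fun _ _ => True) (U Y) (U X)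
    (fun S e z => q $ app S e z) (fun S e z => e_)).
  + by move=> S S' h e w; rewrite -compA napp.
  + by move=> S S' h e w; rewrite gone_nat.
  by exists E0, (idc _); apply: represents_all.
- move=> T a b /PE [a1 a2] /PE [b1 b2]; apply/PE; split=> S h *.
    by rewrite mulA umap_mul a1 b1 gmul1l.
  by rewrite !mulA a2 -[(f $ _) ** _ ** _]gmulA b2 !gsimp.
- by move=> T; apply/PE; split=> S h *; rewrite !oneA ?umap_one // !gsimp.
- move=> T a /PE [a1 a2]; apply/PE; split=> S h *.
    by rewrite invA umap_inv a1 ginv1.
  by rewrite !invA -[(f $ _) ** _ ** _]gmulA a2 !gsimp.
- move=> T a b c _ _ _; apply: ext => [|S h z]; first by rewrite !mulF gmulA.
  by rewrite !mulA mulF gmul_nat !gmulA.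
- move=> T a _; apply: ext => [|S h z]; first by rewrite mulF oneF gmul1l.
  by rewrite mulA oneA oneF gone_nat gmul1l gmul1r.
- move=> T a _; apply: ext => [|S h z]; first by rewrite mulF invF oneF gmulVl.
  by rewrite mulA invA invF ginv_nat gmulVl oneA.
- move=> T S h a b _ _; apply: ext => [|S' h' z].
    by rewrite mulF !compA mulF gmul_nat.
  by rewrite -compA !mulA -!compA.
have injv T (r r' : hom T (U R)) : v \oc r = v \oc r' -> r = r'.
  by move=> e; have [w [_ uw]] := ev' T _ (hv T r'); rewrite -(uw r) // -(uw r').
have [|pr hpr] := @ulift _ _ M R Y (F \oc v).
  by move=> T a b; rewrite -!compA vM mulF.
exists R, pr, (fun T r z => app T (v \oc r) z); split.
- by move=> S S' h r z; rewrite napp compA.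
- by move=> T r z; have /PE [h _] := hv T r; have := h _ (idc T) z; rewrite compf1.
- by move=> T r x z; have /PE [_ h] := hv T r; have := h _ (idc T) x z; rewrite compf1.
- by move=> T r r' z; have := mulA T (v \oc r) (v \oc r') T (idc T) z;
    rewrite vM !compf1 hpr compA.
split=> [T r r' e1 e2|T y a na a1 a2].
  apply: injv; apply: ext => [|S h z]; first by rewrite !compA -hpr.
  by have := e2 S h z; rewrite !compA.
have [e [e1 e2]] := mkE T y a na.
have [|r [hr _]] := ev' T e; first by apply/PE; split=> *; rewrite !e2.
by exists r; rewrite hpr -compA hr; split=> // S h z; rewrite compA hr.
Qed.

Theorem lacc_groups : locally_algebraically_cartesian_closed D.
Proof.
split=> [|pb X Y f]; first exact: finitely_complete_groups.
apply: left_adjoint_of_universal => Q.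
have [R0 [pr [ap [nap qap eqv apM [ext mk]]]]] :=
  coinduced_points f (pt_proj Q) (pt_sec Q).
pose q := pt_proj Q; pose s := pt_sec Q.
have qs T (x : hom T (U X)) : q $ (s $ x) = x.
  by rewrite -umap_compE /q /s pt_split umap_idE.
(* the section of R is y |-> (y, 1), with 1 the trivial family *)
have [r0 [r0p r0a]] : exists r : hom (U Y) (U R0), pr $ r = idc _ /\
    forall S (h : hom S (U Y)) z, ap S (r \oc h) z = e_.
  apply: (mk _ _ (fun S h z => e_)) => [S S' h e y|S h z|S h x z].
  - by rewrite gone_nat.
  - by rewrite umap_one.
  - by rewrite !gsimp.
have [|sR hsR] := @ulift _ _ M Y R0 r0.
  move=> T a b; apply: ext => [|S h z]; first by rewrite umap_mul !compA r0p !comp1f.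
  by rewrite gmul_nat apM -!compA !r0a gmul1l.
have prs T (y : hom T (U Y)) : pr $ (sR $ y) = y by rewrite hsR compA r0p comp1f.
have aps T (y : hom T (U Y)) z : ap T (sR $ y) z = e_ by rewrite hsR r0a.
have split_pr : pr \oc sR = idc Y.
  by apply: umap_ext => T a; rewrite umap_compE prs umap_idE.
pose R := Point split_pr.
have ppE (P : point Y) := pullback_pointsP (pb _ _ _ f (pt_proj P)).
pose p1 (P : point Y) := pb1 (pb _ _ _ f (pt_proj P)).
pose p2 (P : point Y) := pb2 (pb _ _ _ f (pt_proj P)).
have ppinj (P : point Y) T (h h' : hom T (U (bc_obj pb f P))) :
    p1 P $ h = p1 P $ h' -> p2 P $ h = p2 P $ h' -> h = h'.
  exact: (pullback_points_inj (ppE P)).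
have ppex (P : point Y) T (x : hom T (U X)) (b : hom T (U P)) :
    f $ x = pt_proj P $ b -> exists h : hom T (U (bc_obj pb f P)),
    p1 P $ h = x /\ p2 P $ h = b.
  by move=> e; have [h [hh _]] := proj2 (ppE P) T x b e; exists h.
have ppsq (P : point Y) T (h : hom T (U (bc_obj pb f P))) :
    f $ (p1 P $ h) = pt_proj P $ (p2 P $ h).
  by rewrite -!umap_compE /p1 /p2 pb_sq.
have p1s (P : point Y) T (x : hom T (U X)) : p1 P $ (pt_sec (bc_obj pb f P) $ x) = x.
  have e : p1 P \oc pt_sec (bc_obj pb f P) = idc X := pb_pair1 _ _.
  by rewrite -umap_compE e umap_idE.
have p2s (P : point Y) T (x : hom T (U X)) :
    p2 P $ (pt_sec (bc_obj pb f P) $ x) = pt_sec P $ (f $ x).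
  have e : p2 P \oc pt_sec (bc_obj pb f P) = pt_sec P \oc f := pb_pair2 _ _.
  by rewrite -[RHS]umap_compE -e umap_compE.
(* the counit f^* R -> Q is (x, (y, u)) |-> u(1) s(x) *)
have apR T (r r' : hom T (U (bc_obj pb f R))) :
    ap T (p2 R $ (r ** r')) e_ ** (s $ (p1 R $ (r ** r'))) =
    ap T (p2 R $ r) e_ ** (s $ (p1 R $ r)) ** (ap T (p2 R $ r') e_ ** (s $ (p1 R $ r'))).
  (* Writing (x, (y, u)) for [r] and u' for the family of [r']: in the pullback y = f(x), so
     equivariance turns the factor u'(y) of the product into s(x) u'(1) s(x)^-1. *)
  have e : pr $ (p2 R $ r) = f $ (p1 R $ r) by rewrite ppsq.
  by rewrite !umap_mul apM e gmul1l -[f $ (p1 R $ r)](gmul1r (ugrp M Y)) eqv !gsimp.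
have [|ep0 hep] := @ulift _ _ M (bc_obj pb f R) Q
    (ap _ (p2 R $ idc _) e_ ** (s $ (p1 R $ idc _))).
  move=> T a b; rewrite !gmul_nat !nap !gone_nat -!compA !comp1f.
  exact: apR.
have epE T (r : hom T (U (bc_obj pb f R))) :
    ep0 $ r = ap T (p2 R $ r) e_ ** (s $ (p1 R $ r)).
  by rewrite hep gmul_nat nap gone_nat -!compA !comp1f.
have ep_proj : q \oc ep0 = pt_proj (bc_obj pb f R).
  by apply: umap_ext => T r; rewrite umap_compE epE umap_mul qap qs gmul1l.
have ep_sec : ep0 \oc pt_sec (bc_obj pb f R) = s.
  by apply: umap_ext => T x; rewrite umap_compE epE p1s p2s aps gmul1l.
pose ep : pt_hom (bc_obj pb f R) Q := PtHom ep_proj ep_sec.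
exists R, ep => P al.
pose p := pt_proj P; pose t := pt_sec P.
have pt_ T (y : hom T (U Y)) : p $ (t $ y) = y.
  by rewrite -umap_compE /p /t pt_split umap_idE.
have alp T (h : hom T (U (bc_obj pb f P))) : q $ (pth al $ h) = p1 P $ h.
  by rewrite -umap_compE /q pth_proj.
have als T (x : hom T (U X)) : pth al $ (pt_sec (bc_obj pb f P) $ x) = s $ x.
  by rewrite -umap_compE pth_sec.
(* a t(p a)^-1 is the kernel part of [a]. Conjugating it by t(z) stays in the kernel of [p], so the
   result lifts to the pullback over the unit of [X]. *)
pose conj T (z : hom T (U Y)) (a : hom T (U P)) := (t $ z) ** a ** iv (t $ (p $ a)) ** iv (t $ z).
have conjp T z (a : hom T (U P)) : p $ conj T z a = e_.
  by rewrite /conj !usimp !pt_ !gsimp.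
have conj_nat T S (h : hom S T) z (a : hom T (U P)) :
    conj T z a \oc h = conj S (z \oc h) (a \oc h).
  by rewrite /conj !(gmul_nat, ginv_nat) -!compA.
have kex T (z : hom T (U Y)) (a : hom T (U P)) :
    exists h : hom T (U (bc_obj pb f P)), p1 P $ h = e_ /\ p2 P $ h = conj T z a.
  by apply: ppex; rewrite umap_one conjp.
pose kp T z a := projT1 (cid (kex T z a)).
have kp1 T z a : p1 P $ kp T z a = e_ by have [] := projT2 (cid (kex T z a)).
have kp2 T z a : p2 P $ kp T z a = conj T z a by have [] := projT2 (cid (kex T z a)).
have kp_nat T S (h : hom S T) z a : kp T z a \oc h = kp S (z \oc h) (a \oc h).
  by apply: ppinj; rewrite compA ?kp1 ?kp2 ?gone_nat ?conj_nat.
(* the transpose of al sends a to the family z |-> al(1, s(z) a s(p a)^-1 s(z)^-1) *)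
have [b0 [b0p b0a]] : exists b : hom (U P) (U R0), pr $ b = umap M p /\
    forall S (h : hom S (U P)) z, ap S (b \oc h) z = pth al $ kp S z h.
  apply: (mk _ _ (fun S h z => pth al $ kp S z h)) => [S S' h a z|S h z|S h x z].
  - by rewrite -compA kp_nat.
  - by rewrite alp kp1.
  rewrite -als -umap_inv -!umap_mul; congr (_ \oc _); apply: ppinj.
    by rewrite !usimp p1s !kp1 !gsimp.
  by rewrite !usimp p2s !kp2 /conj !usimp !gsimp.
have [|b1 hb1] := @ulift _ _ M P R0 b0.
  move=> T a a'; apply: ext => [|S h z].
    by rewrite umap_mul !compA b0p umap_mul.
  rewrite gmul_nat apM -!compA !b0a -umap_mul; congr (_ \oc _); apply: ppinj.
    by rewrite umap_mul !kp1 gmul1l.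
  by rewrite umap_mul !kp2 (compA (umap M pr)) b0p gmul_nat /conj !usimp !gsimp.
have b1a T (a : hom T (U P)) z : ap T (b1 $ a) z = pth al $ kp T z a.
  by rewrite hb1 b0a.
have b1_proj : pr \oc b1 = p.
  by apply: umap_ext => T a; rewrite umap_compE hb1 compA b0p.
have b1_sec : b1 \oc t = sR.
  apply: umap_ext => T y; apply: ext => [|S h z].
    by rewrite prs -umap_compE compA b1_proj umap_compE pt_.
  rewrite umap_compE -!umapA b1a aps -(umap_one (pth al)); congr (_ \oc _).
  by apply: ppinj; rewrite ?kp1 ?kp2 /conj !umap_one // pt_ !gsimp.
pose b : pt_hom P R := @PtHom D Y P R b1 b1_proj b1_sec.
have bcE (c : pt_hom P R) T (h : hom T (U (bc_obj pb f P))) :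
    (ep0 \oc pth (bc_map pb f c)) $ h = ap T (pth c $ (p2 P $ h)) e_ ** (s $ (p1 P $ h)).
  have e2 : p2 R \oc pth (bc_map pb f c) = pth c \oc p2 P := pb_pair2 _ _.
  have e1 : p1 R \oc pth (bc_map pb f c) = p1 P := pb_pair1 _ _.
  have h2 : p2 R $ (pth (bc_map pb f c) $ h) = pth c $ (p2 P $ h).
    by rewrite -(umap_compE (p2 R)) e2 umap_compE.
  have h1 : p1 R $ (pth (bc_map pb f c) $ h) = p1 P $ h.
    by rewrite -(umap_compE (p1 R)) e1.
  by rewrite umap_compE epE h1 h2.
exists b; split=> [|c hc].
  apply: pt_hom_eq; apply: umap_ext => T h; rewrite [LHS]bcE b1a.
  rewrite -als -umap_mul; congr (_ \oc _); apply: ppinj.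
    by rewrite umap_mul kp1 p1s gmul1l.
  by rewrite umap_mul kp2 p2s ppsq /conj umap_one !gsimp.
(* Any [c] with transpose [al] agrees with [b]: the value of [al] on the lift of [conj z a] is the
   value at 1 of the family of c(conj z a). Since [c] carries [t] to [sR], whose families are
   trivial, the product rule leaves the family of c(a) evaluated at z. *)
apply: pt_hom_eq; apply: umap_ext => T a; apply: ext => [|S h z].
  by rewrite -!umap_compE (pth_proj b) (pth_proj c).
rewrite -!umapA b1a.
have -> : pth al = ep0 \oc pth (bc_map pb f c) by rewrite -hc.
rewrite bcE kp1 kp2 umap_one gmul1r /conj !usimp.
have cs y : pth c $ (t $ y) = sR $ y by rewrite -umap_compE (pth_sec c).
rewrite !cs !apM aps !gsimp -!umap_inv !aps !prs !gsimp.
by [].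
Qed.

(** * The automorphism group and the classification of split extensions *)

Section Automorphisms.
Variable X : D.

(* Points of A are kept together with their inverses: A is cut out of
   X^X * X^X by equations, so that only equalizers are needed. *)
Lemma automorphisms_ex :
  exists (A : D) (ac : family (U A) (U X) (U X)),
  [/\ natural_family ac,
    forall T a x y, ac T a (x ** y) = ac T a x ** ac T a y,
    forall T a b x, ac T (a ** b) x = ac T a (ac T b x) /\ ac T e_ x = x,
    forall T (a b : hom T (U A)),
      (forall S (h : hom S T) x, ac S (a \oc h) x = ac S (b \oc h) x) -> a = b &
    forall T (f g : family T (U X) (U X)), natural_family f -> natural_family g ->
      (forall S h x, f S h (g S h x) = x) -> (forall S h x, g S h (f S h x) = x) ->
      (forall S h x y, f S h (x ** y) = f S h x ** f S h y) ->
      exists a : hom T (U A), forall S (h : hom S T) x, ac S (a \oc h) x = f S h x].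
Proof.
have [Ex [ev [nev hE]]] := exponential (U X) (U X).
pose E0 := prd cart Ex Ex; pose F := fst_ cart Ex Ex; pose V := snd_ cart Ex Ex.
pose fw : family E0 (U X) (U X) := fun T e x => ev T (F \oc e) x.
pose bw : family E0 (U X) (U X) := fun T e x => ev T (V \oc e) x.
have nfw : natural_family fw by move=> S S' h e z; rewrite /fw nev compA.
have nbw : natural_family bw by move=> S S' h e z; rewrite /bw nev compA.
have mkE T (f g : family T (U X) (U X)) : natural_family f -> natural_family g ->
    exists e : hom T E0, forall S h x,
      fw S (e \oc h) x = f S h x /\ bw S (e \oc h) x = g S h x.
  move=> /hE [t [ht _]] /hE [t' [ht' _]]; exists (pair_ cart t t') => S h x.
  by rewrite /fw /bw !compA fst_pair snd_pair.
have ext T (e e' : hom T E0) :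
    (forall S (h : hom S T) x, fw S (e \oc h) x = fw S (e' \oc h) x) ->
    (forall S (h : hom S T) x, bw S (e \oc h) x = bw S (e' \oc h) x) -> e = e'.
  have exE (t t' : hom T Ex) :
      (forall S (h : hom S T) x, ev S (t \oc h) x = ev S (t' \oc h) x) -> t = t'.
    move=> e1; have na : natural_family (fun S (h : hom S T) z => ev S (t \oc h) z).
      by move=> S S' h g z; rewrite nev compA.
    have [w [_ uw]] := hE T _ na.
    by rewrite -(uw t) //; apply: uw => S h z; rewrite e1.
  move=> e1 e2; apply: pairE; apply: exE => S h x; rewrite -!compA.
    exact: e1.
  exact: e2.
have mul_ex T (e e' : hom T E0) : exists e'' : hom T E0, forall S h x,
    fw S (e'' \oc h) x = fw S (e \oc h) (fw S (e' \oc h) x) /\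
    bw S (e'' \oc h) x = bw S (e' \oc h) (bw S (e \oc h) x).
  by apply: mkE => S S' h g z; rewrite ?nfw ?nbw !compA.
have one_ex T : exists e'' : hom T E0, forall S h x,
    fw S (e'' \oc h) x = x /\ bw S (e'' \oc h) x = x.
  by apply: mkE => S S' h g z.
have inv_ex T (e : hom T E0) : exists e'' : hom T E0, forall S h x,
    fw S (e'' \oc h) x = bw S (e \oc h) x /\ bw S (e'' \oc h) x = fw S (e \oc h) x.
  by apply: mkE => S S' h g z; rewrite ?nfw ?nbw !compA.
pose mul T e e' := projT1 (cid (mul_ex T e e')).
have mulP T e e' S (h : hom S T) x :
    fw S (mul T e e' \oc h) x = fw S (e \oc h) (fw S (e' \oc h) x) /\
    bw S (mul T e e' \oc h) x = bw S (e' \oc h) (bw S (e \oc h) x).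
  exact: (projT2 (cid (mul_ex T e e')) S h x).
pose oneE T := projT1 (cid (one_ex T)).
have oneP T S (h : hom S T) x := projT2 (cid (one_ex T)) S h x.
pose inv T e := projT1 (cid (inv_ex T e)).
have invP T e S (h : hom S T) x := projT2 (cid (inv_ex T e)) S h x.
pose FX := fst_ cart (U X) (U X); pose SX := snd_ cart (U X) (U X).
pose P1 T (e : hom T E0) := True /\
  forall S (h : hom S T) x, fw S (e \oc h) (bw S (e \oc h) x) = x.
pose P2 T (e : hom T E0) := P1 T e /\
  forall S (h : hom S T) x, bw S (e \oc h) (fw S (e \oc h) x) = x.
pose P T (e : hom T E0) := P2 T e /\ forall S (h : hom S T) (w : hom S (prd cart (U X) (U X))),
  fw S (e \oc h) ((FX \oc w) ** (SX \oc w)) =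
  fw S (e \oc h) (FX \oc w) ** fw S (e \oc h) (SX \oc w).
have PE T e : P T e <-> [/\ forall S (h : hom S T) x, fw S (e \oc h) (bw S (e \oc h) x) = x,
    forall S (h : hom S T) x, bw S (e \oc h) (fw S (e \oc h) x) = x &
    forall S (h : hom S T) x y, fw S (e \oc h) (x ** y) =
      fw S (e \oc h) x ** fw S (e \oc h) y].
  split=> [[[[_ h1] h2] h3]|[h1 h2 h3]].
    split=> // S h x y; have := h3 S h (pair_ cart x y).
    by rewrite /FX /SX fst_pair snd_pair.
  by split=> // S h w; apply: h3.
have [|||||||| A [v [[hv ev'] vM]]] := @group_representable E0 P mul oneE inv.
- apply: (@represents_cut_family E0 P2 (prd cart (U X) (U X)) (U X)
    (fun S e w => fw S e ((FX \oc w) ** (SX \oc w)))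
    (fun S e w => fw S e (FX \oc w) ** fw S e (SX \oc w))).
  + by move=> S S' h e w; rewrite nfw gmul_nat -!compA.
  + by move=> S S' h e w; rewrite gmul_nat !nfw -!compA.
  apply: (@represents_cut_family E0 P1 (U X) (U X)
    (fun S e x => bw S e (fw S e x)) (fun S e x => x)) => //.
    by move=> S S' h e w; rewrite nbw nfw.
  apply: (@represents_cut_family E0 (fun _ _ => True) (U X) (U X)
    (fun S e x => fw S e (bw S e x)) (fun S e x => x)) => //.
    by move=> S S' h e w; rewrite nfw nbw.
  by exists E0, (idc _); apply: represents_all.
- move=> T a b /PE [a1 a2 a3] /PE [b1 b2 b3]; apply/PE; split=> S h *.
  + by rewrite !(mulP T a b S h _).1 (mulP T a b S h _).2 b1 a1.
  + by rewrite !(mulP T a b S h _).2 (mulP T a b S h _).1 a2 b2.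
  + by rewrite !(mulP T a b S h _).1 b3 a3.
- by move=> T; apply/PE; split=> S h *; rewrite ?(oneP T S h _).1 ?(oneP T S h _).2.
- move=> T a /PE [a1 a2 a3]; apply/PE; split=> S h *.
  + by rewrite (invP T a S h _).1 (invP T a S h _).2 a2.
  + by rewrite (invP T a S h _).1 (invP T a S h _).2 a1.
  rewrite !(invP T a S h _).1.
  by rewrite -{1}[x in x ** _](a1 S h) -{1}[x in _ ** x](a1 S h) -a3 a2.
- move=> T a b c _ _ _; apply: ext => S h x.
    by rewrite !(mulP T _ _ S h _).1.
  by rewrite !(mulP T _ _ S h _).2.
- move=> T a _; apply: ext => S h x.
    by rewrite (mulP T _ _ S h _).1 (oneP T S h _).1.
  by rewrite (mulP T _ _ S h _).2 (oneP T S h _).2.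
- move=> T a /PE [a1 a2 _]; apply: ext => S h x.
    by rewrite (mulP T _ _ S h _).1 (invP T a S h _).1 (oneP T S h _).1 a2.
  by rewrite (mulP T _ _ S h _).2 (invP T a S h _).2 (oneP T S h _).2 a2.
- move=> T S h a b _ _; apply: ext => S' h' x.
    by rewrite -compA (mulP T _ _ S' _ _).1 (mulP S _ _ S' _ _).1 -!compA.
  by rewrite -compA (mulP T _ _ S' _ _).2 (mulP S _ _ S' _ _).2 -!compA.
have injv T (r r' : hom T (U A)) : v \oc r = v \oc r' -> r = r'.
  by move=> e; have [w [_ uw]] := ev' T _ (hv T r'); rewrite -(uw r) // -(uw r').
exists A, (fun T a x => fw T (v \oc a) x); split.
- by move=> S S' h r z; rewrite nfw compA.
- by move=> T a x y; have /PE [_ _ h] := hv T a; have := h _ (idc T) x y; rewrite compf1.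
- move=> T a b x; split.
    by have := (mulP T (v \oc a) (v \oc b) T (idc T) x).1; rewrite -vM !compf1.
  (* The unit acts idempotently, since it equals its own square, and invertibly, hence trivially. *)
  have := (mulP T (v \oc e_) (v \oc e_) T (idc T) x).1; rewrite -vM gmul1l !compf1 => e.
  have /PE [_ a2 _] := hv T e_.
  have h z : bw T (v \oc e_) (fw T (v \oc e_) z) = z.
    by have := a2 T (idc T) z; rewrite compf1.
  by rewrite -[LHS]h -e h.
(* The inverse stored in a point is determined by the forward action, so agreement of the actions
   suffices. *)
- move=> T a b e.
  have e1 S (h : hom S T) x : fw S (v \oc a \oc h) x = fw S (v \oc b \oc h) x.
    by have := e S h x; rewrite !compA.
  apply: injv; apply: ext => // S h x.
  have /PE [a1 a2 _] := hv T a; have /PE [b1 b2 _] := hv T b.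
  by rewrite -{1}(b1 S h x) -e1 a2.
move=> T f g nf ng fg gf fM.
have [e he] := mkE T f g nf ng.
have [|a [ha _]] := ev' T e.
  by apply/PE; split=> S h *; rewrite ?(he S h _).1 ?(he S h _).2 ?(he S h _).1.
by exists a => S h x; rewrite compA ha (he S h x).1.
Qed.

End Automorphisms.

Section Semidirect.
Variables (X A : D) (ac : family (U A) (U X) (U X)).
Arguments ac : clear implicits.
Hypotheses (nac : natural_family ac)
  (acM : forall T a x y, ac T a (x ** y) = ac T a x ** ac T a y)
  (acA : forall T a b x, ac T (a ** b) x = ac T a (ac T b x))
  (ac1 : forall T x, ac T e_ x = x).

Lemma ac_one T a : ac T a e_ = e_.
Proof. by apply: gmul_idem; rewrite -acM gmul1l. Qed.

Lemma ac_inv T a x : ac T a (iv x) = iv (ac T a x).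
Proof. by apply: ginv_uniq; rewrite -acM gmulVr ac_one. Qed.

(** [sx] and [pr] are the two coordinates. The first is kept as a natural operation on points
    because it is multiplicative only up to the action, and so is not a morphism of [D]. *)
Lemma semidirect_ex : exists (S : D) (pr : hom S A) (sx : forall T, hom T (U S) -> hom T (U X)),
  [/\ forall T T' (h : hom T' T) r, sx T r \oc h = sx T' (r \oc h),
    forall T r r', sx T (r ** r') = sx T r ** ac T (pr $ r) (sx T r'),
    forall T (r r' : hom T (U S)), sx T r = sx T r' -> pr $ r = pr $ r' -> r = r' &
    forall T x a, exists r : hom T (U S), sx T r = x /\ pr $ r = a].
Proof.
pose F := fst_ cart (U X) (U A); pose V := snd_ cart (U X) (U A).
pose mk T (x : hom T (U X)) (a : hom T (U A)) := pair_ cart x a.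
have Fm T x a : F \oc mk T x a = x := fst_pair _ _ _.
have Vm T x a : V \oc mk T x a = a := snd_pair _ _ _.
have [|||||||| S [v [[hv ev'] vM]]] := @group_representable (prd cart (U X) (U A)) (fun _ _ => True)
  (fun T r r' => mk T ((F \oc r) ** ac T (V \oc r) (F \oc r')) ((V \oc r) ** (V \oc r')))
  (fun T => mk T e_ e_)
  (fun T r => mk T (ac T (iv (V \oc r)) (iv (F \oc r))) (iv (V \oc r))).
- by exists (prd cart (U X) (U A)), (idc _); apply: represents_all.
- by [].
- by [].
- by [].
- move=> T a b c _ _ _; apply: pairE; first by rewrite !Fm !Vm acM acA gmulA.
  by rewrite !Vm gmulA.
- move=> T a _; apply: pairE; first by rewrite !Fm !Vm ac1 gmul1l.
  by rewrite !Vm gmul1l.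
- move=> T a _; apply: pairE; first by rewrite !Fm !Vm ac_inv gmulVl.
  by rewrite !Vm gmulVl.
- move=> T R h a b _ _; apply: pairE.
    by rewrite compA !Fm gmul_nat nac !compA.
  by rewrite compA !Vm gmul_nat !compA.
have [|pr hpr] := @ulift _ _ M S A (V \oc v).
  by move=> T a b; rewrite -!compA vM Vm.
exists S, pr, (fun T r => F \oc (v \oc r)); split.
- by move=> T T' h r; rewrite !compA.
- by move=> T r r'; rewrite vM Fm hpr -!compA.
- move=> T r r' e1 e2; have [w [_ uw]] := ev' T (v \oc r') I.
  have e : v \oc r = v \oc r'.
    by apply: pairE; [exact: e1|rewrite !compA -hpr].
  by rewrite -(uw r) // -(uw r').
move=> T x a; have [r [hr _]] := ev' T (mk T x a) I.
by exists r; rewrite hpr -compA hr Fm Vm.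
Qed.

End Semidirect.

Theorem action_representable_groups : action_representable D.
Proof.
have [Z0 _] := zero_object_ex.
split=> [||Z pb X]; [by constructor|exact: finitely_complete_groups|].
have [A [ac [nac acM acA0 acE acmk]]] := automorphisms_ex X.
have acA T a b x : ac T (a ** b) x = ac T a (ac T b x) := (acA0 T a b x).1.
have ac1 T x : ac T e_ x = x := (acA0 T e_ e_ x).2.
have [S [pr [sx [nsx sxM sxE sxmk]]]] := semidirect_ex nac acM acA ac1.
have prE T (a b : hom T (U S)) : pr $ (a ** b) = (pr $ a) ** (pr $ b) by rewrite umap_mul.
have [k0 [k0x k0p]] := sxmk (U X) (idc _) e_.
have [|ka hka] := @ulift _ _ M X S k0.
  move=> T a b; apply: sxE; first by rewrite sxM compA k0p gone_nat ac1 -!nsx k0x !comp1f.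
  by rewrite umap_mul !compA k0p !gone_nat gmul1l.
have kax T (x : hom T (U X)) : sx T (ka $ x) = x by rewrite hka -nsx k0x comp1f.
have kap T (x : hom T (U X)) : pr $ (ka $ x) = e_ by rewrite hka compA k0p gone_nat.
have [s0 [s0x s0p]] := sxmk (U A) e_ (idc _).
have [|si hsi] := @ulift _ _ M A S s0.
  move=> T a b; apply: sxE.
    by rewrite sxM -!nsx s0x !gone_nat gmul1l (ac_one acM).
  by rewrite umap_mul !compA s0p !comp1f.
have six T (a : hom T (U A)) : sx T (si $ a) = e_ by rewrite hsi -nsx s0x gone_nat.
have sip T (a : hom T (U A)) : pr $ (si $ a) = a by rewrite hsi compA s0p comp1f.
have sconj T a (x : hom T (U X)) : (si $ a) ** (ka $ x) ** iv (si $ a) = ka $ ac T a x.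
  apply: sxE; last by rewrite !usimp !sip !kap !gsimp.
  by rewrite -umap_inv !sxM !six !kax (ac_one acM) sip gmul1l gmul1r.
have split_pr : pr \oc si = idc A.
  by apply: umap_ext => T a; rewrite umap_compE sip umap_idE.
have ker_pr : is_kernel Z ka pr.
  split=> [|T g eg].
    by apply: umap_ext => T x; rewrite umap_compE kap umap_zero.
  have gp T' (y : hom T' (U T)) : pr $ (g $ y) = e_ by rewrite -umap_compE eg umap_zero.
  (* On points with trivial second coordinate the first coordinate is multiplicative, since the unit
     of [A] acts trivially. *)
  have [|h hh] := @ulift _ _ M T X (sx _ (umap M g)).
    by move=> T' a b; rewrite !nsx umap_mul sxM gp ac1.
  exists h; split.
    apply: umap_ext => T' y; rewrite umap_compE; apply: sxE; last by rewrite kap gp.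
    by rewrite kax hh nsx.
  move=> h' e; apply: umap_ext => T' y.
  by rewrite hh nsx -e umap_compE kax.
pose SE := @SplExt D Z X A (Point split_pr) ka ker_pr.
pose univ : splext_presheaf Z pb X A := class_of SE.
have pmE B (u : hom B A) : pmap u univ = class_of (se_pull pb u SE).
  exact: splext_pmapE.
(* In [E], conjugation by the section acts on the kernel; a cartesian map over [w] carries it to
   conjugation by [si] in the semidirect product, which is the action of [w]. So [E] alone
   determines the classifying morphism. *)
have inj_cart B (u v : hom B A) (E : splext Z X B) (l1 l2 : hom E SE) :
    se_cart u l1 -> se_cart (E' := E) v l2 -> u = v.
  move=> c1 c2; apply: umap_ext => T b; apply: acE => T' h x.
  have [kp km] := kernel_points (se_is_ker E).
  have pt_ T1 (c : hom T1 (U B)) : pt_proj E $ (pt_sec E $ c) = c.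
    by rewrite -umap_compE pt_split umap_idE.
  pose y := (pt_sec E $ (b \oc h)) ** (se_ker E $ x) ** iv (pt_sec E $ (b \oc h)).
  have [|x' [hx' _]] := km T' y; first by rewrite !usimp kp pt_ !gsimp.
  have key (w : hom B A) (l : hom E SE) : se_cart w l -> x' = ac T' (w $ (b \oc h)) x.
    move=> c; rewrite -(kax _ x') -[ka](sc_ker c) umap_compE hx' !usimp.
    have ls : l $ (pt_sec E $ (b \oc h)) = si $ (w $ (b \oc h)).
      by rewrite -!umap_compE (sc_sec c).
    have lk : l $ (se_ker E $ x) = ka $ x by rewrite -umap_compE (sc_ker c).
    by rewrite ls lk sconj kax.
  by rewrite -!umapA -(key _ _ c1) (key _ _ c2).
(* [u] sends b to conjugation by t(b) on the kernel, and [l] sends y to the pair with coordinates y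
   t(p y)^-1 and u(p y). It is cartesian because y is recovered as the product of its kernel part
   and t(p y). *)
have surj B (E : splext Z X B) : exists (u : hom B A) (l : hom E SE), se_cart u l.
  have [kp km] := kernel_points (se_is_ker E).
  pose p := pt_proj E; pose t := pt_sec E; pose ke := se_ker E.
  have pt_ T (c : hom T (U B)) : p $ (t $ c) = c.
    by rewrite -umap_compE pt_split umap_idE.
  have kex T (y : hom T (U E)) : p $ y = e_ -> exists x : hom T (U X), ke $ x = y.
    by move=> /km [x [hx _]]; exists x.
  have keinj T (x x' : hom T (U X)) : ke $ x = ke $ x' -> x = x'.
    move=> e; have [w [_ uw]] := km T (ke $ x') (kp T x').
    by rewrite -(uw x) // -(uw x').
  have cex T (b : hom T (U B)) x : exists x', ke $ x' = (t $ b) ** (ke $ x) ** iv (t $ b).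
    by apply: kex; rewrite !usimp kp pt_ !gsimp.
  pose cj T b x := projT1 (cid (cex T b x)).
  have cjE T b x : ke $ cj T b x = (t $ b) ** (ke $ x) ** iv (t $ b) :=
    projT2 (cid (cex T b x)).
  have ncj : natural_family cj.
    move=> T T' h b x; apply: keinj.
    by rewrite compA !cjE !gmul_nat !ginv_nat -!compA.
  have [||||| u0 hu0] := acmk (U B) cj (fun T b x => cj T (iv b) x).
  - exact: ncj.
  - by move=> T T' h b x; rewrite ncj ginv_nat.
  - by move=> T b x; apply: keinj; rewrite !cjE !usimp !gsimp.
  - by move=> T b x; apply: keinj; rewrite !cjE !usimp !gsimp.
  - by move=> T b x y; apply: keinj; rewrite !(umap_mul, cjE) !gsimp.
  have [|u hu] := @ulift _ _ M B A u0.
    move=> T b b'; apply: acE => T' h x; rewrite -compA !gmul_nat acA -!compA !hu0.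
    by apply: keinj; rewrite !cjE !usimp !gsimp.
  have hu' T (b : hom T (U B)) x : ac T (u $ b) x = cj T b x by rewrite hu hu0.
  have dex T (y : hom T (U E)) : exists x, ke $ x = y ** iv (t $ (p $ y)).
    by apply: kex; rewrite !usimp pt_ gmulVr.
  pose d T y := projT1 (cid (dex T y)).
  have dE T y : ke $ d T y = y ** iv (t $ (p $ y)) := projT2 (cid (dex T y)).
  have nd T T' (h : hom T' T) y : d T y \oc h = d T' (y \oc h).
    by apply: keinj; rewrite compA !dE gmul_nat ginv_nat -!compA.
  have [l0 [l0x l0p]] := sxmk (U E) (d _ (idc _)) (u $ umap M p).
  have l0x' T (y : hom T (U E)) : sx T (l0 \oc y) = d T y by rewrite -nsx l0x nd comp1f.
  have l0p' T (y : hom T (U E)) : pr $ (l0 \oc y) = u $ (p $ y) by rewrite compA l0p -compA.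
  have [|l hl] := @ulift _ _ M E S l0.
    move=> T y y'; apply: sxE; last by rewrite umap_mul !l0p' !usimp.
    rewrite sxM !l0x' l0p' hu'; apply: keinj.
    by rewrite umap_mul cjE !dE !usimp !gsimp.
  have lx T (y : hom T (U E)) : sx T (l $ y) = d T y by rewrite hl l0x'.
  have lp T (y : hom T (U E)) : pr $ (l $ y) = u $ (p $ y) by rewrite hl l0p'.
  have linj T (y y' : hom T (U E)) : p $ y = p $ y' -> l $ y = l $ y' -> y = y'.
    move=> e1 e2; have := dE T y; rewrite -lx e2 lx dE e1 => e.
    by rewrite -(gmulKV (ugrp M E) y (t $ (p $ y'))) -e gmulKV.
  have lmk T (b : hom T (U B)) (r : hom T (U S)) : u $ b = pr $ r ->
      exists y : hom T (U E), p $ y = b /\ l $ y = r.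
    move=> e; exists ((ke $ sx T r) ** (t $ b)).
    have py : p $ ((ke $ sx T r) ** (t $ b)) = b by rewrite umap_mul kp pt_ gmul1l.
    split=> //; apply: sxE; last by rewrite lp py.
    by rewrite lx; apply: keinj; rewrite dE py gmulK.
  exists u, l; split.
  - by apply: umap_ext => T y; rewrite !umap_compE lp.
  - apply: umap_ext => T b; rewrite !umap_compE; apply: sxE; last by rewrite lp sip pt_.
    by rewrite lx six; apply: keinj; rewrite dE pt_ gmulVr umap_one.
  - apply: umap_ext => T x; rewrite !umap_compE; apply: sxE; last by rewrite lp kap kp umap_one.
    by rewrite lx kax; apply: keinj; rewrite dE kp !umap_one !gsimp.
  move=> T a b e.
  have [|w0 [w1 w2]] := lmk (U T) (umap M a) (umap M b); first by rewrite -!umap_comp e.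
  have [|w hw] := @ulift _ _ M T E w0.
    move=> T' c c'; apply: linj; first by rewrite umap_mul !compA w1 umap_mul.
    by rewrite umap_mul !compA w2 umap_mul.
  have e1 : p \oc w = a by apply: (@umap_inj _ _ M); rewrite umap_comp hw w1.
  have e2 : l \oc w = b by apply: (@umap_inj _ _ M); rewrite umap_comp hw w2.
  exists w; split=> // w' [e1' e2']; apply: umap_ext => T' c; apply: linj.
    by rewrite -!umap_compE e1 e1'.
  by rewrite -!umap_compE e2 e2'.
exists A, (fun B u => pmap u univ); split=> [B|B B' f u]; last exact: pmapM.
have inj (u v : hom B A) : pmap u univ = pmap v univ -> u = v.
  rewrite !pmE => /class_ofP /splext_iso_cart [h hc].
  have := se_cart_comp (se_pull_cart pb v SE) hc; rewrite compf1 => c2.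
  exact: (inj_cart _ _ _ _ _ _ (se_pull_cart pb u SE) c2).
have sur (c : splext_presheaf Z pb X B) : exists u : hom B A, pmap u univ = c.
  have [u [l hl]] := surj B (class_repr c); exists u.
  rewrite pmE -[c in RHS]class_reprK; apply/class_ofP.
  exact: se_cart_iso (se_pull_cart pb u SE) hl.
exists (fun c => projT1 (cid (sur c))) => [u|c]; last exact: (projT2 (cid (sur c))).
by apply: inj; apply: (projT2 (cid (sur _))).
Qed.

End GroupObjects.

(** * Color Hopf algebras as group objects *)

Section Instance.
Variables (G : zmodType) (k : fieldType) (phi : G -> G -> k).
Hypothesis hphi : commutation_factor phi.
Local Notation coalg := (coalg phi).
Local Notation cprod := (cprod hphi).
Local Notation cpair := (cpair hphi).
Local Notation cfst := (cfst hphi).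
Local Notation csnd := (csnd hphi).
Local Notation cmap := (cmap hphi).
Local Notation cunit := (cunit hphi).

Lemma coc_exp_eq (Y K W : coalg) (al be : chom K W) :
  exists (E : coalg) (u : chom (cprod E Y) K), chom_comp al u = chom_comp be u /\
    forall (T : coalg) (f : chom (cprod T Y) K), chom_comp al f = chom_comp be f ->
    exists! h : chom T E, chom_comp u (cpair (chom_comp h (cfst T Y)) (csnd T Y)) = f.
Proof.
have [E [u hu]] := exp_representable hphi Y al be.
have mapE T (h : chom T E) :
    cpair (chom_comp h (cfst T Y)) (csnd T Y) = cmap h (chom_id Y).
  by rewrite cmap_pair; congr (cpair _ _); apply: chom_eq.
exists E, (sval u); split=> [|T f e]; first exact: (proj2_sig u).
have [h [hh uh]] := hu T (exist _ f e); exists h; split=> [|h' e'].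
  by rewrite mapE -[RHS]/(sval (exist (fun f => chom_comp al f = chom_comp be f) f e)) -hh.
apply: uh; apply: exp_ext => t y.
by rewrite -[RHS]/(f (t \ot y)) -e' mapE.
Qed.

Definition coc_cartesian : cartesian (Coc phi) :=
  @Cartesian (Coc phi) cunit (cterm hphi) (@cterm_uniq _ _ _ hphi)
    (fun X Y => cprod X Y) (fun X Y => cfst X Y) (fun X Y => csnd X Y)
    (fun T X Y f g => cpair f g) (fun T X Y f g => cfst_pair hphi f g)
    (fun T X Y f g => csnd_pair hphi f g) (fun T X Y h => cpair_eta h) coc_exp_eq.

(** * The convolution group of a cocommutative color Hopf algebra *)

Section HopfGroup.
Variable H : coc_hopf phi.

Definition hopf_coalg : coalg :=
  @Coalg _ _ phi (ga_gvect H) (comul H) (counit H) (@comul_deg _ _ _ H)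
    (@counit_deg _ _ _ H) (@comulA _ _ _ H) (@comul_counitl _ _ _ H)
    (@comul_counitr _ _ _ H) (@coc_cocomm _ _ _ H).

Local Notation UH := hopf_coalg.

Fact hmul_graded : graded (V := gtensor UH UH) (W := UH) (@tmul k H).
Proof.
move=> g x hx; apply: (tensor_degP (V := UH) (W := UH)
  (S := fun x => gv_deg (g := UH) g (tmul (x : tensor H H))) hx).
- by rewrite linear0; apply: (deg0 UH).
- by move=> y z; rewrite linearD; apply: (@degD _ _ UH).
by move=> a b y z <- hy hz; rewrite tmul_pure; apply: (ga_degM hy hz).
Qed.

Fact hmul_comul x : cc_comul UH (tmul x) = tmap tmul tmul (cc_comul (cprod UH UH) x).
Proof.
move: x; apply: (span_ext (V := tensor UH UH) (f := comul H \o tmul)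
  (g := tmap tmul tmul \o cc_comul (cprod UH UH))); [by []|by []|span_solve|].
move=> _ [x [y [_ _ ->]]]; rewrite tmul_pure cprod_comulE tmap_pure.
exact: comulM.
Qed.

Fact hmul_counit x : cc_counit UH (tmul x) = cc_counit (cprod UH UH) x.
Proof.
move: x; apply: (span_ext_scalar (V := tensor UH UH) (f := counit H \o tmul)
  (g := cc_counit (cprod UH UH))); [by []|by []|span_solve|].
by move=> _ [x [y [_ _ ->]]]; rewrite tmul_pure cprod_counit_pure; apply: counitM.
Qed.

Definition hmul : chom (cprod UH UH) UH :=
  @CHom _ _ phi (cprod UH UH) UH (@tmul k H) hmul_graded hmul_comul hmul_counit.

Lemma hmul_pure (x y : H) : hmul ((x : UH) \ot (y : UH)) = x * y.
Proof. exact: tmul_pure. Qed.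

Definition hone_fun (x : cunit) : UH := (x : k) *: (1 : H).
Fact hone_linear : linear hone_fun.
Proof. by move=> a x y; rewrite /hone_fun scalerDl scalerA. Qed.
HB.instance Definition _ := GRing.isLinear.Build k cunit UH _ hone_fun hone_linear.

Fact hone_graded : graded (V := cunit) (W := UH) hone_fun.
Proof.
move=> g x [->|->]; last by rewrite linear0; apply: (deg0 UH).
by apply: (@deg_scale _ _ UH); apply: ga_deg1.
Qed.

Fact hone_comul x : cc_comul UH (hone_fun x) = tmap hone_fun hone_fun (cc_comul cunit x).
Proof.
rewrite /hone_fun linearZ_LR [cc_comul UH 1]comul1 [cc_comul cunit x]/(_ *: _) linearZ_LR.
rewrite tmap_pure; apply: (congr1 (fun t => (x : k) *: (t \ot t))).
by apply/esym/scale1r.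
Qed.

Fact hone_counit x : cc_counit UH (hone_fun x) = cc_counit cunit x.
Proof. by rewrite /hone_fun scalarZE [cc_counit UH 1]counit1 mulr1. Qed.

Definition hone : chom cunit UH :=
  @CHom _ _ phi cunit UH hone_fun hone_graded hone_comul hone_counit.

(* x (x) y |-> x_1 (x) g(x_2) y; g |-> twist g turns convolution into composition *)
Definition twist (g : {linear UH -> UH}) : {linear tensor UH UH -> tensor UH UH} :=
  tmap idfun (hmul \o tmap g idfun) \o (tassoc \o tmap (comul H) idfun).

Definition rmul (y x : UH) : UH := ((x : H) * (y : H) : H).
Fact rmul_linear y : linear (rmul y).
Proof. by move=> a x x'; rewrite /rmul mulrDl -scalerAl. Qed.
HB.instance Definition _ y := GRing.isLinear.Build k UH UH _ (rmul y) (rmul_linear y).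

Lemma twist_tmap g (r : {linear UH -> UH}) (w : tensor UH UH) :
  twist g (tmap idfun r w) =
  tmap idfun (hmul \o tmap g r) (tassoc (tmap (comul H) idfun w)).
Proof.
rewrite /twist !lcompE (tmap_comp (comul H) idfun).
rewrite (@eq_tmap _ _ _ _ _ _ (tmap idfun idfun \o comul H) _ (r \o idfun));
  [|by move=> x; rewrite /= tmap_id|by []].
rewrite -(tmap_comp (tmap idfun idfun)) tassoc_nat tmap_comp.
by apply: eq_tmap => // x; rewrite !lcompE (tmap_comp g).
Qed.

Lemma tmap_rmul g (r : {linear UH -> UH}) y (u : tensor UH UH) :
  hmul (tmap g (rmul y \o r) u) = rmul y (hmul (tmap g r u)).
Proof.
move: u; apply: (span_ext (f := hmul \o tmap g (rmul y \o r))
  (g := rmul y \o (hmul \o tmap g r))); [by []|by []|span_solve|].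
by move=> _ [x [z [_ _ ->]]]; rewrite !tmap_pure !hmul_pure /rmul /= mulrA.
Qed.

Lemma twist_pure g (x y : UH) : twist g (x \ot y) = tmap idfun (rmul y \o g) (comul H x).
Proof.
rewrite /twist !lcompE tmap_pure; move: (comul H x) => w.
move: w; apply: (span_ext (f := tmap idfun (hmul \o tmap g idfun) \o
  (tassoc \o tpurel y)) (g := tmap idfun (rmul y \o g))); [by []|by []|span_solve|].
move=> _ [x1 [x2 [_ _ ->]]]; rewrite tassoc_pure !tmap_pure lcompE tmap_pure hmul_pure.
by [].
Qed.

Definition hconv (g h : {linear UH -> UH}) : {linear UH -> UH} := hmul \o (tmap g h \o comul H).

(** By coassociativity both sides send x (x) y to x_1 (x) g(x_2) h(x_3) y. *)
Lemma twist_comp g h z : twist g (twist h z) = twist (hconv g h) z.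
Proof.
move: z; apply: (span_ext (f := twist g \o twist h) (g := twist (hconv g h)));
  [by []|by []|span_solve|].
move=> _ [x [y [_ _ ->]]]; rewrite !twist_pure twist_tmap.
rewrite [tassoc _](comulA (c := H)) tmap_comp; apply: eq_tmap => // t.
by rewrite !lcompE tmap_rmul.
Qed.

Lemma twist_unit (g : {linear UH -> UH}) (z : tensor UH UH) :
  (forall x : H, g x = counit H x *: (1 : H)) -> twist g z = z.
Proof.
move=> e; move: z; apply: (span_ext (f := twist g) (g := idfun));
  [by []|by []|span_solve|].
move=> _ [x [y [_ _ ->]]]; rewrite twist_pure /= -[x in RHS](comul_counitr x).
move: (comul H x); apply: (span_ext (f := tmap idfun (rmul y \o g))
  (g := tpurel y \o tcontractr (counit H))); [by []|by []|span_solve|].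
move=> _ [x1 [x2 [_ _ ->]]]; rewrite tmap_pure tcontractr_pure tpureZl -tpureZr /=.
by rewrite e /rmul -scalerAl mul1r.
Qed.

(** This is the shear map (x, y) |-> (x, x y). Written as a pairing of coalgebra morphisms, it is a
    coalgebra morphism itself. *)
Lemma twist_id (z : tensor UH UH) : twist idfun z = cpair (cfst UH UH) hmul z.
Proof.
rewrite -[RHS]/(tmap (cfst UH UH) hmul (cc_comul (cprod UH UH) z)) cprod_comulE.
have key (t : tensor (tensor UH UH) (tensor UH UH)) :
    tmap (cfst UH UH) hmul (tmiddle phi UH UH UH UH t) =
    tmap idfun hmul (tassoc (tmap idfun (tcontractl (counit H)) t)).
  move: t; apply: (span_ext (f := tmap (cfst UH UH) hmul \o tmiddle phi UH UH UH UH)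
    (g := tmap idfun hmul \o (tassoc \o tmap idfun (tcontractl (counit H)))));
    [by []|by []|span_solve|].
  move=> _ [_ [_ [[a [b [_ [g hb] ->]]] [c [d [[h hc] _ ->]]] ->]]].
  rewrite (tmiddleE _ _ _ hb hc) // linearZ_LR !tmap_pure tcontractl_pure.
  rewrite tpureZr linearZ_LR tassoc_pure linearZ_LR tmap_pure.
  rewrite [cfst UH UH _]tcontractr_pure tpureZl scalerA; congr (_ *: _).
  have [h0|h0] := eqVneq h 0; last by rewrite (counit_deg hc h0) mulr0.
  by rewrite h0 cf0r // mul1r.
rewrite key (tmap_comp idfun); move: z.
apply: (span_ext (f := twist idfun) (g := tmap idfun hmul \o (tassoc \o
  tmap (idfun \o comul H) (tcontractl (counit H) \o comul H)))); [by []|by []|span_solve|].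
move=> _ [x [y [_ _ ->]]]; rewrite twist_pure tmap_pure [X in _ \ot X](comul_counitl (c := H) y).
rewrite [X in X \ot _](_ : _ = comul H x) //.
move: (comul H x); apply: (span_ext (f := tmap idfun (rmul y \o idfun))
  (g := tmap idfun hmul \o (tassoc \o tpurel y))); [by []|by []|span_solve|].
by move=> _ [x1 [x2 [_ _ ->]]]; rewrite tassoc_pure !tmap_pure hmul_pure.
Qed.

Definition hid1 : chom UH (cprod UH UH) :=
  cpair (chom_id UH) (chom_comp hone (cterm hphi UH)).

Lemma hid1E x : hid1 x = x \ot (1 : H).
Proof.
rewrite -[LHS]/(tmap idfun (chom_comp hone (cterm hphi UH)) (comul H x)).
rewrite -[x in RHS](comul_counitr x); move: (comul H x).
apply: (span_ext (f := tmap idfun (chom_comp hone (cterm hphi UH)))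
  (g := tpurel (1 : UH) \o tcontractr (counit H))); [by []|by []|span_solve|].
by move=> _ [x1 [x2 [_ _ ->]]]; rewrite tmap_pure tcontractr_pure tpureZl -tpureZr.
Qed.

(** The inverse shear map sends (x, 1) to (x, x^-1), so the antipode is its second coordinate along
    [hid1]. *)
Lemma antipode_twist x : antipode H x = csnd UH UH (twist (antipode H) (hid1 x)).
Proof.
rewrite hid1E twist_pure [RHS]tcontractl_map /= -[x in LHS](comul_counitl x) /rmul mulr1.
by apply: congr1; apply: eq_tcontractl.
Qed.

(* The antipode is a coalgebra map because twist id is a coalgebra isomorphism,
   with inverse twist S. *)
Lemma antipode_comul x :
  comul H (antipode H x) = tmap (antipode H) (antipode H) (comul H x).
Proof.
pose Th := cpair (cfst UH UH) hmul; pose Th' := twist (antipode H).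
have ThTh' z : Th (Th' z) = z.
  rewrite -twist_id twist_comp; apply: twist_unit => y.
  exact: antipoder.
have Th'Th z : Th' (Th z) = z.
  rewrite -twist_id twist_comp; apply: twist_unit => y.
  exact: antipodel.
have Th'D z : cc_comul (cprod UH UH) (Th' z) = tmap Th' Th' (cc_comul (cprod UH UH) z).
  rewrite -{2}(ThTh' z) chom_comul tmap_comp -[LHS]tmap_id.
  by apply: eq_tmap => y; apply/esym/Th'Th.
have ThS y : (csnd UH UH \o (Th' \o hid1)) y = antipode H y by apply/esym/antipode_twist.
rewrite antipode_twist -[comul H _]/(cc_comul UH _) chom_comul Th'D chom_comul.
rewrite (tmap_comp Th') (tmap_comp (csnd UH UH)).
by apply: eq_tmap.
Qed.

Lemma antipode_counit x : counit H (antipode H x) = counit H x.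
Proof.
have := congr1 (counit H) (antipodel x); rewrite scalarZE counit1 mulr1 => <-.
rewrite -[x in LHS](comul_counitr x); move: (comul H x).
apply: (span_ext_scalar (f := counit H \o (antipode H \o tcontractr (counit H)))
  (g := counit H \o (tmul \o tmap (antipode H) idfun))); [by []|by []|span_solve|].
move=> _ [x1 [x2 [_ _ ->]]]; rewrite tcontractr_pure tmap_pure tmul_pure counitM.
by rewrite linearZ_LR scalarZE mulrC.
Qed.

Definition hinv : chom UH UH :=
  @CHom _ _ phi UH UH (antipode H) (@antipode_deg _ _ _ H) antipode_comul antipode_counit.

Definition hopf_mul (T : coalg) (a b : chom T UH) : chom T UH := chom_comp hmul (cpair a b).
Definition hopf_one (T : coalg) : chom T UH := chom_comp hone (cterm hphi T).
Definition hopf_inv (T : coalg) (a : chom T UH) : chom T UH := chom_comp hinv a.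

Lemma hopf_mulE T (a b : chom T UH) t : hopf_mul a b t = tmul (tmap a b (cc_comul T t)).
Proof. by []. Qed.

Lemma tmulA (t : tensor (tensor UH UH) UH) :
  hmul (tmap idfun hmul (tassoc t)) = hmul (tmap hmul idfun t).
Proof.
move: t; apply: (span_ext (f := hmul \o (tmap idfun hmul \o tassoc))
  (g := hmul \o tmap hmul idfun)); [by []|by []|span_solve|].
move=> _ [_ [z [[x [y [_ _ ->]]] _ ->]]].
by rewrite tassoc_pure !tmap_pure !hmul_pure mulrA.
Qed.

Fact hopf_mulA T (a b c : chom T UH) :
  hopf_mul a (hopf_mul b c) = hopf_mul (hopf_mul a b) c.
Proof.
apply: chom_eq => t.
have -> : hopf_mul a (hopf_mul b c) t =
    hmul (tmap idfun hmul (tmap a (tmap b c) (tmap idfun (cc_comul T) (cc_comul T t)))).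
  by rewrite (tmap_comp a) tmap_comp; congr (hmul _); apply: eq_tmap.
rewrite -cc_comulA -tassoc_nat tmulA (tmap_comp _ (cc_comul T)) tmap_comp.
by congr (hmul _); apply: eq_tmap.
Qed.

Fact hopf_mul1 T (a : chom T UH) : hopf_mul (hopf_one T) a = a.
Proof.
apply: chom_eq => t; rewrite hopf_mulE -[t in RHS](cc_counitl t); move: (cc_comul T t).
apply: (span_ext (f := tmul \o tmap (hopf_one T) a) (g := a \o tcontractl (cc_counit T)));
  [by []|by []|span_solve|].
move=> _ [x [y [_ _ ->]]]; rewrite tmap_pure tmul_pure tcontractl_pure linearZ_LR.
by rewrite -[hopf_one T x]/(cc_counit T x *: 1) -scalerAl mul1r.
Qed.

Fact hopf_mulV T (a : chom T UH) : hopf_mul (hopf_inv a) a = hopf_one T.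
Proof.
apply: chom_eq => t; rewrite hopf_mulE -[RHS]/(cc_counit T t *: 1) -(chom_counit a).
rewrite -[RHS]antipodel -[comul H _]/(cc_comul UH _) chom_comul tmap_comp.
by apply: congr1; apply: eq_tmap.
Qed.

Fact hopf_mul_nat T S (h : chom S T) (a b : chom T UH) :
  chom_comp (hopf_mul a b) h = hopf_mul (chom_comp a h) (chom_comp b h).
Proof.
apply: chom_eq => t; rewrite -[LHS]/(tmul (tmap a b (cc_comul T (h t)))).
by rewrite chom_comul tmap_comp; apply: congr1; apply: eq_tmap.
Qed.

Definition hopf_group : group_on (C := Coc phi) UH :=
  @GroupOn (Coc phi) UH hopf_mul hopf_one hopf_inv hopf_mulA hopf_mul1 hopf_mulV hopf_mul_nat.

End HopfGroup.

(** * Hopf algebra morphisms as homomorphisms of group objects *)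

Section HopfMap.
Variables H K : coc_hopf phi.

Definition hopf_map (f : color_hom H K) : chom (hopf_coalg H) (hopf_coalg K) :=
  @CHom _ _ phi (hopf_coalg H) (hopf_coalg K) (f : {linear H -> K})
    (@ch_fun_deg _ _ _ _ _ f) (@ch_fun_comul _ _ _ _ _ f) (@ch_fun_counit _ _ _ _ _ f).

Lemma hopf_map_inj (f g : color_hom H K) : hopf_map f = hopf_map g -> f = g.
Proof.
move=> e; apply: color_hom_eq => x.
exact: (congr1 (fun h : chom (hopf_coalg H) (hopf_coalg K) => h x) e).
Qed.

Lemma hopf_map_mul (f : color_hom H K) (T : coalg) (a b : chom T (hopf_coalg H)) :
  chom_comp (hopf_map f) (hopf_mul a b) =
  hopf_mul (chom_comp (hopf_map f) a) (chom_comp (hopf_map f) b).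
Proof.
apply: chom_eq => t; rewrite -[LHS]/(f (tmul (tmap a b (cc_comul T t)))) hopf_mulE.
move: (cc_comul T t); apply: (span_ext (f := f \o (tmul \o tmap a b))
  (g := tmul \o tmap (chom_comp (hopf_map f) a) (chom_comp (hopf_map f) b)));
  [by []|by []|span_solve|].
by move=> _ [x [y [_ _ ->]]]; rewrite !tmap_pure !tmul_pure rmorphM.
Qed.

Section Lift.
Variable h : chom (hopf_coalg H) (hopf_coalg K).
Hypothesis h_mul : forall T (a b : chom T (hopf_coalg H)),
  chom_comp h (hopf_mul a b) = hopf_mul (chom_comp h a) (chom_comp h b).

Definition lift_fun (x : H) : K := h (x : hopf_coalg H).
Fact lift_linear : linear lift_fun. Proof. exact: linearP. Qed.
HB.instance Definition _ := GRing.isLinear.Build k H K _ lift_fun lift_linear.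

Fact lift_monoid : monoid_morphism lift_fun.
Proof.
split.
  have e : chom_comp h (hopf_one H cunit) = hopf_one K cunit.
    apply: (gmul_idem (g := hopf_group K)); rewrite -[gmul _ _ _]h_mul.
    congr (chom_comp h _); exact: (hopf_mul1 (hopf_one H cunit)).
  have := congr1 (fun f : chom cunit (hopf_coalg K) => f (kone G k)) e.
  by rewrite /= /hone_fun /kterm /= !scale1r.
pose UH := hopf_coalg H; move=> x y.
(* Yoneda: [h_mul] is applied to the generic pair of points, the two projections of [H (x) H], whose
   pairing is the identity. *)
have e : chom_comp h (hmul H) = chom_comp (hmul K) (cmap h h).
  rewrite cmap_pair -[RHS]h_mul; congr (chom_comp h _).
  apply: chom_eq => z; apply: congr1.
  have := cpair_eta (chom_id (cprod UH UH)).
  by move=> /(congr1 (fun f : chom (cprod UH UH) (cprod UH UH) => f z)).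
have := congr1 (fun f : chom (cprod UH UH) (hopf_coalg K) => f ((x : UH) \ot (y : UH))) e.
rewrite -[X in X = _ -> _]/(h (hmul H ((x : UH) \ot (y : UH)))) hmul_pure => ->.
by rewrite -[LHS]/(hmul K (cmap h h ((x : UH) \ot (y : UH)))) cmap_pure hmul_pure.
Qed.
HB.instance Definition _ := GRing.isMonoidMorphism.Build H K lift_fun lift_monoid.

Definition lift_hom : color_hom H K :=
  @ColorHom _ _ phi H K lift_fun (@chom_deg _ _ _ _ _ h) (@chom_comul _ _ _ _ _ h)
    (@chom_counit _ _ _ _ _ h).

Lemma lift_homE : hopf_map lift_hom = h.
Proof. exact: chom_eq. Qed.

End Lift.
End HopfMap.

Lemma chom_compA (T S R Q : coalg) (h : chom R Q) (f : chom S R) (e : chom T S) :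
  chom_comp h (chom_comp f e) = chom_comp (chom_comp h f) e.
Proof. exact: chom_eq. Qed.

(** * The Hopf algebra of a group object *)

Section BuildHopf.
Variables (E : coalg) (g : group_on (C := Coc phi) E).

Definition gm : chom (cprod E E) E := gmul g (cfst E E : @hom (Coc phi) (cprod E E) E) (csnd E E).
Definition ge : chom cunit E := gone g (cunit : Coc phi).
Definition gi : chom E E := ginv g (chom_id E : @hom (Coc phi) E E).

Lemma gmulE (T : coalg) (a b : chom T E) :
  gmul g (a : @hom (Coc phi) T E) b = chom_comp gm (cpair a b).
Proof.
apply/esym; apply: etrans (gmul_nat g (cpair a b : @hom (Coc phi) T (cprod E E)) _ _) _.
by congr (gmul g _ _); [apply: cfst_pair|apply: csnd_pair].
Qed.

(** Associativity on points is applied to the generic triple [a], [b], [c] of projections of E (x) E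
    (x) E; the rest identifies the resulting pairings with [cmap] and the associator, so that both
    sides can be evaluated at pure tensors. *)
Lemma gm_assoc x y z : gm (gm (x \ot y) \ot z) = gm (x \ot gm (y \ot z)).
Proof.
pose T := cprod (cprod E E) E.
pose a : chom T E := chom_comp (cfst E E) (cfst (cprod E E) E).
pose b : chom T E := chom_comp (csnd E E) (cfst (cprod E E) E).
pose c : chom T E := csnd (cprod E E) E.
have e1 : cpair a b = cfst (cprod E E) E by apply/esym/cpair_eta.
have e2 : cpair (chom_comp gm (cpair a b)) c = cmap gm (chom_id E).
  by rewrite e1 cmap_pair; congr (cpair _ _); apply: chom_eq.
have ea : chom_comp (cfst E (cprod E E)) (cassoc hphi E E E) = a.
  apply: chom_eq; apply: (span_ext (V := tensor (tensor E E) E)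
    (f := chom_comp (cfst E (cprod E E)) (cassoc hphi E E E)) (g := a));
    [by []|by []|span_solve|].
  move=> _ [_ [t [[u [v [_ _ ->]]] _ ->]]].
  rewrite -[LHS]/(tcontractr (cc_counit (cprod E E)) (tassoc ((u \ot v) \ot t))).
  rewrite -[RHS]/(tcontractr (cc_counit E) (tcontractr (cc_counit E) ((u \ot v) \ot t))).
  rewrite tassoc_pure !tcontractr_pure cprod_counit_pure linearZ_LR tcontractr_pure.
  by rewrite scalerA mulrC.
have ebc : chom_comp (csnd E (cprod E E)) (cassoc hphi E E E) = cpair b c.
  rewrite [LHS]cpair_eta; congr (cpair _ _); apply: chom_eq.
    apply: (span_ext (V := tensor (tensor E E) E)
      (f := chom_comp (cfst E E) (chom_comp (csnd E (cprod E E)) (cassoc hphi E E E)))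
      (g := b)); [by []|by []|span_solve|].
    move=> _ [_ [t [[u [v [_ _ ->]]] _ ->]]].
    rewrite -[LHS]/(tcontractr (cc_counit E) (tcontractl (cc_counit E) (tassoc ((u \ot v) \ot t)))).
    rewrite -[RHS]/(tcontractl (cc_counit E) (tcontractr (cc_counit E) ((u \ot v) \ot t))).
    rewrite tassoc_pure tcontractl_pure tcontractr_pure !linearZ_LR.
    by rewrite tcontractl_pure tcontractr_pure !scalerA mulrC.
  apply: (span_ext (V := tensor (tensor E E) E)
      (f := chom_comp (csnd E E) (chom_comp (csnd E (cprod E E)) (cassoc hphi E E E)))
      (g := c)); [by []|by []|span_solve|].
  move=> _ [_ [t [[u [v [_ _ ->]]] _ ->]]].
  rewrite -[LHS]/(tcontractl (cc_counit E) (tcontractl (cc_counit E) (tassoc ((u \ot v) \ot t)))).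
  rewrite -[RHS]/(tcontractl (cc_counit (cprod E E)) ((u \ot v) \ot t)).
  rewrite tassoc_pure !tcontractl_pure cprod_counit_pure linearZ_LR tcontractl_pure.
  by rewrite scalerA.
have e3 : cpair a (chom_comp gm (cpair b c)) =
    chom_comp (cmap (chom_id E) gm) (cassoc hphi E E E).
  rewrite [RHS]cpair_eta cmap_pair; congr (cpair _ _).
    rewrite chom_compA cfst_pair -ea.
    exact: chom_eq.
  rewrite chom_compA csnd_pair -ebc.
  exact: chom_eq.
have := gmulA g (a : @hom (Coc phi) T E) b c.
rewrite !gmulE e2 e3 => /(congr1 (fun f : chom T E => f ((x \ot y) \ot z))).
rewrite -[X in X = _ -> _]/(gm (cmap (chom_id E) gm (tassoc ((x \ot y) \ot z)))).
rewrite -[X in _ = X -> _]/(gm (cmap gm (chom_id E) ((x \ot y) \ot z))).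
by rewrite tassoc_pure !cmap_pure => ->.
Qed.

Lemma gone_term (T : coalg) : gone g (T : Coc phi) = chom_comp ge (cterm hphi T).
Proof. exact/esym/(gone_nat g (cterm hphi T : @hom (Coc phi) T cunit)). Qed.

Lemma ge_term (T : coalg) t : chom_comp ge (cterm hphi T) t = cc_counit T t *: ge (kone G k).
Proof.
rewrite -linearZ_LR -[LHS]/(ge (kterm t)); apply: (congr1 ge).
by apply/esym; apply: mulr1.
Qed.

Lemma gm_1l x : gm (ge (kone G k) \ot x) = x.
Proof.
have := gmul1l g (chom_id E : @hom (Coc phi) E E); rewrite gmulE gone_term.
move=> /(congr1 (fun f : chom E E => f x)); apply: etrans; apply: (congr1 gm).
rewrite -[RHS]/(tmap (chom_comp ge (cterm hphi E)) (chom_id E) (cc_comul E x)).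
rewrite -[x in LHS](cc_counitl x); move: (cc_comul E x).
apply: (span_ext (f := tpurer (ge (kone G k)) \o tcontractl (cc_counit E))
  (g := tmap (chom_comp ge (cterm hphi E)) (chom_id E))); [by []|by []|span_solve|].
move=> _ [u [v [_ _ ->]]]; rewrite tcontractl_pure tmap_pure ge_term.
by rewrite tpureZl tpureZr.
Qed.

Lemma gm_1r x : gm (x \ot ge (kone G k)) = x.
Proof.
have := gmul1r g (chom_id E : @hom (Coc phi) E E); rewrite gmulE gone_term.
move=> /(congr1 (fun f : chom E E => f x)); apply: etrans; apply: (congr1 gm).
rewrite -[RHS]/(tmap (chom_id E) (chom_comp ge (cterm hphi E)) (cc_comul E x)).
rewrite -[x in LHS](cc_counitr x); move: (cc_comul E x).
apply: (span_ext (f := tpurel (ge (kone G k)) \o tcontractr (cc_counit E))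
  (g := tmap (chom_id E) (chom_comp ge (cterm hphi E)))); [by []|by []|span_solve|].
move=> _ [u [v [_ _ ->]]]; rewrite tcontractr_pure tmap_pure ge_term.
by rewrite tpureZl tpureZr.
Qed.

Lemma gm_Vl x : gm (tmap gi (chom_id E) (cc_comul E x)) = cc_counit E x *: ge (kone G k).
Proof.
have := gmulVl g (chom_id E : @hom (Coc phi) E E); rewrite gmulE gone_term.
by rewrite -ge_term => /(congr1 (fun f : chom E E => f x)).
Qed.

Lemma gm_Vr x : gm (tmap (chom_id E) gi (cc_comul E x)) = cc_counit E x *: ge (kone G k).
Proof.
have := gmulVr g (chom_id E : @hom (Coc phi) E E); rewrite gmulE gone_term.
by rewrite -ge_term => /(congr1 (fun f : chom E E => f x)).
Qed.

(* The underlying module of an algType is not convertible to an abstract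
   lmodType, so the Hopf algebra built from g lives on a copy of E and its
   coproduct is transported along the identity maps hto and hof. *)
Definition hcar (_ : group_on (C := Coc phi) E) : Type := E.
HB.instance Definition _ := GRing.Lmodule.copy (hcar g) (gv_car (cc_gv E)).

Definition hcar_mul (x y : hcar g) : hcar g := gm ((x : E) \ot (y : E)).
Definition hcar_one : hcar g := ge (kone G k).

Fact hcar_mulA : associative hcar_mul. Proof. by move=> x y z; rewrite /hcar_mul gm_assoc. Qed.
Fact hcar_mul1r : left_id hcar_one hcar_mul. Proof. exact: gm_1l. Qed.
Fact hcar_mulr1 : right_id hcar_one hcar_mul. Proof. exact: gm_1r. Qed.
Fact hcar_mulDl : left_distributive hcar_mul +%R.
Proof.
by move=> x y z; rewrite /hcar_mul -[LHS]/(gm (((x : E) + (y : E)) \ot (z : E))) linearDl linearD.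
Qed.
Fact hcar_mulDr : right_distributive hcar_mul +%R.
Proof.
by move=> x y z; rewrite /hcar_mul -[LHS]/(gm ((x : E) \ot ((y : E) + (z : E)))) linearDr linearD.
Qed.

Lemma counit_ge : cc_counit E (ge (kone G k)) = 1. Proof. exact: chom_counit. Qed.

Fact hcar_oner_neq0 : hcar_one != 0.
Proof.
apply/eqP => e; have := counit_ge; rewrite -[ge _]/(hcar_one : E) e.
by rewrite -[cc_counit E _]/(cc_counit E (0 : E)) linear0 => /esym/eqP; rewrite oner_eq0.
Qed.

HB.instance Definition _ := GRing.Zmodule_isNzRing.Build (hcar g)
  hcar_mulA hcar_mul1r hcar_mulr1 hcar_mulDl hcar_mulDr hcar_oner_neq0.

Fact hcar_scalerAl (a : k) (x y : hcar g) : a *: (x * y) = (a *: x) * y.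
Proof.
rewrite -[RHS]/(gm ((a *: (x : E)) \ot (y : E))) tpureZl linearZ_LR.
by [].
Qed.
HB.instance Definition _ := GRing.Lmodule_isLalgebra.Build k (hcar g) hcar_scalerAl.

Fact hcar_scalerAr (a : k) (x y : hcar g) : a *: (x * y) = x * (a *: y).
Proof.
rewrite -[RHS]/(gm ((x : E) \ot (a *: (y : E)))) tpureZr linearZ_LR.
by [].
Qed.
HB.instance Definition _ := GRing.Lalgebra_isAlgebra.Build k (hcar g) hcar_scalerAr.

Definition hto (x : hcar g) : E := x.
Fact hto_linear : linear hto. Proof. by []. Qed.
HB.instance Definition _ := GRing.isLinear.Build k (hcar g) E _ hto hto_linear.

Definition hof (x : E) : hcar g := x.
Fact hof_linear : linear hof. Proof. by []. Qed.
HB.instance Definition _ := GRing.isLinear.Build k E (hcar g) _ hof hof_linear.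

Definition hdeg (a : G) : set (hcar g) := [set x | gv_deg a (hto x)].

Definition hproj (a : G) : {linear hcar g -> hcar g} := hof \o (gproj a \o hto).

Fact hgrading : is_grading hdeg.
Proof.
apply: (@mk_grading _ _ (hcar g) hdeg hproj) => [a c x y hx hy|a x|a b x hx|x|x].
- by rewrite /hdeg /= linearP; apply: (deg_lin (gv_grading E)).
- exact: (gcompP_deg (x : E) a).
- rewrite -[LHS]/(hof (gcomp (hto x) b)) (gcomp_homog hx).
  by case: ifP.
- by have [h _ _] := gcompP (x : E); exact: h.
- by have [_ _ h] := gcompP (x : E); exact: h.
Qed.

Fact hdeg1 : hdeg 0 (1 : hcar g).
Proof. exact: (@chom_deg _ _ _ _ _ ge _ _ (kdeg1 G k)). Qed.

Fact hdegM a b (x y : hcar g) : hdeg a x -> hdeg b y -> hdeg (a + b) (x * y).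
Proof.
by move=> hx hy; apply: (@chom_deg _ _ _ _ _ gm); apply: (deg_pure hx hy).
Qed.

Definition halg : galg G k := GAlg hgrading hdeg1 hdegM.

Definition hcomul : {linear halg -> tensor halg halg} :=
  tmap hof hof \o (cc_comul E \o hto).
Definition hcounit : {scalar halg} := cc_counit E \o hto.
Definition hantipode : {linear halg -> halg} := hof \o (gi \o hto).

Lemma hto_graded : graded (V := ga_gvect halg) (W := E) hto. Proof. by []. Qed.
Lemma hof_graded : graded (V := E) (W := ga_gvect halg) hof. Proof. by []. Qed.

Fact hcomul_deg a x : @ga_deg G k halg a x ->
  @tensor_deg G k (ga_gvect halg) (ga_gvect halg) a (hcomul x).
Proof.
move=> hx; apply: (tmap_graded hof_graded hof_graded).
exact: (cc_comul_deg (c := E) hx).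
Qed.

Fact hcounit_deg a x : @ga_deg G k halg a x -> a != 0 -> hcounit x = 0.
Proof. by move=> hx; apply: (cc_counit_deg (c := E) hx). Qed.

Fact hantipode_deg a x : @ga_deg G k halg a x -> @ga_deg G k halg a (hantipode x).
Proof. exact: (@chom_deg _ _ _ _ _ gi). Qed.

Fact hcomulA x : tassoc (tmap hcomul idfun (hcomul x)) = tmap idfun hcomul (hcomul x).
Proof.
rewrite -[hcomul x]/(tmap hof hof (cc_comul E x)) (tmap_comp hcomul) (tmap_comp idfun).
rewrite (@eq_tmap _ _ _ _ _ _ (tmap hof hof \o cc_comul E) _ (hof \o idfun)) //.
rewrite (@eq_tmap _ _ _ _ _ _ (hof \o idfun) _ (tmap hof hof \o cc_comul E)) //.
rewrite -(tmap_comp (tmap hof hof)) -(tmap_comp hof) tassoc_nat.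
by rewrite cc_comulA.
Qed.

Fact hcounitl x : tcontractl hcounit (hcomul x) = x.
Proof.
rewrite [LHS]tcontractl_map -[RHS]/(hof (x : E)) -[in RHS](cc_counitl (c := E) x).
by apply: (congr1 hof); apply: eq_tcontractl.
Qed.

Fact hcounitr x : tcontractr hcounit (hcomul x) = x.
Proof.
rewrite [LHS]tcontractr_map -[RHS]/(hof (x : E)) -[in RHS](cc_counitr (c := E) x).
by apply: (congr1 hof); apply: eq_tcontractr.
Qed.

Fact hcounit1 : hcounit 1 = 1. Proof. exact: counit_ge. Qed.

Fact hcounitM (x y : halg) : hcounit (x * y) = hcounit x * hcounit y.
Proof.
rewrite -[LHS]/(cc_counit E (gm ((x : E) \ot (y : E)))) chom_counit.
exact: cprod_counit_pure.
Qed.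

Fact hcomul1 : hcomul 1 = 1 \ot 1.
Proof.
rewrite -[LHS]/(tmap hof hof (cc_comul E (ge (kone G k)))) chom_comul.
by rewrite [cc_comul cunit _]kcomul1 !tmap_pure.
Qed.

Lemma tmul_hof t : tmul (tmap hof hof t : tensor halg halg) = hof (gm t).
Proof.
move: t; apply: (span_ext (f := (tmul : {linear tensor halg halg -> halg}) \o tmap hof hof)
  (g := hof \o gm)); [by []|by []|span_solve|].
by move=> _ [x [y [_ _ ->]]]; rewrite tmap_pure tmul_pure.
Qed.

Fact hcomulM (x y : halg) : hcomul (x * y) = color_mul phi (hcomul x) (hcomul y).
Proof.
rewrite -[LHS]/(tmap hof hof (cc_comul E (gm ((x : E) \ot (y : E))))) chom_comul.
rewrite cprod_comulE tmap_pure (tmap_comp hof).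
rewrite /color_mul -[hcomul x]/(tmap hof hof (cc_comul E x)).
rewrite -[hcomul y]/(tmap hof hof (cc_comul E y)) -(tmap_pure (tmap hof hof)).
rewrite -(@tmiddle_nat _ _ phi _ _ _ _ E (ga_gvect halg) E (ga_gvect halg) hof hof hof hof) //.
by rewrite (tmap_comp tmul); apply: eq_tmap => z; rewrite [RHS]tmul_hof.
Qed.

Fact hantipoder (x : halg) : tmul (tmap idfun hantipode (hcomul x)) = hcounit x *: 1.
Proof.
rewrite -[RHS]/(hof (cc_counit E x *: ge (kone G k))) -gm_Vr -tmul_hof.
rewrite -[hcomul x]/(tmap hof hof (cc_comul E x)) (tmap_comp idfun) (tmap_comp hof).
by apply: congr1; apply: eq_tmap.
Qed.

Fact hantipodel (x : halg) : tmul (tmap hantipode idfun (hcomul x)) = hcounit x *: 1.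
Proof.
rewrite -[RHS]/(hof (cc_counit E x *: ge (kone G k))) -gm_Vl -tmul_hof.
rewrite -[hcomul x]/(tmap hof hof (cc_comul E x)) (tmap_comp hantipode) (tmap_comp hof).
by apply: congr1; apply: eq_tmap.
Qed.

Definition hhopf : color_hopf phi :=
  @ColorHopf G k phi halg hcomul hcounit hantipode hcomul_deg hcounit_deg hantipode_deg
    hcomulA hcounitl hcounitr hcounit1 hcounitM hcomul1 hcomulM hantipoder hantipodel.

Fact hcocomm : cocommutative hhopf.
Proof.
move=> x; rewrite -[comul _ _]/(tmap hof hof (cc_comul E x)).
rewrite (@braid_nat _ _ phi E (ga_gvect halg) E (ga_gvect halg) hof hof) //.
by rewrite cc_comulC.
Qed.

Definition hobj : coc_hopf phi := CocHopf hcocomm.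

Fact hto_comul (x : hopf_coalg hobj) : cc_comul E (hto x) = tmap hto hto (cc_comul (hopf_coalg hobj) x).
Proof.
by rewrite -[cc_comul (hopf_coalg hobj) x]/(tmap hof hof (cc_comul E x)) tmap_comp -[LHS]tmap_id.
Qed.

Definition hobj_to : chom (hopf_coalg hobj) E :=
  @CHom _ _ phi (hopf_coalg hobj) E hto hto_graded hto_comul (fun=> erefl).
Definition hobj_of : chom E (hopf_coalg hobj) :=
  @CHom _ _ phi E (hopf_coalg hobj) hof hof_graded (fun=> erefl) (fun=> erefl).

Lemma hobj_to_mul (T : coalg) (a b : chom T (hopf_coalg hobj)) :
  chom_comp hobj_to (hopf_mul a b) =
  gmul g (chom_comp hobj_to a : @hom (Coc phi) T E) (chom_comp hobj_to b).
Proof.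
rewrite gmulE; apply: chom_eq => t.
rewrite -[LHS]/(hto (tmul (tmap a b (cc_comul T t)))).
rewrite -[RHS]/(gm (tmap (chom_comp hobj_to a) (chom_comp hobj_to b) (cc_comul T t))).
move: (cc_comul T t); apply: (span_ext (f := hto \o (tmul \o tmap a b))
  (g := gm \o tmap (chom_comp hobj_to a) (chom_comp hobj_to b))); [by []|by []|span_solve|].
by move=> _ [x [y [_ _ ->]]]; rewrite !tmap_pure tmul_pure.
Qed.

End BuildHopf.

Lemma hopf_lift (H K : coc_hopf phi) (f : chom (hopf_coalg H) (hopf_coalg K)) :
  (forall T (a b : chom T (hopf_coalg H)),
    chom_comp f (hopf_mul a b) = hopf_mul (chom_comp f a) (chom_comp f b)) ->
  exists f' : color_hom H K, hopf_map f' = f.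
Proof. by move=> hf; exists (lift_hom hf); apply: lift_homE. Qed.

Lemma hopf_obj (E : Coc phi) (g : group_on E) :
  exists (H : Hopf_coc phi) (i : @hom (Coc phi) (hopf_coalg H) E)
    (j : @hom (Coc phi) E (hopf_coalg H)),
  [/\ j \oc i = idc (hopf_coalg H : Coc phi), i \oc j = idc E &
    forall (T : Coc phi) (a b : @hom (Coc phi) T (hopf_coalg H)),
      i \oc gmul (hopf_group H) a b = gmul g (i \oc a) (i \oc b)].
Proof.
exists (hobj g), (hobj_to g), (hobj_of g); split; first exact: chom_eq.
  exact: chom_eq.
by move=> T a b; apply: hobj_to_mul.
Qed.

Definition hopf_groups : groups_in (Coc phi) (Hopf_coc phi) :=
  @GroupsIn (Coc phi) (Hopf_coc phi) hopf_coalg hopf_map hopf_map_inj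
    (fun H K L f g => @chom_eq _ _ _ _ _ (hopf_map (f \oc g)) (chom_comp (hopf_map f) (hopf_map g)) (fun=> erefl))
    (fun H => @chom_eq _ _ _ _ _ (hopf_map (idc H)) (chom_id _) (fun=> erefl))
    hopf_group hopf_map_mul hopf_lift hopf_obj.

End Instance.

Theorem proposition6p3 (G : zmodType) (k : fieldType) (phi : G -> G -> k)
  (hG : finitely_generated G)
  (hk : 2%N \notin [pchar k])
  (hphi : commutation_factor phi) :
  action_representable (Hopf_coc phi) /\
  locally_algebraically_cartesian_closed (Hopf_coc phi).
Proof.
split.
  exact: (action_representable_groups (coc_cartesian hphi) (hopf_groups hphi)).
exact: (lacc_groups (coc_cartesian hphi) (hopf_groups hphi)).
Qed.
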